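(* Let all parameters except $D>0$ be fixed, and let $\Lambda_D(\alpha)$, $c^*(D)$, $\Lambda_f(\alpha)$, $c_f^*$ be as in the context. Assume that $\sup_{D>0}\Lambda_D(0)<0$ and $\Lambda_f(0)<0$, that the domain is either annular or a ball, i.e. $\omega=B_R\setminus \overline{B_r}$ for some $R>r> 0$ or $\omega=B_R$ for some $R>0$, where $B_\rho\subset\mathbb{R}^N$ denotes the open ball centered at the origin with radius $\rho$, and that all heterogeneities are radial functions, in the sense that $$\kappa(y)=\kappa(|y|),\qquad \partial_v f(y,0)=\tilde f(|y|),\qquad \partial_u g(y,0)=\tilde g(|y|),$$ where $|y|$ denotes the Euclidean norm of $y$. Then $D\mapsto c^*(D)$ is (strictly) increasing on $(0,+\infty)$ and, in particular, there exists at most one value $D_0$ such that $c^*(D_0)=c_f^*$.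
   Context: Setting. $N\ge 1$; $\omega\subset\mathbb{R}^N$ is open, bounded, connected, with smooth boundary. $d,D,\mu,\nu>0$ are constants, $0<\beta<1$ is a Hölder exponent, and $\kappa\in C^{1,\beta}(\partial\omega)$ is nonnegative and not identically $0$. The functions $f\in C^{1,\beta}(\omega\times[0,+\infty))$ and $g\in C^{1,\beta}(\partial\omega\times[0,+\infty))$ satisfy: $f(\cdot,0)\equiv 0\equiv g(\cdot,0)$; $v\mapsto f(\cdot,v)/v$ is decreasing and $u\mapsto g(\cdot,u)/u$ is nonincreasing; there is $M>0$ such that for all $u,v\ge M$, $f(y,v)\le 0$ for all $y\in\omega$ and $g(y,u)\le0$ for all $y\in\partial\omega$. For $\alpha\in\mathbb{R}$ and $D>0$ the principal eigenvalue is $$\Lambda_D(\alpha)=\min\Big\{\mathcal{F}_D(\alpha)[U,V]:\ (U,V)\in H^1(\partial\omega)\times H^1(\omega),\ \int_{\partial\omega}U^2+\int_\omega V^2=1\Big\},$$ $$\mathcal{F}_D(\alpha)[U,V]=D\int_{\partial\omega}|\nabla U|^2-\int_{\partial\omega}(D\alpha^2+\partial_u g(y,0))U^2+d\int_\omega|\nabla V|^2-\int_\omega(d\alpha^2+\partial_v f(y,0))V^2+\int_{\partial\omega}\kappa(y)(\sqrt{\mu}U-\sqrt{\nu}V)^2$$ (traces of $V$ on $\partial\omega$; tangential gradient of $U$, absent when $N=1$). When $\Lambda_D(0)<0$, the spreading speed of the bulk-surface system ($\partial_t v=d\Delta v+f(y,v)$ in $\mathbb{R}\times\omega$, $d\,\partial_nv=\kappa(\mu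 u-\nu v)$ on $\mathbb{R}\times\partial\omega$, $\partial_tu=D\Delta u+g(y,u)+\kappa(\nu v-\mu u)$ on $\mathbb{R}\times\partial\omega$) is $$c^*(D)=\min_{\alpha>0}\frac{-\Lambda_D(\alpha)}{\alpha}.$$ For the bulk equation alone with Neumann boundary conditions, $$\Lambda_f(\alpha)=\min_{V\in H^1(\omega),\,V\not\equiv0}\frac{d\int_\omega|\nabla V|^2-\int_\omega(d\alpha^2+\partial_vf(y,0))V^2}{\int_\omega V^2},\qquad c_f^*=\min_{\alpha>0}\frac{-\Lambda_f(\alpha)}{\alpha},$$ the latter being well defined when $\Lambda_f(0)<0$. *)

(* Defs.v *)
From HB Require Import structures.
From mathcomp Require Import all_boot all_order all_algebra.
From mathcomp Require Import all_classical all_reals all_analysis.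
From mathcomp Require Import measurable_realfun.

Set Implicit Arguments.
Unset Strict Implicit.
Unset Printing Implicit Defensive.
Import Order.TTheory GRing.Theory Num.Theory.
Import numFieldNormedType.Exports.

Local Open Scope classical_set_scope.
Local Open Scope ring_scope.

Section measurable_row.
Context {R : realType} (n : nat).

(* The sigma-algebra generated by the coordinates, i.e. the Borel one. *)
Let coord (i : 'I_n) (x : 'rV[R]_n) : R := x ord0 i.

Let row_set0 : g_sigma_preimage coord set0.
Proof. exact: sigma_algebra0. Qed.

Let row_setC A : g_sigma_preimage coord A -> g_sigma_preimage coord (~` A).
Proof. exact: sigma_algebraC. Qed.

Let row_bigcup (F : (set 'rV[R]_n)^nat) :
  (forall i, g_sigma_preimage coord (F i)) ->
  g_sigma_preimage coord (\bigcup_i (F i)).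
Proof. exact: sigma_algebra_bigcup. Qed.

HB.instance Definition _ := @isMeasurable.Build default_measure_display
  'rV[R]_n (g_sigma_preimage coord) row_set0 row_setC row_bigcup.

Lemma measurable_coord (i : 'I_n) :
  measurable_fun setT (fun x : 'rV[R]_n => x ord0 i).
Proof.
move=> _ Y mY; rewrite setTI; apply: sub_sigma_algebra => /=.
rewrite -bigcup_seq/=; exists i => /=; first by rewrite mem_index_enum.
by exists Y => //; rewrite setTI.
Qed.

Lemma measurable_fun_row d (T : measurableType d) (f : T -> 'rV[R]_n) :
  (forall i, measurable_fun setT (fun t => f t ord0 i)) ->
  measurable_fun setT f.
Proof.
move=> mf _ A mA; rewrite setTI.
suff: g_sigma_preimage (fun i => coord i \o f) `<=` measurable.
  by apply; rewrite g_sigma_preimage_comp; exists A => //; rewrite setTI.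
apply: smallest_sub; first exact: sigma_algebra_measurable.
apply: (big_ind (fun S : set (set T) => S `<=` measurable)) => //.
- by move=> S1 S2 h1 h2 B [/h1|/h2].
- by move=> i _ _ [B mB <-]; exact: mf.
Qed.

End measurable_row.

Definition pushm d1 d2 (T1 : measurableType d1) (T2 : measurableType d2)
    (R : realType) (m : {measure set T1 -> \bar R}) (f : T1 -> T2)
    (mf : measurable_fun setT f) : {measure set T2 -> \bar R} :=
  measure_function_pushforward__canonical__measure_function_Measure m mf.

Section lebesgue_row.
Context {R : realType}.

(* (y, t) |-> (t, y_1, ..., y_n) *)
Definition consr n (p : 'rV[R]_n * R) : 'rV[R]_n.+1 :=
  \row_(i < n.+1) oapp (p.1 ord0) p.2 (unlift ord0 i).

Lemma measurable_consr n : measurable_fun setT (@consr n).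
Proof.
apply: measurable_fun_row => i; rewrite /consr.
under eq_fun do rewrite mxE.
case: unliftP => [j|] _ /=; last exact: measurable_snd.
by apply: (measurableT_comp (measurable_coord j)); exact: measurable_fst.
Qed.

Fixpoint leb n : {measure set 'rV[R]_n -> \bar R} :=
  match n return {measure set 'rV[R]_n -> \bar R} with
  | 0 => @dirac _ 'rV[R]_0 (0 : 'rV[R]_0) R
  | m.+1 => pushm (leb m \x lebesgue_measure)%E (@measurable_consr m)
  end.

End lebesgue_row.

Section geometry.
Context {R : realType} {N : nat}.
Implicit Types (x y : 'rV[R]_N) (r rho : R).

Definition dotr x y : R := \sum_(i < N) x ord0 i * y ord0 i.

(* The library norm `|x| on row vectors is the sup norm. *)
Definition enorm x : R := Num.sqrt (dotr x x).

Definition eball rho : set 'rV[R]_N := [set x | enorm x < rho].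

Definition boundary (A : set 'rV[R]_N) : set 'rV[R]_N := closure A `\` A°.

Lemma measurable_enorm : measurable_fun setT (@enorm).
Proof.
have msqrt : measurable_fun setT (@Num.sqrt R).
  by apply: continuous_measurable_fun; exact: sqrt_continuous.
apply: (measurableT_comp msqrt).
apply: measurable_sum => i.
by apply: measurable_funM; exact: measurable_coord.
Qed.

Definition sproj rho x : 'rV[R]_N := (rho / enorm x) *: x.

Lemma measurable_sproj rho : measurable_fun setT (sproj rho).
Proof.
apply: measurable_fun_row => i; rewrite /sproj.
under eq_fun do rewrite mxE.
apply: measurable_funM; last exact: measurable_coord.
apply: measurable_funM; first exact: measurable_cst.
rewrite (_ : (fun x => _) = (fun x => enorm x `^ (-1))); last first.
  by apply/funext => x; rewrite powR_inv1 ?sqrtr_ge0.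
apply: (@measurableT_comp _ _ _ _ _ _ ((@powR R)^~ (-1))) => //.
exact: measurable_enorm.
Qed.

Lemma measurable_cball rho : measurable [set x | enorm x <= rho].
Proof.
have := measurable_enorm measurableT (measurable_itv `]-oo, rho]).
by rewrite setTI (_ : _ @^-1` _ = [set x | enorm x <= rho]).
Qed.

(* Surface measure of the sphere of radius rho, read off the volume of cones:
   by polar coordinates, for A inside the sphere,
   leb {t *: y | 0 < t <= 1, y in A} = rho / N * sigma A. *)
Definition sphere_measure rho : {measure set 'rV[R]_N -> \bar R} :=
  mscale `|N%:R / rho|%:nng
    (pushm (mrestr (leb N) (measurable_cball rho)) (measurable_sproj rho)).

Variant radial_domain := Ball of R | Annulus of R & R.

Definition admissible (s : radial_domain) : Prop :=
  match s with
  | Ball r2 => 0 < r2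
  | Annulus r1 r2 => 0 < r1 < r2
  end.

Definition dom (s : radial_domain) : set 'rV[R]_N :=
  match s with
  | Ball r2 => eball r2
  | Annulus r1 r2 => eball r2 `\` closure (eball r1)
  end.

Definition bdry_measure (s : radial_domain) : {measure set 'rV[R]_N -> \bar R} :=
  match s with
  | Ball r2 => sphere_measure r2
  | Annulus r1 r2 => measure_add (sphere_measure r1) (sphere_measure r2)
  end.

End geometry.
Arguments radial_domain : clear implicits.
Arguments dom {R} N s : rename.

(* C^{1,beta} regularity on an arbitrary subset A of a finite-dimensional      *)
(* normed space: h has at every point of A a differential relative to A, which *)
(* is beta-Hoelder on bounded subsets of A. On a smooth open set this is the   *)
(* classical notion, on a hypersurface p x can be composed with the tangential *)
(* projection, and on A = omega x [0, +oo) it is one-sided at v = 0.           *)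
Definition C1holder (R : realType) (E : normedModType R) (beta : R) (A : set E)
    (h : E -> R) : Prop :=
  exists p : E -> {linear E -> R},
    (forall x, A x -> forall e, 0 < e -> \forall y \near within A (nbhs x),
       `|h y - h x - p x (y - x)| <= e * `|y - x|) /\
    (forall K, exists C, forall x y z, A x -> A y -> `|x| <= K -> `|y| <= K ->
       `|p x z - p y z| <= C * `|x - y| `^ beta * `|z|).

Definition rderiv0 (R : realType) (h : R -> R) : R :=
  lim ((h t - h 0) / t @[t --> 0^'+]).

Definition radial_on (R : realType) N (A : set 'rV[R]_N) (h : 'rV[R]_N -> R) :=
  exists k : R -> R, forall y, A y -> h y = k (enorm y).

Section sobolev.
Context {R : realType} {N : nat}.
Local Notation E := 'rV[R]_N.
Implicit Types (s : radial_domain R) (phi U V T : E -> R) (G : E -> E)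
  (mu : {measure set E -> \bar R}) (A : set E).

Definition grad phi (x : E) : E := \row_(i < N) 'D_(delta_mx ord0 i) phi x.

Definition C1 phi : Prop := (forall x, differentiable phi x) /\ continuous (grad phi).

(* Tangential gradient on spheres centered at the origin; it vanishes if N = 1. *)
Definition tgrad phi (x : E) : E :=
  grad phi x - (dotr (grad phi x) x / dotr x x) *: x.

Definition L2 mu A V : Prop :=
  measurable_fun A V /\ (\int[mu]_(x in A) ((V x) ^+ 2)%:E < +oo)%E.

Definition L2_vec mu A G : Prop := forall i, L2 mu A (fun x => G x ord0 i).

Definition L2_cvg mu A (phi : nat -> E -> R) V : Prop :=
  (fun n => \int[mu]_(x in A) ((phi n x - V x) ^+ 2)%:E)%E @ \oo --> (0%E : \bar R).

Definition L2_cvg_vec mu A (F : nat -> E -> E) G : Prop :=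
  forall i, L2_cvg mu A (fun n x => F n x ord0 i) (fun x => G x ord0 i).

Definition compactly_supported A phi : Prop :=
  exists K : set E, [/\ compact K, K `<=` A & forall x, ~ K x -> phi x = 0].

Definition weak_grad A V G : Prop :=
  forall phi, C1 phi -> compactly_supported A phi -> forall i,
    \int[leb N]_(x in A) (V x * grad phi x ord0 i) =
    - \int[leb N]_(x in A) (G x ord0 i * phi x).

(* V is in H^1(A), with gradient G. *)
Definition H1 A V G : Prop :=
  [/\ L2 (leb N) A V, L2_vec (leb N) A G & weak_grad A V G].

(* T is the trace on the boundary of V in H^1(dom N s), with gradient G: the   *)
(* continuous extension of the restriction map from C^1 functions to H^1.      *)
Definition trace s V G T : Prop :=
  L2 (bdry_measure s) (boundary (dom N s)) T /\
  exists phi : nat -> E -> R,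
    [/\ forall n, C1 (phi n),
        L2_cvg (leb N) (dom N s) phi V,
        L2_cvg_vec (leb N) (dom N s) (fun n => grad (phi n)) G &
        L2_cvg (bdry_measure s) (boundary (dom N s)) phi T].

(* U is in H^1 of the boundary, with tangential gradient G, where H^1 of a     *)
(* compact manifold is the completion of C^1 for the Sobolev norm.             *)
Definition H1_bdry s U G : Prop :=
  let mu := bdry_measure s in let A := boundary (dom N s) in
  [/\ L2 mu A U, L2_vec mu A G &
    exists phi : nat -> E -> R,
      [/\ forall n, C1 (phi n), L2_cvg mu A phi U &
          L2_cvg_vec mu A (fun n => tgrad (phi n)) G]].

End sobolev.

Section eigenvalues.
Context {R : realType} {N : nat}.
Local Notation E := 'rV[R]_N.
Variables (s : radial_domain R) (d mu nu : R) (kappa : E -> R) (f g : E -> R -> R).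
Local Notation om := (dom N s).
Local Notation bd := (boundary om).
Local Notation lam := (leb N).
Local Notation sig := (bdry_measure s).

Definition energy (D alpha : R) (U : E -> R) (GU : E -> E)
    (V : E -> R) (GV : E -> E) (T : E -> R) : R :=
  D * \int[sig]_(y in bd) dotr (GU y) (GU y)
  - \int[sig]_(y in bd) ((D * alpha ^+ 2 + rderiv0 (g y)) * U y ^+ 2)
  + d * \int[lam]_(y in om) dotr (GV y) (GV y)
  - \int[lam]_(y in om) ((d * alpha ^+ 2 + rderiv0 (f y)) * V y ^+ 2)
  + \int[sig]_(y in bd) (kappa y * (Num.sqrt mu * U y - Num.sqrt nu * T y) ^+ 2).

(* GU, GV and T are determined a.e. by U and V; the minimum is written as an   *)
(* infimum, which is attained.                                                 *)
Definition Lambda (D alpha : R) : R :=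
  inf [set e | exists U GU V GV T,
    [/\ H1_bdry s U GU, H1 om V GV, trace s V GV T,
        \int[sig]_(y in bd) (U y ^+ 2) + \int[lam]_(y in om) (V y ^+ 2) = 1 &
        e = energy D alpha U GU V GV T]].

Definition Lambda_f (alpha : R) : R :=
  inf [set e | exists V GV,
    [/\ H1 om V GV, \int[lam]_(y in om) (V y ^+ 2) != 0 &
        e = (d * \int[lam]_(y in om) dotr (GV y) (GV y)
             - \int[lam]_(y in om) ((d * alpha ^+ 2 + rderiv0 (f y)) * V y ^+ 2))
            / \int[lam]_(y in om) (V y ^+ 2)]].

End eigenvalues.

(* Again an infimum for a minimum attained when L 0 < 0. *)
Definition speed (R : realType) (L : R -> R) : R :=
  inf [set - L alpha / alpha | alpha in [set alpha | 0 < alpha]].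

(* Main.v *)
Require Import Defs.
From HB Require Import structures.
From mathcomp Require Import all_boot all_order all_algebra.
From mathcomp Require Import all_classical all_reals all_analysis.
From mathcomp Require Import measurable_realfun ring lra.

Set Implicit Arguments.
Unset Strict Implicit.
Unset Printing Implicit Defensive.
Import Order.TTheory GRing.Theory Num.Theory.
Import numFieldNormedType.Exports.
Local Open Scope classical_set_scope.
Local Open Scope ring_scope.

(* Fix [alpha > 0] and [D1 < D2]. As the coefficients are radial, testing the
   eigenvalue problem for [D2] with radial functions, for which [U] is constant
   on each boundary sphere and has no surface gradient, shows that a quadratic
   form on profiles over [(a, b)] is nonnegative at the level [Lambda D2 alpha].
   Going from [D2] to [D1] adds [(D2 - D1) alpha^2 U^2] on the boundary. If
   the resulting form were small on a normalised profile, [U] would be small,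
   hence [V] would be small on a sphere where [kappa > 0], and, by testing
   against exponentials of [r^2], small everywhere: so the new form dominates
   [dl] times the squared norm for some [dl > 0]. This one-dimensional
   inequality holds for all profiles, in particular for the restrictions of an
   arbitrary competitor to rays, and integrating it over the directions gives
   [Lambda D1 alpha >= Lambda D2 alpha + dl]: the surface gradient and the
   angular part of the bulk gradient are nonnegative and are dropped. Since the
   infimum over [alpha] defining the speed is attained, the strict inequality
   passes to the speeds. *)

(** [D] enters the energy through [D (|grad U|^2 - alpha^2 U^2)]: raising it makes tangential
    variation dearer and mass on the boundary cheaper. Radial symmetry decides between the two
    effects, because a [U] constant on each sphere feels only the second. No minimiser is
    constructed, so strictness has to come from the uniform gap [dl], and smallness of the form has
    to play the part of the eigenvalue equation: by Cauchy-Schwarz for a nonnegative form, a profile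
    of small form nearly solves the equation against every fixed test function. The exponential is a
    strict subsolution, and the sign of its exponent is chosen so that the flux has the good sign at
    the end where no trace bound is available. It controls the weighted integral of a nonnegative
    [V]; an interpolation inequality turns this into a bound in [L^2]. Restrictions to rays are in
    general neither even in [r] nor nonnegative. The gap is therefore first shown for nonnegative
    [C^1] functions of [r^2] and then extended by smoothing [|v|]. *)

Section lebesgue_affine.
Context {R : realType}.
Local Open Scope ereal_scope.
Local Notation mu := (@lebesgue_measure R).

(** The image of Lebesgue measure under [t |-> rho * t + c], multiplied by [rho], gives half-open
    intervals their length, so uniqueness of Lebesgue measure identifies it with [mu]. *)
Lemma ge0_integral_affine (F : R -> \bar R) (rho c : R) :
  (0 < rho)%R -> measurable_fun setT F -> (forall t, 0 <= F t) ->
  \int[mu]_t F t = rho%:E * \int[mu]_t F (rho * t + c)%R.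
Proof.
move=> rho0 mF F0.
pose phi : R -> measurableTypeR R := fun t => (rho * t + c)%R.
have mphi : measurable_fun setT phi.
  by apply: measurable_funD => //; exact: measurable_funM.
have r0 : (0 <= rho)%R by exact: ltW.
pose k := NngNum r0.
have E A : measurable A -> mu A = mscale k (pushforward mu phi) A.
  move=> mA; have := @lebesgue_measure_unique R
    (mscale k (pushm mu mphi)) _ A mA.
  apply => _ [[x y] /= xy <-].
  rewrite /mscale /= /pushforward /=.
  have -> : phi @^-1` `]x, y] = `]((x - c) / rho)%R, ((y - c) / rho)%R]%classic.
    by apply/seteqP; split => t; rewrite /phi /= !in_itv/= ltr_pdivrMr// ler_pdivlMr//
      mulrC ltrBlDr lerBrDr.
  rewrite !lebesgue_measure_itv/= !lte_fin ltr_pM2r ?invr_gt0// ltrD2r.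
  case: ifPn => _; last by rewrite mule0.
  rewrite -!EFinB -EFinM; congr EFin; field; exact: lt0r_neq0.
rewrite (eq_measure_integral (mscale k (pushm mu mphi))); last by move=> A mA _; exact: E.
rewrite ge0_integral_mscale//; congr (_ * _).
by rewrite ge0_integral_pushforward.
Qed.

End lebesgue_affine.

(** * Lebesgue measure on row vectors: Tonelli and affine changes of variables *)

Section lebesgue_row_theory.
Context {R : realType}.
Local Open Scope ereal_scope.
Local Notation mu := (@lebesgue_measure R).

Definition box n (c : R) : set 'rV[R]_n := [set x | forall i, `|x ord0 i| <= c]%R.

Lemma measurable_box n c : measurable (@box n c).
Proof.
have -> : box c = \bigcap_(i in [set: 'I_n]) [set x : 'rV[R]_n | `|x ord0 i| <= c]%R.
  by apply/seteqP; split => x h i => [_|]; exact: h.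
apply: fin_bigcap_measurable => // i _.
have m : measurable_fun setT (fun x : 'rV[R]_n => `|x ord0 i|)%R.
  by apply: measurableT_comp => //; exact: measurable_coord.
have := m measurableT _ (measurable_itv `]-oo, c]).
by rewrite setTI; congr measurable; apply/seteqP; split => x /=; rewrite in_itv.
Qed.

Lemma consr_box n c : @consr R n @^-1` (box c) = box c `*` `[(- c)%R, c]%classic.
Proof.
apply/seteqP; split => -[y t] /=.
  move=> h; split => [i|].
    by have := h (lift ord0 i); rewrite /consr mxE liftK.
  by have := h ord0; rewrite /consr mxE unlift_none /= in_itv/= ler_norml.
move=> [h]; rewrite in_itv/= -ler_norml => tc i; rewrite /consr mxE.
by case: unliftP => [j _|_] //=.
Qed.

Lemma leb_box_lty n c : leb n (@box n c) < +oo.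
Proof.
elim: n c => [|n ih] c.
  by rewrite /= diracE; case: (_ \in _); rewrite ltry.
rewrite /= /pushforward consr_box.
rewrite [X in X < _](_ : _ = leb n (box c) * mu `[(- c)%R, c]); last first.
  by apply: product_measure1E => //; exact: measurable_box.
rewrite lebesgue_measure_itv; apply: lte_mul_pinfty => //.
  by rewrite ge0_fin_numE.
by case: ifP => // _; rewrite -EFinB ltry.
Qed.

Lemma bigcup_box n : \bigcup_(k : nat) @box n k%:R = setT.
Proof.
apply/seteqP; split => // x _.
exists (Num.bound (\sum_(i < n) `|x ord0 i|)%R) => // i.
apply: ltW; apply: le_lt_trans (archi_boundP _); last exact: sumr_ge0.
by rewrite (bigD1 i)//= lerDl sumr_ge0.
Qed.

Lemma leb_sigma_finite n : sigma_finite setT (@leb R n).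
Proof.
exists (fun k => box k%:R); first by rewrite bigcup_box.
by move=> k; split; [exact: measurable_box|exact: leb_box_lty].
Qed.

(* [leb n] is bundled as a mere measure; this copy of its underlying function
   carries the sigma-finite structure needed by Tonelli's theorem. *)
Definition lebsf n : set 'rV[R]_n -> \bar R := leb n.
Arguments lebsf : clear implicits.
HB.instance Definition _ n := isMeasure.Build _ _ _ (lebsf n)
  (measure0 (leb n)) (measure_ge0 (leb n)) (@measure_semi_sigma_additive _ _ _ (leb n)).
HB.instance Definition _ n := Measure_isSigmaFinite.Build _ _ _ (lebsf n)
  (leb_sigma_finite n).

Lemma leb_tonelli n (f : 'rV[R]_n * R -> \bar R) :
  measurable_fun setT f -> (forall p, 0 <= f p) ->
  \int[leb n]_x \int[mu]_r f (x, r) = \int[mu]_r \int[leb n]_x f (x, r).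
Proof. by move=> mf f0; exact: (@fubini_tonelli _ _ _ _ R (lebsf n) mu). Qed.

Lemma measurable_leb_int n (f : 'rV[R]_n * R -> \bar R) :
  measurable_fun setT f -> (forall p, 0 <= f p) ->
  measurable_fun setT (fun r => \int[leb n]_x f (x, r)).
Proof.
by move=> mf f0; exact: (@measurable_fun_fubini_tonelli_G _ _ _ _ R (lebsf n)).
Qed.

Lemma ge0_integral_leb_succ n (F : 'rV[R]_n.+1 -> \bar R) :
  measurable_fun setT F -> (forall x, 0 <= F x) ->
  \int[leb n.+1]_x F x = \int[mu]_t \int[leb n]_y F (consr (y, t)).
Proof.
move=> mF F0.
rewrite [LHS]ge0_integral_pushforward//; last exact: measurable_consr.
rewrite preimage_setT.
apply: (@fubini_tonelli2 _ _ _ _ R (lebsf n) mu (F \o @consr R n)) => //.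
exact: (measurableT_comp mF (@measurable_consr R n)).
by move=> x; exact: F0.
Qed.

Lemma measurable_affine n (rho : R) (b : 'rV[R]_n) :
  measurable_fun setT (fun x : 'rV[R]_n => rho *: x + b)%R.
Proof.
apply: measurable_fun_row => i.
under eq_fun do rewrite !mxE.
apply: measurable_funD => //; apply: measurable_funM => //.
exact: measurable_coord.
Qed.

(** Each coordinate contributes one factor [rho]: the first by the one-dimensional case, the others
    by induction. *)
Lemma ge0_integral_leb_affine n (F : 'rV[R]_n -> \bar R) (rho : R) (b : 'rV[R]_n) :
  (0 < rho)%R -> measurable_fun setT F -> (forall x, 0 <= F x) ->
  \int[leb n]_x F x = (rho ^+ n)%:E * \int[leb n]_x F (rho *: x + b)%R.
Proof.
move=> rho0; elim: n F b => [|n ih] F b mF F0.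
  rewrite /= expr0 mul1e !integral_dirac//= ?diracE ?mem_set// ?mul1e.
    by congr F; apply/rowP => -[].
  exact: measurableT_comp mF (measurable_affine _ _).
have mFa := measurableT_comp mF (measurable_affine rho b).
rewrite !ge0_integral_leb_succ//.
have mFc : measurable_fun setT (fun p : 'rV[R]_n * R => F (consr p)).
  exact: measurableT_comp mF (@measurable_consr R n).
rewrite (ge0_integral_affine (b ord0 ord0) rho0)//; last 2 first.
- exact: (@measurable_leb_int n (fun p => F (consr p))).
- by move=> t; exact: integral_ge0.
pose b' : 'rV[R]_n := \row_j b ord0 (lift ord0 j).
have E t y : consr (rho *: y + b', rho * t + b ord0 ord0)%R =
   (rho *: consr (y, t) + b)%R.
  apply/rowP => i; rewrite !mxE; case: unliftP => [j ->|->] //=.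
  by rewrite !mxE.
rewrite exprS EFinM -muleA; congr (_ * _).
rewrite -ge0_integralZl//; last 3 first.
- have := @measurable_leb_int n (fun p => F (rho *: consr p + b)%R).
  by apply => //; exact: measurableT_comp mFa (@measurable_consr R n).
- by move=> x _; exact: integral_ge0.
- by rewrite lee_fin exprn_ge0// ltW.
apply: eq_integral => t _.
rewrite (ih (fun y => F (consr (y, _))) b')//; last first.
  exact: measurableT_comp mFc (measurable_pair2 _).
by congr (_ * _); apply: eq_integral => y _; rewrite E.
Qed.

End lebesgue_row_theory.

(** * Topology of row vectors and measurability of continuous functions *)

Section row_topology.
Context {R : realType} {n : nat}.
Implicit Types x y : 'rV[R]_n.

Lemma coord_le_norm x i : `|x ord0 i| <= `|x|.
Proof.
rewrite [leRHS]/Num.norm /= mx_normrE; apply/bigmax_geP; right => /=.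
by exists (ord0, i).
Qed.

Lemma norm_le_coord x e : 0 <= e -> (forall i, `|x ord0 i| <= e) -> `|x| <= e.
Proof.
move=> e0 h; rewrite [leLHS]/Num.norm /= mx_normrE; apply/bigmax_leP; split => //.
by move=> [i j] _ /=; rewrite ord1.
Qed.

(* Dyadic-like rounding reduces to maps with countably many values. *)
Lemma continuous_row_measurable (f : 'rV[R]_n -> R) :
  continuous f -> measurable_fun setT f.
Proof.
move=> cf.
pose z (k : nat) x : 'rV[int]_n := \row_i Num.floor (k.+1%:R * x ord0 i).
pose h (k : nat) (w : 'rV[int]_n) : 'rV[R]_n := \row_i ((w ord0 i)%:~R / k.+1%:R).
apply: (@measurable_fun_cvg _ _ _ setT (fun k x => f (h k (z k x)))).
- move=> k _ Y mY; rewrite setTI.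
  have -> : (fun x => f (h k (z k x))) @^-1` Y =
    \bigcup_(w : 'rV[int]_n) (if f (h k w) \in Y then
       \bigcap_(i in [set: 'I_n]) [set x : 'rV[R]_n | x ord0 i \in
          `[(w ord0 i)%:~R / k.+1%:R, ((w ord0 i + 1)%:~R) / k.+1%:R[ ] else set0).
    have zP x (w : 'rV[int]_n) : (forall i, x ord0 i \in
          `[(w ord0 i)%:~R / k.+1%:R, ((w ord0 i + 1)%:~R) / k.+1%:R[) <-> z k x = w.
      split => [h1|<- i].
        apply/rowP => i; rewrite mxE; apply: floor_def.
        have := h1 i; rewrite in_itv/= ler_pdivrMr// ltr_pdivlMr// [in X in _ -> X]mulrC.
        by [].
      by rewrite mxE in_itv/= ler_pdivrMr// ltr_pdivlMr// mulrC floor_itv.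
    apply/seteqP; split => x /=.
      move=> Yx; exists (z k x) => //; rewrite mem_set// => i _ /=.
      by move: i; apply/zP.
    move=> [w _]; case: ifPn => // /set_mem Yw hx.
    have -> : z k x = w by apply/zP => i; exact: hx.
    exact: Yw.
  apply: countable_bigcupT_measurable => [|w]; first exact: countableP.
  case: ifPn => // _; apply: fin_bigcap_measurable => // i _.
  have := @measurable_coord R n i measurableT _ (measurable_itv
     `[(w ord0 i)%:~R / k.+1%:R, ((w ord0 i + 1)%:~R) / k.+1%:R[).
  by rewrite setTI.
- move=> x _; apply: (@continuous_cvg _ _ _ _ _ (fun k => h k (z k x)) f x) => //; first exact: cf.
  apply/cvgrPdist_le => e e0.
  have /cvgrPdist_le/(_ e e0)[N _ hN] := @cvg_harmonic R.
  exists N => // k /= Nk.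
  have := hN k Nk; rewrite /= sub0r normrN ger0_norm ?harmonic_ge0// => hk.
  apply: norm_le_coord; first exact: ltW.
  move=> i; rewrite !mxE; apply: le_trans hk; rewrite /harmonic.
  have k0 : 0 < k.+1%:R :> R by [].
  have /andP[h1 h2] := floor_itv (k.+1%:R * x ord0 i).
  rewrite ger0_norm; last by rewrite subr_ge0 ler_pdivrMr// [leRHS]mulrC.
  rewrite lerBlDr -[X in _ <= X + _]mul1r -mulrDl ler_pdivlMr// mulrC.
  by move: h2; rewrite intrD addrC => /ltW.
Qed.

End row_topology.

(** * The Euclidean norm and the radial projection *)

Section enorm_theory.
Context {R : realType} {n : nat}.
Implicit Types x y : 'rV[R]_n.

Lemma dotr_ge0 x : 0 <= dotr x x.
Proof. by apply: sumr_ge0 => i _; rewrite -expr2 sqr_ge0. Qed.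

Lemma dotrZl c x y : dotr (c *: x) y = c * dotr x y.
Proof. by rewrite /dotr mulr_sumr; apply: eq_bigr => i _; rewrite mxE mulrA. Qed.

Lemma dotrC x y : dotr x y = dotr y x.
Proof. by rewrite /dotr; apply: eq_bigr => i _; rewrite mulrC. Qed.

Lemma dotrZr c x y : dotr x (c *: y) = c * dotr x y.
Proof. by rewrite dotrC dotrZl dotrC. Qed.

Lemma dotrBl x y z : dotr (x - y) z = dotr x z - dotr y z.
Proof. by rewrite /dotr -sumrB; apply: eq_bigr => i _; rewrite !mxE mulrBl. Qed.

Lemma enorm_ge0 x : 0 <= enorm x.
Proof. exact: sqrtr_ge0. Qed.

Lemma enorm_sqr x : enorm x ^+ 2 = dotr x x.
Proof. by rewrite sqr_sqrtr// dotr_ge0. Qed.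

Lemma enormZ c x : enorm (c *: x) = `|c| * enorm x.
Proof.
by rewrite /enorm dotrZl dotrZr mulrA -expr2 sqrtrM ?sqr_ge0// sqrtr_sqr.
Qed.

Lemma coord_le_enorm x i : `|x ord0 i| <= enorm x.
Proof.
rewrite -sqrtr_sqr ler_wsqrtr// /dotr (bigD1 i)//= -expr2 lerDl.
by apply: sumr_ge0 => j _; rewrite -expr2 sqr_ge0.
Qed.

Lemma enorm0 : enorm (0 : 'rV[R]_n) = 0.
Proof. by rewrite -(scale0r (0 : 'rV[R]_n)) enormZ normr0 mul0r. Qed.

Lemma enorm_eq0 x : (enorm x == 0) = (x == 0).
Proof.
apply/idP/idP => [/eqP h|/eqP ->]; last by rewrite enorm0.
apply/eqP/rowP => i; rewrite mxE; apply/eqP; rewrite -normr_eq0 eq_le normr_ge0 andbT.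
by rewrite -h coord_le_enorm.
Qed.

Lemma continuous_dotr : continuous (fun x : 'rV[R]_n => dotr x x).
Proof.
rewrite /dotr; apply: continuous_big => [|i _ x]; first exact: add_continuous.
by apply: continuousM; exact: coord_continuous.
Qed.

Lemma continuous_enorm : continuous (@enorm R n).
Proof.
move=> x; apply: (@continuous_comp _ _ _ (fun x : 'rV[R]_n => dotr x x) Num.sqrt).
  exact: continuous_dotr.
exact: sqrt_continuous.
Qed.

Lemma dotr_cauchy x y : dotr x y ^+ 2 <= dotr x x * dotr y y.
Proof.
have [->|y0] := eqVneq y 0.
  have z z' : dotr z' (0 : 'rV[R]_n) = 0.
    by rewrite -(scale0r (0 : 'rV[R]_n)) dotrZr mul0r.
  by rewrite !z mulr0 expr0n.
have yy : 0 < dotr y y by rewrite -enorm_sqr exprn_gt0// lt_neqAle enorm_ge0 eq_sym enorm_eq0 y0.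
have := dotr_ge0 (dotr y y *: x - dotr x y *: y).
rewrite dotrBl !(dotrC _ (_ - _)) !dotrBl !dotrZl !dotrZr (dotrC y x).
set A := dotr x x; set B := dotr x y; set C := dotr y y => h.
have : 0 <= C * (A * C - B ^+ 2) by nra.
by rewrite pmulr_rge0// subr_ge0.
Qed.

Lemma sprojZ rho x : enorm (sproj rho x) = if x == 0 then 0 else `|rho|.
Proof.
rewrite /sproj enormZ; have [->|x0] := eqVneq x 0; first by rewrite enorm0 mulr0.
have ex : enorm x != 0 by rewrite enorm_eq0.
by rewrite normrM normfV (ger0_norm (enorm_ge0 x)) divfK.
Qed.

Lemma sproj_scale c rho x : 0 < c -> sproj rho (c *: x) = sproj rho x.
Proof.
move=> c0; rewrite /sproj enormZ (gtr0_norm c0) scalerA.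
have [->|x0] := eqVneq x 0; first by rewrite !scaler0.
congr (_ *: _); field; by rewrite enorm_eq0 x0 gt_eqF.
Qed.

Lemma sproj1 rho x : sproj rho x = rho *: sproj 1 x.
Proof. by rewrite /sproj scalerA mul1r. Qed.

Lemma enorm_sproj x : enorm x *: sproj 1 x = x.
Proof.
have [->|x0] := eqVneq x 0; first by rewrite /sproj !scaler0.
by rewrite /sproj scalerA mul1r divff ?scale1r// enorm_eq0.
Qed.

End enorm_theory.

Section inverse_power.
Context {R : realType}.
Local Open Scope ereal_scope.
Local Notation mu := (@lebesgue_measure R).

Lemma integral_inv_power (n : nat) (s : R) : (0 < s)%R ->
  \int[mu]_(r in `[s, +oo[) (n.+1%:R * r^-1 ^+ n.+2)%:E = (s^-1 ^+ n.+1)%:E.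
Proof.
move=> s0.
have dF (x : R) : (0 < x)%R -> is_derive x 1%R (fun r : R => - (r^-1 ^+ n.+1))%R
     (n.+1%:R * x^-1 ^+ n.+2)%R.
  move=> x0; have x1 : x != 0%R by rewrite gt_eqF.
  have h1 : is_derive x 1%R (fun r : R => r^-1)%R (- x^-2)%R.
    apply: is_derive_eq; first exact: (@is_deriveV R id x 1%R 1%R x1 (is_derive_id x 1%R)).
    by rewrite /GRing.scale/= mulr1.
  have h2 := is_deriveN (is_deriveX n.+1 h1); rewrite exprfctE in h2.
  have -> : (fun r : R => - (r^-1 ^+ n.+1))%R = (- (fun r : R => r^-1 ^+ n.+1))%R by [].
  apply: (is_derive_eq h2).
  by rewrite -!exprVn /GRing.scale/= !exprS; ring.
have cV (x : R) : (0 < x)%R -> {for x, continuous (fun r : R => r^-1)%R}.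
  by move=> x0; apply: inv_continuous; rewrite gt_eqF.
rewrite (@ge0_continuous_FTC2y R _ (fun r : R => - (r^-1 ^+ n.+1))%R s 0).
- by rewrite sub0e -EFinN opprK.
- move=> x sx; apply: mulr_ge0 => //; apply: exprn_ge0; rewrite invr_ge0.
  by rewrite (le_trans (ltW s0)).
- apply: continuous_in_subspaceT => x; rewrite inE/= in_itv/= andbT => sx.
  have x0 := lt_le_trans s0 sx.
  apply: cvgM; first exact: cvg_cst.
  apply: (@continuous_comp _ _ _ (fun r : R => r^-1)%R (fun r : R => r ^+ n.+2)%R).
    exact: cV.
  exact: exprn_continuous.
- rewrite -[X in _ --> X]oppr0; apply: cvgN.
  rewrite [X in _ --> X](_ : _ = 0 ^+ n.+1)%R; last by rewrite expr0n.
  apply: (@cvg_comp _ _ _ (fun r : R => r^-1)%R (fun r : R => r ^+ n.+1)%R _ (nbhs (0%R : R))).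
    apply/gtr0_cvgV0; first by near=> x; near: x; exact: nbhs_pinfty_gt.
    exact: cvg_id.
  exact: exprn_continuous.
- by move=> x sx; have [] := dF _ (lt_trans s0 sx).
- apply: cvg_at_right_filter; have [d _] := dF _ s0.
  have h : {for s, continuous (fun r : R => - (r^-1 ^+ n.+1))%R}.
    by apply: differentiable_continuous; exact/derivable1_diffP.
  exact: h.
- move=> x; rewrite in_itv/= andbT => sx.
  by rewrite derive1E; apply: derive_val; exact: (dF _ (lt_trans s0 sx)).
Unshelve. all: by end_near. Qed.

End inverse_power.

Lemma measurable_invr (R : realType) : measurable_fun setT (fun r : R => r^-1).
Proof.
have m1 : measurable_fun setT (fun t : R => t `^ (-1)) by exact: measurable_powR.
have m2 : measurable_fun setT (fun t : R => - (- t) `^ (-1)).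
  apply: measurable_funN; apply: (measurableT_comp m1); exact: oppr_measurable.
rewrite (_ : (fun r => _) = (fun r : R => if 0 < r then r `^ (-1) else - ((- r) `^ (-1)))).
  by apply: measurable_fun_ifT => //; exact: measurable_fun_ltr.
apply/funext => r; case: ifPn => r0; first by rewrite powR_inv1// ltW.
by rewrite powR_inv1 ?invrN ?opprK// oppr_ge0 leNgt.
Qed.

(** * Polar coordinates *)

Section polar.
Context {R : realType} {n : nat}.
Local Open Scope ereal_scope.
Local Notation mu := (@lebesgue_measure R).
Local Notation E := 'rV[R]_n.+1.

(* Integrals over the unit sphere are averages over the unit ball punctured at
   the origin: [pball] with radial projection stands for the sphere. *)
Definition pball : set E := [set x | (0 < enorm x <= 1)%R].

(** The Jacobian of polar coordinates in dimension [n.+1], cut off at [r <= 0] so that radial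
    integrals can run over the whole line. *)
Definition wt (r : R) : R := if (0 < r)%R then (r ^+ n)%R else 0%R.

Lemma wt_ge0 r : (0 <= wt r)%R.
Proof. by rewrite /wt; case: ifPn => // r0; rewrite exprn_ge0// ltW. Qed.

Lemma measurable_wt : measurable_fun setT wt.
Proof.
apply: measurable_fun_ifT => //; first exact: measurable_fun_ltr.
Qed.

Lemma measurable_enormT : measurable_fun setT (@enorm R n.+1).
Proof. exact: measurable_enorm. Qed.

Lemma measurable_pball : measurable pball.
Proof.
have := measurable_enormT measurableT (measurable_itv `]0%R, 1%R]).
by rewrite setTI (_ : _ @^-1` _ = pball)//; apply/seteqP; split => x /=; rewrite in_itv.
Qed.

Lemma measurable_scale : measurable_fun setT (fun p : E * R => p.2 *: p.1)%R.
Proof.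
apply: measurable_fun_row => i; under eq_fun do rewrite mxE.
apply: measurable_funM => //.
by apply: (measurableT_comp (measurable_coord i)); exact: measurable_fst.
Qed.

Definition ballind (x : E) : R := (\1_pball x)%R.

Lemma measurable_ballind : measurable_fun setT ballind.
Proof. by apply: measurable_indic; exact: measurable_pball. Qed.

Lemma ballindE x : ballind x = if (0 < enorm x <= 1)%R then 1%R else 0%R.
Proof.
rewrite /ballind indicE; case: ifPn => h; first by rewrite mem_set.
by rewrite memNset//= => h'; rewrite h' in h.
Qed.

Lemma ballind_ge0 x : (0 <= ballind x)%R.
Proof. by rewrite ballindE; case: ifP. Qed.

(** Substituting [enorm x * r] for [r] trades the projection for a power of the norm; afterwards [F]
    sees [x] and [r] only through [r *: x]. *)
Lemma ray_integral (F : E -> \bar R) (x : E) : measurable_fun setT F ->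
  (forall y, 0 <= F y) -> (0 < enorm x)%R ->
  \int[mu]_r ((wt r)%:E * F (r *: sproj 1 x)%R) =
  (enorm x ^+ n.+1)%:E * \int[mu]_r ((wt r)%:E * F (r *: x)%R).
Proof.
move=> mF F0 x0.
have mr y : measurable_fun setT (fun r : R => F (r *: y)%R).
  apply: (measurableT_comp mF).
  exact: measurableT_comp measurable_scale (measurable_pair1 y).
have mwF y : measurable_fun setT (fun r : R => (wt r)%:E * F (r *: y)%R).
  by apply: emeasurable_funM => //; apply/measurable_EFinP; exact: measurable_wt.
have F0' y r : 0 <= (wt r)%:E * F (r *: y)%R.
  by apply: mule_ge0 => //; rewrite lee_fin wt_ge0.
rewrite (ge0_integral_affine 0%R x0); [|exact: mwF|exact: F0'].
rewrite exprS EFinM -muleA; congr (_ * _).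
rewrite -ge0_integralZl//; last by rewrite lee_fin exprn_ge0// ltW.
2: exact: mwF.
apply: eq_integral => r _; rewrite addr0 muleA -EFinM.
have -> : ((enorm x * r) *: sproj 1 x = r *: x)%R.
  by rewrite mulrC -scalerA enorm_sproj.
congr (_%:E * _); rewrite /wt pmulr_rgt0//; case: ifPn => _; last by rewrite mulr0.
by rewrite exprMn.
Qed.

(** The integrand equals [n.+1 * r ^- n.+2] on [[s, +oo[]. This is the total weight that a point at
    distance [s] from the origin collects in the proof of [polar]. *)
Lemma radial_kernel (s : R) : (0 < s)%R ->
  \int[mu]_r (n.+1%:R * (wt r * (r^-1 ^+ n.+1) ^+ 2 * (s <= r)%R%:R))%:E =
  (s^-1 ^+ n.+1)%:E.
Proof.
move=> s0; rewrite -integral_inv_power// [RHS]integral_mkcond.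
apply: eq_integral => r _; rewrite patchE.
have -> : (r \in `[s, +oo[%classic) = (s <= r)%R.
  by apply/idP/idP => [/set_mem/=|h]; [|apply/mem_set => /=]; rewrite in_itv/= andbT.
case: ifPn => sr; last by rewrite mulr0 mulr0.
have r0 := lt_le_trans s0 sr; have r1 : r != 0%R by rewrite gt_eqF.
rewrite /wt r0 mulr1; congr EFin; rewrite exprVn.
by rewrite !exprVn !exprS; field; rewrite ?expf_neq0.
Qed.

(** Tonelli is used twice. Once [ray_integral] has removed the projection, the integrals are
    exchanged, a dilation by [r] leaves [F] depending on [x] alone, and the integrals are exchanged
    back. The remaining integral in [r] is [radial_kernel], which cancels [enorm x ^+ n.+1]. *)
Lemma polar (F : E -> \bar R) : measurable_fun setT F -> (forall y, 0 <= F y) ->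
  (n.+1%:R)%:E * \int[leb n.+1]_(x in pball) \int[mu]_r ((wt r)%:E * F (r *: sproj 1 x)%R)
  = \int[leb n.+1]_(x in [set x | (0 < enorm x)%R]) F x.
Proof.
move=> mF F0.
have mFp : measurable_fun setT (fun p : E * R => F (p.2 *: p.1)%R).
  exact: measurableT_comp mF measurable_scale.
have mF2 : measurable_fun setT (fun p : E * R => F p.1).
  exact: measurableT_comp.
have mw2 : measurable_fun setT (fun p : E * R => wt p.2).
  exact: measurableT_comp measurable_wt _.
have me2 : measurable_fun setT (fun p : E * R => enorm p.1).
  exact: measurableT_comp measurable_enormT _.
have mb2 : measurable_fun setT (fun p : E * R => ballind p.1).
  exact: measurableT_comp measurable_ballind _.
have minv := @measurable_invr R.
rewrite [X in _ * X](_ : _ = \int[leb n.+1]_x \int[mu]_r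
    ((ballind x * enorm x ^+ n.+1 * wt r)%:E * F (r *: x)%R)); last first.
  rewrite integral_mkcond; apply: eq_integral => x _; rewrite patchE.
  have -> : (x \in pball) = (0 < enorm x <= 1)%R.
    by apply/idP/idP => [/set_mem//|h]; exact/mem_set.
  have m1 y : measurable_fun setT (fun r : R => (wt r)%:E * F (r *: y)%R).
    apply: emeasurable_funM; first by apply/measurable_EFinP; exact: measurable_wt.
    exact: measurableT_comp mFp (measurable_pair1 y).
  case: ifPn => h; last first.
    by rewrite integral0_eq// => r _; rewrite ballindE (negbTE h) !mul0r mul0e.
  rewrite ray_integral//; last by case/andP: h.
  rewrite -ge0_integralZl//; last 3 first.
  - exact: m1.
  - by move=> r _; apply: mule_ge0; rewrite ?lee_fin ?wt_ge0.
  - by rewrite lee_fin exprn_ge0// enorm_ge0.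
  by apply: eq_integral => r _; rewrite ballindE h mul1r muleA EFinM.
have mG : measurable_fun setT (fun p : E * R =>
    (ballind p.1 * enorm p.1 ^+ n.+1 * wt p.2)%:E * F (p.2 *: p.1)%R).
  apply: emeasurable_funM => //; apply/measurable_EFinP.
  by do !apply: measurable_funM => //; exact: measurable_funX.
have G0 p : 0 <= (ballind p.1 * enorm p.1 ^+ n.+1 * wt p.2)%:E * F (p.2 *: p.1)%R.
  apply: mule_ge0 => //; rewrite lee_fin.
  by rewrite !mulr_ge0 ?ballind_ge0 ?wt_ge0// exprn_ge0// enorm_ge0.
rewrite [X in _ * X](leb_tonelli mG G0).
(* Of the two factors [r^-1 ^+ n.+1], one cancels the Jacobian of the dilation [x |-> r *: x], the
   other the power of [r] in [enorm (r *: x) ^+ n.+1]. The condition [enorm x <= r] is the dilated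
   unit ball. *)
pose K (p : E * R) : R := (wt p.2 * ((p.2^-1) ^+ n.+1) ^+ 2 * (enorm p.1 <= p.2)%R%:R)%R.
have mK : measurable_fun setT K.
  apply: measurable_funM; first apply: measurable_funM => //.
    by apply: measurable_funX; apply: measurable_funX; exact: measurableT_comp.
  rewrite (_ : (fun p : E * R => (enorm p.1 <= p.2)%R%:R%R) =
      (fun p => if (enorm p.1 <= p.2)%R then 1 else 0)%R); last first.
    by apply/funext => p; case: (_ <= _)%R.
  by apply: measurable_fun_ifT => //; exact: measurable_fun_ler.
have K0 p : (0 <= K p)%R.
  by rewrite /K mulr_ge0 ?ler0n// mulr_ge0 ?wt_ge0 ?sqr_ge0.
pose e (x : E) : R := (if 0 < enorm x then 1 else 0)%R.
have me : measurable_fun setT e.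
  by apply: measurable_fun_ifT => //; apply: measurable_fun_ltr => //; exact: measurable_enormT.
have e0 x : (0 <= e x)%R by rewrite /e; case: ifP.
have mH : measurable_fun setT (fun p : E * R =>
    (e p.1 * enorm p.1 ^+ n.+1 * K p)%:E * F p.1).
  apply: emeasurable_funM => //; apply/measurable_EFinP.
  apply: measurable_funM => //; apply: measurable_funM; first exact: measurableT_comp.
  exact: measurable_funX.
have H0 p : 0 <= (e p.1 * enorm p.1 ^+ n.+1 * K p)%:E * F p.1.
  apply: mule_ge0 => //; rewrite lee_fin.
  by rewrite mulr_ge0// mulr_ge0// exprn_ge0// enorm_ge0.
rewrite [X in _ * X](_ : _ = \int[mu]_r \int[leb n.+1]_x
    ((e x * enorm x ^+ n.+1 * K (x, r))%:E * F x)); last first.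
  apply: eq_integral => r _; have [r0|r0] := boolP (0 < r)%R; last first.
    rewrite !integral0_eq// => x _; first by rewrite /K /wt (negbTE r0) !mul0r mulr0 mul0e.
    by rewrite /wt (negbTE r0) mulr0 mul0e.
  rewrite [RHS](ge0_integral_leb_affine 0%R r0)//; last 2 first.
  - exact: measurableT_comp mH (measurable_pair2 r).
  - by move=> x; exact: (H0 (x, r)).
  rewrite -ge0_integralZl//; last 3 first.
  - have := measurableT_comp (measurableT_comp mH (measurable_pair2 r)) (measurable_affine r (0%R : E)).
    exact.
  - by move=> x _; exact: (H0 (_, r)).
  - by rewrite lee_fin exprn_ge0// ltW.
  apply: eq_integral => x _; rewrite addr0 muleA -EFinM; congr (_%:E * _).
  rewrite /K /e /= enormZ gtr0_norm// pmulr_rgt0// ballindE ger_pMr//.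
  have [x0|] := boolP (0 < enorm x)%R; last by rewrite /= !mul0r mulr0.
  case: (_ <= 1)%R; rewrite /= ?mul0r ?mulr0// !mul1r mulr1 exprMn exprVn.
  have rn : (r ^+ n.+1 != 0)%R by rewrite expf_neq0// gt_eqF.
  by field.
rewrite -[X in _ * X](leb_tonelli mH H0).
rewrite [RHS]integral_mkcond -ge0_integralZl//; last 2 first.
- exact: (@measurable_fun_fubini_tonelli_F _ _ _ _ R mu _ mH).
- by move=> x _; apply: integral_ge0 => r _; exact: (H0 (x, r)).
apply: eq_integral => x _; rewrite patchE.
have -> : (x \in [set x : E | (0 < enorm x)%R]) = (0 < enorm x)%R.
  by apply/idP/idP => [/set_mem//|h]; exact/mem_set.
case: ifPn => x0; last first.
  by rewrite integral0_eq ?mule0// => r _; rewrite /e (negbTE x0) !mul0r mul0e.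
have mKx : measurable_fun setT (fun r => (n.+1%:R * K (x, r))%:E).
  by apply/measurable_EFinP; apply: measurable_funM => //; exact: measurableT_comp mK (measurable_pair1 x).
rewrite -ge0_integralZl//; last first.
  exact: measurableT_comp mH (measurable_pair1 x).
transitivity (\int[mu]_r ((enorm x ^+ n.+1)%:E * F x * (n.+1%:R * K (x, r))%:E)).
  apply: eq_integral => r _; rewrite /e x0 mul1r [in RHS]muleC !muleA -!EFinM.
  by congr (_%:E * _); ring.
rewrite ge0_integralZl//; last 2 first.
- by move=> r _; rewrite lee_fin mulr_ge0.
- by apply: mule_ge0 => //; rewrite lee_fin exprn_ge0// enorm_ge0.
rewrite /K /= radial_kernel// muleAC -EFinM exprVn divff ?mul1e//.
by rewrite expf_neq0// gt_eqF.
Qed.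

End polar.

Arguments leb : simpl never.

Lemma ge0_integral_mrestr d (T : measurableType d) (R : realType)
    (m : {measure set T -> \bar R}) (D : set T) (mD : measurable D) (f : T -> \bar R) :
  measurable_fun setT f -> (forall x, 0 <= f x)%E ->
  (\int[mrestr m mD]_x f x = \int[m]_(x in D) f x)%E.
Proof.
move=> mf f0; rewrite -(setUv D) ge0_integral_setU//; last 3 first.
- exact: measurableC.
- by rewrite setUv.
- by apply/disj_setPS => x [].
rewrite (eq_measure_integral m); last first.
  by move=> A mA AD; transitivity (m (A `&` D)) => //; rewrite setIidl.
rewrite [X in (_ + X)%E](eq_measure_integral mzero) ?integral_measure_zero ?adde0//.
move=> A mA AD; transitivity (m (A `&` D)) => //.
rewrite (_ : A `&` D = set0) ?measure0//.
by apply/seteqP; split => // x [/AD].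
Qed.

(** * Balls and annuli *)

Section domain_geometry.
Context {R : realType} {n : nat}.
Local Notation E := 'rV[R]_n.+1.
Implicit Types (s : radial_domain R) (rho : R).

Definition inner s : R := match s with Ball _ => 0 | Annulus r _ => r end.
Definition outer s : R := match s with Ball r => r | Annulus _ r => r end.

(* [winner] vanishes for a ball, which has no inner boundary. *)
Definition winner s : R := match s with Ball _ => 0 | Annulus r _ => r ^+ n end.
Definition wouter s : R := outer s ^+ n.

Lemma inner_ge0 s : admissible s -> 0 <= inner s.
Proof. by case: s => //= r1 r2 /andP[/ltW]. Qed.

Lemma inner_lt_outer s : admissible s -> inner s < outer s.
Proof. by case: s => //= r1 r2 /andP[]. Qed.

Lemma outer_gt0 s : admissible s -> 0 < outer s.
Proof. by move=> h; exact: le_lt_trans (inner_ge0 h) (inner_lt_outer h). Qed.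

Lemma winner_ge0 s : admissible s -> 0 <= winner s.
Proof. by case: s => //= r1 r2 /andP[/ltW h _]; exact: exprn_ge0. Qed.

Lemma wouter_gt0 s : admissible s -> 0 < wouter s.
Proof. by move=> h; apply: exprn_gt0; exact: outer_gt0. Qed.

Definition sph rho : set E := [set x | enorm x = rho].

(** A point of the closed shell is approached along its own ray: from inside if it lies on the outer
    sphere, by stretching otherwise. *)
Lemma closure_enorm (A : set E) (x : E) (a b : R) : a < b -> x != 0 ->
  a <= enorm x <= b -> (forall y : E, a < enorm y < b -> A y) -> closure A x.
Proof.
move=> ab x0 /andP[ax xb] hA B xB.
have ex : 0 < enorm x by rewrite lt_neqAle enorm_ge0 eq_sym enorm_eq0 x0.
have c1 : (fun t : R => t *: x) @ (1 : R) --> x.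
  rewrite -[X in _ --> X]scale1r; exact: scalel_continuous.
have {c1}nB : \forall t \near (1 : R), B (t *: x) by exact: (c1 _ xB).
have e1 t : 0 < t -> enorm (t *: x) = t * enorm x.
  by move=> t0; rewrite enormZ gtr0_norm.
move: xb; rewrite le_eqVlt => /predU1P[xb|xb].
  have : \forall t \near 1^'-, B (t *: x) /\ a < enorm (t *: x) < b.
    near=> t; split; first by near: t; exact: cvg_within.
    have t0 : 0 < t by near: t; exact: nbhs_left_gt.
    have t1 : t < 1 by near: t; exact: nbhs_left_lt.
    rewrite e1// -xb gtr_pMl// t1 andbT xb -ltr_pdivrMr -?xb//.
    near: t; apply: nbhs_left_gt; rewrite ltr_pdivrMr// mul1r xb.
    exact: ab.
  by move=> /filter_ex[t [Bt ht]]; exists (t *: x); split => //; exact: hA.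
have : \forall t \near 1^'+, B (t *: x) /\ a < enorm (t *: x) < b.
  near=> t; split; first by near: t; exact: cvg_within.
  have t1 : 1 < t by near: t; exact: nbhs_right_gt.
  have t0 : 0 < t by exact: lt_trans t1.
  rewrite e1// (le_lt_trans ax) ?ltr_pMl//= -ltr_pdivlMr//.
  near: t; apply: nbhs_right_lt; by rewrite ltr_pdivlMr// mul1r.
by move=> /filter_ex[t [Bt ht]]; exists (t *: x); split => //; exact: hA.
Unshelve. all: by end_near. Qed.

Lemma closed_enorm_le (c : R) : closed [set x : E | enorm x <= c].
Proof.
apply: (@closed_comp _ _ (@enorm R n.+1) [set t | t <= c]).
  by move=> x _; exact: continuous_enorm.
exact: closed_le.
Qed.

Lemma closed_enorm_ge (c : R) : closed [set x : E | c <= enorm x].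
Proof.
apply: (@closed_comp _ _ (@enorm R n.+1) [set t | c <= t]).
  by move=> x _; exact: continuous_enorm.
exact: closed_ge.
Qed.

Lemma closure_eball rho : 0 < rho -> closure (@eball R n.+1 rho) = [set x | enorm x <= rho].
Proof.
move=> r0; apply/seteqP; split => x.
  move=> cx; rewrite (iffLR (closure_id _) (@closed_enorm_le rho)).
  by apply: closure_subset cx => y /= /ltW.
move=> /= xr; have [->|x0] := eqVneq x 0.
  by apply: subset_closure; rewrite /eball /= enorm0.
(* The value [-1] makes the lower bound on the norm vacuous, so the ball is treated as a shell. *)
apply: (@closure_enorm _ _ (-1) rho) => //.
- by rewrite (lt_trans _ r0)// ltrN10.
- by rewrite xr andbT (le_trans _ (enorm_ge0 _))// lerN10.
- by move=> y /andP[].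
Qed.

Lemma domE s : admissible s -> dom n.+1 s = match s with
  | Ball r => [set x | enorm x < r] | Annulus r1 r2 => [set x | r1 < enorm x < r2] end.
Proof.
case: s => //= r1 r2 /andP[r0 r12]; rewrite closure_eball//.
apply/seteqP; split => x /=.
  by move=> [xr] /negP; rewrite -ltNge => ->.
by move=> /andP[xr xr2]; split => //; apply/negP; rewrite -ltNge.
Qed.

Lemma open_dom s : admissible s -> open (dom n.+1 s).
Proof.
move=> h; rewrite domE//; case: s h => [r _|r1 r2 _].
  apply: (@open_comp _ _ (@enorm R n.+1) [set t | t < r]).
    by move=> x _; exact: continuous_enorm.
  exact: open_lt.
rewrite (_ : [set x | _] = [set x : E | r1 < enorm x] `&` [set x | enorm x < r2]).
  apply: openI.
    apply: (@open_comp _ _ (@enorm R n.+1) [set t | r1 < t]).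
      by move=> x _; exact: continuous_enorm.
    exact: open_gt.
  apply: (@open_comp _ _ (@enorm R n.+1) [set t | t < r2]).
    by move=> x _; exact: continuous_enorm.
  exact: open_lt.
by apply/seteqP; split => x /=; [move=> /andP[]|move=> [-> ->]].
Qed.

(** The origin is set apart: it belongs to the ball, but its norm is not in the open interval of
    radii. *)
Lemma dom_enorm s x : admissible s -> x != 0 ->
  dom n.+1 s x <-> inner s < enorm x < outer s.
Proof.
move=> h x0; rewrite domE//; case: s h => //= r _.
suff -> : 0 < enorm x by [].
by rewrite lt_neqAle enorm_ge0 eq_sym enorm_eq0 x0.
Qed.

Lemma dom_lt s x : admissible s -> dom n.+1 s x -> enorm x < outer s.
Proof. by move=> h; rewrite domE//; case: s h => //= r1 r2 _ /andP[]. Qed.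

Lemma measurable_dom s : admissible s -> measurable (dom n.+1 s).
Proof.
move=> h; rewrite domE//; case: s h => [r _|r1 r2 _].
  have := @measurable_enormT R n measurableT _ (measurable_itv `]-oo, r[).
  by rewrite setTI; congr measurable; apply/seteqP; split => x /=; rewrite in_itv.
have := @measurable_enormT R n measurableT _ (measurable_itv `]r1, r2[).
by rewrite setTI; congr measurable; apply/seteqP; split => x /=; rewrite in_itv.
Qed.

Lemma measurable_sph rho : measurable (sph rho).
Proof.
have := @measurable_enormT R n measurableT _ (measurable_set1 rho).
by rewrite setTI.
Qed.

Lemma boundary_dom s : admissible s -> boundary (dom n.+1 s) =
  match s with Ball r => sph r | Annulus r1 r2 => sph r1 `|` sph r2 end.
Proof.
move=> h; rewrite /boundary (iffLR (interior_id _) (open_dom h)).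
rewrite {2}domE//; case: s h => [r r0|r1 r2 /= /andP[r10 r12]].
  rewrite /= closure_eball//; apply/seteqP; split => x /=.
    move=> [xr] /negP; rewrite -leNgt => rx; apply/eqP.
    by rewrite eq_le xr rx.
  by rewrite /sph /= => ->; split => //; rewrite ltxx.
have hh : admissible (Annulus r1 r2) by rewrite /= r10 r12.
have -> : closure (eball r2 `\` closure (eball r1)) = [set x : E | r1 <= enorm x <= r2].
  apply/seteqP; split => x.
    have c : closed [set x : E | r1 <= enorm x <= r2].
      rewrite (_ : [set x | _] = [set x : E | r1 <= enorm x] `&` [set x | enorm x <= r2]).
        by apply: closedI; [exact: closed_enorm_ge|exact: closed_enorm_le].
      by apply/seteqP; split => y /=; [move=> /andP[]|move=> [-> ->]].
    move=> cx; rewrite (iffLR (closure_id _) c); apply: closure_subset cx => y yd.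
    have : dom n.+1 (Annulus r1 r2) y by [].
    by rewrite domE//= => /andP[/ltW -> /ltW ->].
  move=> /= xr; apply: (@closure_enorm _ _ r1 r2) => //.
    by rewrite -enorm_eq0 gt_eqF// (lt_le_trans r10)//; case/andP: xr.
  move=> y yr; have : dom n.+1 (Annulus r1 r2) y by rewrite domE.
  exact.
apply/seteqP; split => x /=.
  move=> [/andP[h1 h2]] /negP; rewrite negb_and -!leNgt => /orP[h3|h3].
    by left; rewrite /sph /=; apply/eqP; rewrite eq_le h3 h1.
  by right; rewrite /sph /=; apply/eqP; rewrite eq_le h3 h2.
rewrite /sph /= => -[->|->]; split; rewrite ?lexx ?ltxx ?andbF//= ?(ltW r12)//.
Qed.

Lemma measurable_bdry s : admissible s -> measurable (boundary (dom n.+1 s)).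
Proof.
move=> h; rewrite boundary_dom//; case: s h => [r _|r1 r2 _].
  exact: measurable_sph.
by apply: measurableU; exact: measurable_sph.
Qed.

Lemma bdry_gt0 s x : admissible s -> boundary (dom n.+1 s) x -> 0 < enorm x.
Proof.
move=> h; rewrite boundary_dom//; case: s h => [r r0 -> //|r1 r2 /= /andP[r0 r12]].
by rewrite /sph /= => -[->|->]//; exact: lt_trans r12.
Qed.

Lemma bdry_outer s th : admissible s -> enorm th = 1 ->
  boundary (dom n.+1 s) (outer s *: th).
Proof.
move=> h th1; have o0 := outer_gt0 h.
have : enorm (outer s *: th) = outer s by rewrite enormZ th1 mulr1 gtr0_norm.
by rewrite boundary_dom//; case: s h {o0} => [r _ //|r1 r2 _]; right.
Qed.

Lemma bdry_inner s th : admissible s -> enorm th = 1 -> winner s != 0 ->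
  boundary (dom n.+1 s) (inner s *: th).
Proof.
move=> h th1; rewrite boundary_dom//; case: s h => [r _|r1 r2 /= /andP[r0 _] _]; first by rewrite eqxx.
by left; rewrite /sph /= enormZ th1 mulr1 gtr0_norm.
Qed.

End domain_geometry.

(** * Integration over spheres *)

Section spherical_integrals.
Context {R : realType} {n : nat}.
Local Notation E := 'rV[R]_n.+1.
Local Open Scope ereal_scope.
Local Notation mu := (@lebesgue_measure R).

(** The surface integral over the unit sphere, read off cones in the punctured unit ball; [n.+1] is
    the ratio of area to volume. *)
Definition oint (G : E -> \bar R) : \bar R :=
  (n.+1%:R)%:E * \int[leb n.+1]_(x in pball) G (sproj 1 x).

Lemma pball_sproj (x : E) : pball x -> enorm (sproj 1 x) = 1%R.
Proof.
move=> /andP[x0 _]; rewrite sprojZ normr1; case: eqP => // x00.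
by rewrite x00 enorm0 ltxx in x0.
Qed.

Lemma oint_eq (G H : E -> \bar R) : (forall th, enorm th = 1%R -> G th = H th) ->
  oint G = oint H.
Proof.
move=> GH; congr (_ * _); apply: eq_integral => x /set_mem xB.
exact/GH/pball_sproj.
Qed.

Lemma measurable_comp_sproj (G : E -> \bar R) : measurable_fun setT G ->
  measurable_fun pball (fun x => G (sproj 1 x)).
Proof.
move=> mG; apply: measurable_funTS; exact: measurableT_comp mG (@measurable_sproj R n.+1 1).
Qed.

Lemma ointD (G H : E -> \bar R) : measurable_fun setT G -> measurable_fun setT H ->
  (forall th, 0 <= G th) -> (forall th, 0 <= H th) ->
  oint (fun th => G th + H th) = oint G + oint H.
Proof.
move=> mG mH G0 H0; rewrite /oint ge0_integralD//.
- by rewrite ge0_muleDr// integral_ge0.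
- exact: measurable_pball.
- exact: measurable_comp_sproj.
- exact: measurable_comp_sproj.
Qed.

Lemma ointZ (k : R) (G : E -> \bar R) : (0 <= k)%R -> measurable_fun setT G ->
  (forall th, 0 <= G th) -> oint (fun th => k%:E * G th) = k%:E * oint G.
Proof.
move=> k0 mG G0; rewrite /oint ge0_integralZl//; first by rewrite muleCA.
- exact: measurable_pball.
- exact: measurable_comp_sproj.
Qed.

Lemma le_oint (G H : E -> \bar R) : measurable_fun setT G -> measurable_fun setT H ->
  (forall th, 0 <= G th) -> (forall th, enorm th = 1%R -> G th <= H th) ->
  oint G <= oint H.
Proof.
move=> mG mH G0 GH; rewrite /oint; apply: lee_wpmul2l => //.
apply: ge0_le_integral => //.
- exact: measurable_pball.
- exact: measurable_comp_sproj.
- exact: measurable_comp_sproj.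
- by move=> x xB; exact/GH/pball_sproj.
Qed.

Lemma measurable_dilate (rho : R) : measurable_fun setT (fun x : E => rho *: x)%R.
Proof.
have := measurable_affine rho (0%R : E); under eq_fun do rewrite addr0; exact.
Qed.

(** Dilating the ball of radius [rho] to the unit ball costs [rho ^+ n.+1], and the factor
    [n.+1 / rho] of the cone measure turns this into [rho ^+ n] times the [n.+1] of [oint]. The
    hypothesis [~ D 0] makes the integrand vanish at the origin, which [sproj] fixes and [pball]
    leaves out. *)
Lemma sphere_measure_integral (rho : R) (D : set E) (G : E -> \bar R) :
  (0 < rho)%R -> measurable D -> ~ D 0%R -> measurable_fun D G ->
  (forall x, D x -> 0 <= G x) ->
  \int[sphere_measure rho]_(x in D) G x =
  (rho ^+ n)%:E * oint (fun th => (G \_ D) (rho *: th)%R).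
Proof.
move=> rho0 mD D0 mG G0.
have G0' x : 0 <= (G \_ D) x.
  by rewrite patchE; case: ifPn => // /set_mem; exact: G0.
have mG' : measurable_fun setT (G \_ D) by exact/(measurable_restrictT _ mD).
rewrite integral_mkcond ge0_integral_mscale//.
rewrite [X in _ * X]ge0_integral_pushforward//; last exact: measurable_sproj.
rewrite preimage_setT ge0_integral_mrestr//; last 2 first.
- exact: measurableT_comp mG' (@measurable_sproj R n.+1 rho).
- by move=> x; exact: G0'.
rewrite integral_mkcond (ge0_integral_leb_affine 0%R rho0); last 2 first.
- apply: (iffLR (measurable_restrictT _ (measurable_cball rho))); apply: measurable_funTS.
  exact: measurableT_comp mG' (@measurable_sproj R n.+1 rho).
- by move=> x; rewrite patchE; case: ifP => // _; exact: G0'.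
rewrite /oint !muleA -!EFinM; congr (_ * _).
  by rewrite /= ger0_norm ?divr_ge0 ?ltW// exprS; congr EFin; field; rewrite gt_eqF.
rewrite [RHS]integral_mkcond; apply: eq_integral => x _; rewrite addr0 !patchE.
have -> : (rho *: x \in [set x0 : E | (enorm x0 <= rho)%R])%R = (enorm x <= 1)%R.
  apply/idP/idP => [/set_mem|h]; last apply/mem_set;
    by rewrite /= enormZ gtr0_norm// ger_pMr.
have -> : (x \in pball) = (0 < enorm x <= 1)%R.
  by apply/idP/idP => [/set_mem//|h]; exact/mem_set.
rewrite /= sproj_scale// -sproj1.
have [x0|x0] := eqVneq x 0%R; last first.
  by rewrite lt_neqAle enorm_ge0 eq_sym enorm_eq0 x0.
rewrite x0 enorm0 ltxx /= ler01 /sproj scaler0 patchE memNset//.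
Qed.

Lemma lebesgue_measure_setT : mu [set: R] = +oo.
Proof. by rewrite -set_itvNyy lebesgue_measure_itv. Qed.

Lemma leb_setT : leb n.+1 [set: E] = +oo.
Proof.
have H : forall m, 0 < leb m.+1 [set: 'rV[R]_m.+1] /\ leb m.+1 [set: 'rV[R]_m.+1] = +oo.
  elim=> [|m [ih1 ih2]].
  - rewrite -[X in 0 < X /\ _](@mul1e R) -(@integral_cst _ _ _ (leb 1) setT measurableT 1).
    rewrite (_ : leb 1 setT = \int[leb 1]_x 1); last by rewrite integral_cst// mul1e.
    rewrite ge0_integral_leb_succ//.
    have -> : \int[mu]_t \int[leb 0]_(y in [set: 'rV[R]_0]) 1 = +oo.
      under eq_integral do rewrite integral_cst//= diracE mem_set// mule1.
      by rewrite integral_cst// mul1e; exact: lebesgue_measure_setT.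
    by split.
  - rewrite (_ : leb m.+2 setT = \int[leb m.+2]_x 1); last by rewrite integral_cst// mul1e.
    rewrite ge0_integral_leb_succ//.
    have -> : \int[mu]_t \int[leb m.+1]_(y in [set: 'rV[R]_m.+1]) 1 = +oo.
      under eq_integral do rewrite integral_cst// ih2 mul1e.
      transitivity ((+oo : \bar R) * mu [set: R]); first by rewrite -integral_cst.
      by rewrite lebesgue_measure_setT mulyy.
    by split.
by have [] := H n.
Qed.

Lemma leb_set0 : leb n.+1 [set (0%R : E)] = 0.
Proof.
have m0 m : measurable [set (0%R : 'rV[R]_m)].
  rewrite (_ : [set _] = box 0%R); first exact: measurable_box.
  apply/seteqP; split => x /=; first by move=> -> i; rewrite mxE normr0.
  by move=> h; apply/rowP => i; rewrite mxE; apply/eqP; rewrite -normr_le0.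
pose F (x : E) : \bar R := (\1_[set (0%R : E)] x)%:E.
have -> : leb n.+1 [set (0%R : E)] = \int[leb n.+1]_x F x.
  by rewrite integral_indic ?setIT//; exact: m0.
have mF : measurable_fun setT F by apply/measurable_EFinP/measurable_indic; exact: m0.
rewrite ge0_integral_leb_succ//; last by move=> x; rewrite lee_fin.
pose c := \int[leb n]_y (F (consr (y, 0%R))).
transitivity (\int[mu]_t (cst c \_ [set 0%R]) t).
  apply: eq_integral => t _; rewrite patchE; case: ifPn => [/set_mem ->//|t0].
  apply: integral0_eq => y _; rewrite /F indicE memNset//= => h.
  have /rowP/(_ ord0) := h; rewrite !mxE unlift_none /= => t00.
  by move: t0; rewrite t00 mem_set.
by rewrite -integral_mkcond integral_set1.
Qed.

End spherical_integrals.

(** * Bounded measurable functions *)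

Section bounded_measurable.
Context {d : measure_display} {T : measurableType d} {R : realType}.
Variables (m : {measure set T -> \bar R}) (D : set T).
Hypotheses (mD : measurable D) (fD : (m D < +oo)%E).
Implicit Types f g : T -> R.

(** Unlike integrability, this is stable under products; on a set of finite measure it implies
    integrability. *)
Definition bmeas f := measurable_fun D f /\ exists C, forall x, D x -> `|f x| <= C.

Lemma bmeas_integrable f : bmeas f -> m.-integrable D (EFin \o f).
Proof.
move=> [mf [C hC]]; apply: measurable_bounded_integrable => //.
exists C; split; first exact: num_real.
by move=> M CM x Dx; exact: le_trans (hC x Dx) (ltW CM).
Qed.

Lemma bmeas_cst c : bmeas (fun=> c).
Proof. by split; [exact: measurable_cst|exists `|c|]. Qed.

Lemma bmeasD f g : bmeas f -> bmeas g -> bmeas (fun x => f x + g x).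
Proof.
move=> [mf [C hC]] [mg [C' hC']]; split; first exact: measurable_funD.
exists (C + C') => x Dx; apply: le_trans (ler_normD _ _) _.
by rewrite lerD ?hC ?hC'.
Qed.

Lemma bmeasN f : bmeas f -> bmeas (fun x => - f x).
Proof.
move=> [mf [C hC]]; split; first exact: measurable_funN.
by exists C => x Dx; rewrite normrN hC.
Qed.

Lemma bmeasB f g : bmeas f -> bmeas g -> bmeas (fun x => f x - g x).
Proof. by move=> hf hg; apply: bmeasD => //; exact: bmeasN. Qed.

Lemma bmeasM f g : bmeas f -> bmeas g -> bmeas (fun x => f x * g x).
Proof.
move=> [mf [C hC]] [mg [C' hC']]; split; first exact: measurable_funM.
by exists (C * C') => x Dx; rewrite normrM ler_pM ?hC ?hC'.
Qed.

Lemma bmeasX f k : bmeas f -> bmeas (fun x => f x ^+ k).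
Proof.
move=> hf; elim: k => [|k ih].
  by under [X in bmeas X]eq_fun do rewrite expr0; exact: bmeas_cst.
by under [X in bmeas X]eq_fun do rewrite exprS; exact: bmeasM.
Qed.

Lemma bmeas_max0 f : bmeas f -> bmeas (fun x => Num.max (f x) 0).
Proof.
move=> [mf [C hC]]; split; first exact: measurable_maxr.
exists C => x Dx; have := hC x Dx; case: (leP (f x) 0) => // _.
by rewrite normr0; apply: le_trans.
Qed.

Lemma eq_bmeas f g : (forall x, D x -> f x = g x) -> bmeas f -> bmeas g.
Proof.
move=> fg [mf [C hC]]; split.
  by apply: eq_measurable_fun mf => x /set_mem Dx; rewrite fg.
by exists C => x Dx; rewrite -fg// hC.
Qed.

End bounded_measurable.

(** * Functions of class C^1 on the line and radially weighted integrals *)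

Section C1_functions.
Context {R : realType}.
Implicit Types (v w : R -> R).

(** The derivative is a parameter, so that an explicit expression for it is carried through sums,
    products and compositions. *)
Definition isC1 v v' := (forall x : R, is_derive x 1 v (v' x)) /\ continuous v'.

Lemma isC1_continuous v v' : isC1 v v' -> continuous v.
Proof.
move=> [dv _] x; have [h _] := dv x.
exact/differentiable_continuous/derivable1_diffP.
Qed.

Lemma isC1_cst c : isC1 (fun=> c) (fun=> 0).
Proof. by split => [x|x]; [exact: is_derive_cst|exact: cvg_cst]. Qed.

Lemma isC1_id : isC1 (fun x => x) (fun=> 1).
Proof. by split => [x|x]; [exact: is_derive_id|exact: cvg_cst]. Qed.

Lemma isC1D v v' w w' : isC1 v v' -> isC1 w w' ->
  isC1 (fun x => v x + w x) (fun x => v' x + w' x).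
Proof.
move=> [dv cv] [dw cw]; split => x; first exact: is_deriveD.
by apply: continuousD; [exact: cv|exact: cw].
Qed.

Lemma isC1M v v' w w' : isC1 v v' -> isC1 w w' ->
  isC1 (fun x => v x * w x) (fun x => v' x * w x + v x * w' x).
Proof.
move=> hv hw; have cv0 := isC1_continuous hv; have cw0 := isC1_continuous hw.
move: hv hw => [dv cv] [dw cw]; split => x.
  by apply: is_derive_eq (is_deriveM (dv x) (dw x)) _; rewrite /GRing.scale/= addrC mulrC.
apply: cvgD; apply: cvgM;
  [exact: cv|exact: cw0|exact: cv0|exact: cw].
Qed.

Lemma isC1Z c v v' : isC1 v v' -> isC1 (fun x => c * v x) (fun x => c * v' x).
Proof.
move=> /(isC1M (isC1_cst c)); congr isC1.
by apply/funext => x; rewrite mul0r add0r.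
Qed.

Lemma isC1_comp v v' w w' : isC1 v v' -> isC1 w w' ->
  isC1 (fun x => v (w x)) (fun x => v' (w x) * w' x).
Proof.
move=> [dv cv] hw; have cw0 := isC1_continuous hw.
move: hw => [dw cw]; split => x; first exact: (is_derive1_comp (dv _) (dw x)).
apply: continuousM; last exact: cw.
by apply: continuous_comp; [exact: cw0|exact: cv].
Qed.

Lemma isC1X v v' k : isC1 v v' ->
  isC1 (fun x => v x ^+ k.+1) (fun x => k.+1%:R * v x ^+ k * v' x).
Proof.
move=> hv; elim: k => [|k ih].
  by under [X in isC1 _ X]eq_fun do rewrite expr0 !mul1r.
have := isC1M hv ih; congr isC1.
by apply/funext => x; rewrite -[k.+2%:R]natr1 -[k.+1%:R]natr1 exprS; ring.
Qed.

Lemma isC1_expR : isC1 (@expR R) (@expR R).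
Proof. by split => x; [exact: is_derive_expR|exact: continuous_expR]. Qed.

Lemma isC1_sqrt_pos v v' : isC1 v v' -> (forall x, 0 < v x) ->
  isC1 (fun x => Num.sqrt (v x)) (fun x => v' x / (2 * Num.sqrt (v x))).
Proof.
move=> hv v0; have cv0 := isC1_continuous hv; move: hv => [dv cv]; split => x.
  apply: is_derive_eq (is_derive1_comp (is_derive1_sqrt (v0 x)) (dv x)) _.
  by rewrite mulrC.
apply: cvgM; first exact: cv.
apply: (@continuous_comp _ _ _ (fun x => 2 * Num.sqrt (v x)) (fun t => t^-1)).
  apply: cvgM; first exact: cvg_cst.
  by apply: continuous_comp; [exact: cv0|exact: sqrt_continuous].
by apply: inv_continuous; rewrite mulf_neq0// gt_eqF// sqrtr_gt0.
Qed.

Lemma continuous_bmeas v (a b : R) : continuous v -> bmeas `]a, b[ v.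
Proof.
move=> cv; split.
  by apply: measurable_funTS; exact: continuous_measurable_fun.
have [ab|ba] := leP a b; last first.
  exists 0 => x /=; rewrite in_itv/= => /andP[h1 h2].
  by have := lt_trans ba (lt_trans h1 h2); rewrite ltxx.
have [c _ hc] := @EVT_max R (fun x => `|v x|) a b ab
  (continuous_subspaceT (fun x => @continuous_comp _ _ _ v _ x (cv x) (@norm_continuous _ _ _))).
exists `|v c| => x /=; rewrite in_itv/= => /andP[h1 h2].
by apply: hc; rewrite in_itv/= !ltW.
Qed.

Section weighted_integral.
Variables (a b : R) (n : nat).
Hypothesis ab : a < b.
Local Notation mu := (@lebesgue_measure R).
Local Notation I := (`]a, b[%classic : set R).

Lemma measurable_oo : measurable I. Proof. exact: measurable_itv. Qed.

Lemma oo_measure_lty : (mu I < +oo)%E.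
Proof. by rewrite lebesgue_measure_itv/= lte_fin ab -EFinB ltry. Qed.

Definition wint (h : R -> R) : R := \int[mu]_(r in I) (h r * r ^+ n).

Lemma bmeas_pow : bmeas I (fun r => r ^+ n).
Proof. by apply: continuous_bmeas => x; exact: exprn_continuous. Qed.

Lemma wintegrable h : bmeas I h -> mu.-integrable I (EFin \o (fun r => h r * r ^+ n)).
Proof.
move=> bh; apply: bmeas_integrable; [exact: measurable_oo|exact: oo_measure_lty|].
by apply: bmeasM => //; exact: bmeas_pow.
Qed.

Lemma wintD h k : bmeas I h -> bmeas I k -> wint (fun r => h r + k r) = wint h + wint k.
Proof.
move=> bh bk; rewrite /wint -RintegralD//; [|exact: wintegrable|exact: wintegrable].
by apply: eq_Rintegral => r _; rewrite mulrDl.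
Qed.

Lemma wintZ c h : bmeas I h -> wint (fun r => c * h r) = c * wint h.
Proof.
move=> bh; rewrite /wint -RintegralZl//; last exact: wintegrable.
by apply: eq_Rintegral => r _; rewrite mulrA.
Qed.

Lemma wintB h k : bmeas I h -> bmeas I k -> wint (fun r => h r - k r) = wint h - wint k.
Proof.
move=> bh bk; rewrite /wint -RintegralB//; [|exact: wintegrable|exact: wintegrable].
by apply: eq_Rintegral => r _; rewrite mulrBl.
Qed.

Lemma eq_wint h k : (forall r, a < r < b -> h r = k r) -> wint h = wint k.
Proof.
by move=> hk; apply: eq_Rintegral => r /set_mem /=; rewrite in_itv => /hk ->.
Qed.

Lemma le_wint h k : 0 <= a -> bmeas I h -> bmeas I k ->
  (forall r, a < r < b -> h r <= k r) -> wint h <= wint k.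
Proof.
move=> a0 bh bk hk; apply: le_Rintegral => //; [exact: wintegrable|exact: wintegrable|].
move=> r /=; rewrite in_itv/= => /[dup] /hk hkr /andP[ar _].
by rewrite ler_wpM2r// exprn_ge0// ltW// (le_lt_trans a0).
Qed.

Lemma wint_ge0 h : 0 <= a -> (forall r, a < r < b -> 0 <= h r) -> 0 <= wint h.
Proof.
move=> a0 h0; apply: Rintegral_ge0 => r /=; rewrite in_itv/= => /[dup] /h0 hr /andP[ar _].
by rewrite mulr_ge0// exprn_ge0// ltW// (le_lt_trans a0).
Qed.

Lemma FTC_isC1 v v' : isC1 v v' -> \int[mu]_(r in I) v' r = v b - v a.
Proof.
move=> hv; have cv := isC1_continuous hv; have [dv cv'] := hv.
have bv' := continuous_bmeas a b cv'.
rewrite /Rintegral -(@integral_itv_bndoo _ a b (EFin \o v') true false); last first.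
  by apply/measurable_EFinP; case: bv'.
rewrite (@continuous_FTC2 _ v' v)//.
- by apply: continuous_subspaceT => x; exact: cv'.
- split; first by move=> x _; have [] := dv x.
  + by apply: cvg_at_right_filter; exact: cv.
  + by apply: cvg_at_left_filter; exact: cv.
- by move=> x _; rewrite derive1E; exact: derive_val.
Qed.

Lemma wint_pow_gt0 : 0 <= a -> 0 < wint (fun=> 1).
Proof.
move=> a0.
have h : isC1 (fun r => r ^+ n.+1) (fun r => n.+1%:R * r ^+ n * 1) := isC1X n isC1_id.
have := FTC_isC1 h.
have -> : \int[mu]_(r in I) (n.+1%:R * r ^+ n * 1) = n.+1%:R * wint (fun=> 1).
  rewrite -wintZ; last exact: bmeas_cst.
  by apply: eq_Rintegral => r _; rewrite !mulr1.
move=> E; rewrite -(@pmulr_rgt0 _ n.+1%:R)// E subr_gt0.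
by rewrite ltrXn2r.
Qed.

End weighted_integral.

End C1_functions.

(** * Integration along rays *)

Section slicing.
Context {R : realType} {n : nat}.
Local Notation E := 'rV[R]_n.+1.
Local Notation mu := (@lebesgue_measure R).
Variable s : radial_domain R.
Hypothesis hs : admissible s.
Local Notation om := (dom n.+1 s).
Local Notation bd := (boundary om).
Local Notation a := (inner s).
Local Notation b := (outer s).
Local Notation I := (`]a, b[%classic : set R).
Local Notation w1 := (@winner R n s).
Local Notation w2 := (@wouter R n s).

Let ab : a < b. Proof. exact: inner_lt_outer. Qed.
Let a0 : 0 <= a. Proof. exact: inner_ge0. Qed.

Local Open Scope ereal_scope.

Definition rayint (F : E -> \bar R) (th : E) : \bar R :=
  \int[mu]_r ((wt (n := n) r)%:E * (F \_ om) (r *: th)%R).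

Lemma measurable_rayint F : measurable_fun om F -> (forall x, om x -> 0 <= F x) ->
  measurable_fun setT (rayint F).
Proof.
move=> mF F0.
have F0' x : 0 <= (F \_ om) x by rewrite patchE; case: ifPn => // /set_mem; exact: F0.
have mF' : measurable_fun setT (F \_ om).
  exact/(measurable_restrictT _ (measurable_dom hs)).
have mG : measurable_fun setT (fun p : E * R => (wt (n := n) p.2)%:E * (F \_ om) (p.2 *: p.1)%R).
  apply: emeasurable_funM; last exact: measurableT_comp mF' measurable_scale.
  by apply/measurable_EFinP; exact: measurableT_comp measurable_wt _.
apply: (@measurable_fun_fubini_tonelli_F _ _ _ _ R mu _ mG).
by move=> p; apply: mule_ge0 => //; rewrite lee_fin wt_ge0.
Qed.

Lemma rayint_ge0 F th : (forall x, om x -> 0 <= F x) -> 0 <= rayint F th.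
Proof.
move=> F0; apply: integral_ge0 => r _; apply: mule_ge0; first by rewrite lee_fin wt_ge0.
by rewrite patchE; case: ifPn => // /set_mem; exact: F0.
Qed.

Lemma dom_ray r th : enorm th = 1%R -> (0 < r)%R ->
  (om (r *: th)%R) <-> (a < r < b)%R.
Proof.
move=> th1 r0; have er : enorm (r *: th)%R = r by rewrite enormZ th1 mulr1 gtr0_norm.
have := @dom_enorm R n s (r *: th)%R hs; rewrite er; apply.
by rewrite -enorm_eq0 er gt_eqF.
Qed.

Lemma rayintE F th : enorm th = 1%R ->
  rayint F th = \int[mu]_(r in I) ((r ^+ n)%:E * F (r *: th)%R).
Proof.
move=> th1; rewrite [RHS]integral_mkcond; apply: eq_integral => r _; rewrite !patchE /wt.
have [r0|r0] := boolP (0 < r)%R; last first.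
  rewrite mul0e memNset//= in_itv/= => /andP[ar _].
  by move: r0; rewrite (le_lt_trans a0 ar).
have -> : (r \in I) = (a < r < b)%R.
  by apply/idP/idP => [/set_mem/=|h]; [|apply/mem_set => /=]; rewrite in_itv.
have -> : (r *: th \in om)%R = (a < r < b)%R.
  by apply/idP/idP => [/set_mem/(dom_ray th1 r0)//|h]; exact/mem_set/(dom_ray th1 r0).
by case: ifPn => _; rewrite ?mule0.
Qed.

(** Polar coordinates for the extension of [F] by zero; the origin, which the open rays miss, is a
    null set. *)
Lemma dom_integral F : measurable_fun om F -> (forall x, om x -> 0 <= F x) ->
  \int[leb n.+1]_(x in om) F x = oint (rayint F).
Proof.
move=> mF F0.
have F0' x : 0 <= (F \_ om) x by rewrite patchE; case: ifPn => // /set_mem; exact: F0.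
have mF' : measurable_fun setT (F \_ om).
  exact/(measurable_restrictT _ (measurable_dom hs)).
rewrite /oint /rayint polar// integral_mkcond.
have mpos : measurable [set x : E | (0 < enorm x)%R].
  have := @measurable_enormT R n measurableT _ (measurable_itv `]0%R, +oo[).
  by rewrite setTI; congr measurable; apply/seteqP; split => x /=; rewrite in_itv/= andbT.
rewrite (@ge0_negligible_integral _ _ _ _ _ (~` [set x : E | (0 < enorm x)%R]))//.
- by rewrite setTD setCK.
- exact: measurableC.
- rewrite (_ : ~` _ = [set 0%R]) ?leb_set0//.
  apply/seteqP; split => x /=.
    move/negP; rewrite -leNgt => x0; apply/eqP; rewrite -enorm_eq0 eq_le x0.
    exact: enorm_ge0.
  by move=> ->; rewrite enorm0 ltxx.
Qed.

Definition bdryslice (G : E -> \bar R) (th : E) : \bar R :=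
  w1%:E * (G \_ bd) (a *: th)%R + w2%:E * (G \_ bd) (b *: th)%R.

Lemma bdrysliceE (G : E -> R) th : enorm th = 1%R ->
  bdryslice (EFin \o G) th = (w1 * G (a *: th) + w2 * G (b *: th))%R%:E.
Proof.
move=> th1; rewrite /bdryslice !patchE [in X in _ + X]mem_set; last exact: bdry_outer.
have [->|w10] := eqVneq w1 0%R; first by rewrite mul0e mul0r EFinD EFinM.
by rewrite mem_set ?EFinD ?EFinM//; exact: bdry_inner.
Qed.

Lemma measurable_bdryslice G : measurable_fun bd G -> measurable_fun setT (bdryslice G).
Proof.
move=> mG; have mG' : measurable_fun setT (G \_ bd).
  exact/(measurable_restrictT _ (measurable_bdry hs)).
by apply: emeasurable_funD; apply: emeasurable_funM => //;
  exact: measurableT_comp mG' (measurable_dilate _).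
Qed.

Lemma bdryslice_ge0 G th : (forall x, bd x -> 0 <= G x) -> 0 <= bdryslice G th.
Proof.
move=> G0; have G0' x : 0 <= (G \_ bd) x.
  by rewrite patchE; case: ifPn => // /set_mem; exact: G0.
by apply: adde_ge0; apply: mule_ge0 => //; rewrite lee_fin ?winner_ge0 ?ltW ?wouter_gt0.
Qed.

Lemma bdry_integral G : measurable_fun bd G -> (forall x, bd x -> 0 <= G x) ->
  \int[bdry_measure s]_(x in bd) G x = oint (bdryslice G).
Proof.
move=> mG G0; have G0' x : 0 <= (G \_ bd) x.
  by rewrite patchE; case: ifPn => // /set_mem; exact: G0.
have mG' : measurable_fun setT (G \_ bd).
  exact/(measurable_restrictT _ (measurable_bdry hs)).
have mGs c : measurable_fun setT (fun th : E => (G \_ bd) (c *: th)%R).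
  exact: measurableT_comp mG' (measurable_dilate _).
have nbd0 : ~ bd 0%R by move=> /(bdry_gt0 hs); rewrite enorm0 ltxx.
have mbd := @measurable_bdry R n s hs.
rewrite /bdryslice ointD; last 4 first.
- by apply: emeasurable_funM.
- by apply: emeasurable_funM.
- by move=> th; apply: mule_ge0 => //; rewrite lee_fin winner_ge0.
- by move=> th; apply: mule_ge0 => //; rewrite lee_fin ltW// wouter_gt0.
rewrite !ointZ//; [|by rewrite ltW// wouter_gt0|by rewrite winner_ge0].
have key rho : (0 < rho)%R -> \int[sphere_measure rho]_(x in bd) G x =
    (rho ^+ n)%:E * oint (fun th => (G \_ bd) (rho *: th)%R).
  by move=> rho0; exact: sphere_measure_integral.
case: s hs key mG G0 mbd => [r /= r0|r1 r2 /= /andP[r10 r12]] key mG G0 mbd.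
  by rewrite mul0e add0e key.
rewrite ge0_integral_measure_add// !key//.
exact: lt_trans r12.
Qed.

(** Bulk and boundary are added before the comparison because the inequality on a ray couples the
    profile to its endpoint values and holds only for the sum. Nonnegativity lets Tonelli apply
    without integrability. *)
Lemma slice_mono (P P' Q Q' : E -> R) :
  measurable_fun om P -> measurable_fun om P' ->
  measurable_fun bd Q -> measurable_fun bd Q' ->
  (forall x, om x -> 0 <= P x)%R -> (forall x, om x -> 0 <= P' x)%R ->
  (forall x, bd x -> 0 <= Q x)%R -> (forall x, bd x -> 0 <= Q' x)%R ->
  (forall th, enorm th = 1%R ->
     \int[mu]_(r in I) ((r ^+ n)%:E * (P (r *: th)%R)%:E) +
       (w1 * Q (a *: th) + w2 * Q (b *: th))%R%:E <=
     \int[mu]_(r in I) ((r ^+ n)%:E * (P' (r *: th)%R)%:E) +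
       (w1 * Q' (a *: th) + w2 * Q' (b *: th))%R%:E) ->
  \int[leb n.+1]_(x in om) (P x)%:E + \int[bdry_measure s]_(x in bd) (Q x)%:E <=
  \int[leb n.+1]_(x in om) (P' x)%:E + \int[bdry_measure s]_(x in bd) (Q' x)%:E.
Proof.
move=> mP mP' mQ mQ' P0 P0' Q0 Q0' H.
rewrite !dom_integral//; [|exact/measurable_EFinP|exact/measurable_EFinP].
rewrite !bdry_integral//; [|exact/measurable_EFinP|exact/measurable_EFinP].
rewrite -!ointD.
- apply: le_oint.
  + by apply: emeasurable_funD; [apply: measurable_rayint|apply: measurable_bdryslice] => //;
      apply/measurable_EFinP.
  + by apply: emeasurable_funD; [apply: measurable_rayint|apply: measurable_bdryslice] => //;
      apply/measurable_EFinP.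
  + by move=> th; apply: adde_ge0; [exact: rayint_ge0|exact: bdryslice_ge0].
  + move=> th th1; rewrite !rayintE//.
    by rewrite (bdrysliceE Q th1) (bdrysliceE Q' th1); exact: H.
all: try by move=> th; [exact: rayint_ge0].
all: try by move=> th; [exact: bdryslice_ge0].
all: try by apply: measurable_rayint => //; exact/measurable_EFinP.
all: by apply: measurable_bdryslice; exact/measurable_EFinP.
Qed.

Lemma leb_dom_lty : leb n.+1 om < +oo.
Proof.
apply: le_lt_trans (leb_box_lty n.+1 b); apply: le_measure; rewrite ?inE.
- exact: measurable_dom.
- exact: measurable_box.
- by move=> x /(dom_lt hs) xb i; rewrite (le_trans (coord_le_enorm _ _))// ltW.
Qed.

Lemma bdry_lty : bdry_measure s bd < +oo.
Proof.
rewrite -[X in X < _]mul1e -integral_cst//; last exact: measurable_bdry.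
rewrite bdry_integral//.
rewrite (@oint_eq _ _ _ (fun=> (w1 + w2)%:E)); last first.
  by move=> th th1; have := bdrysliceE (cst 1%R) th1; rewrite /= !mulr1 => <-.
rewrite /oint integral_cst//; last exact: measurable_pball.
rewrite muleA; apply: lte_mul_pinfty => //.
  by apply: mule_ge0 => //; rewrite lee_fin addr_ge0// ?winner_ge0// ltW// wouter_gt0.
apply: le_lt_trans (leb_box_lty n.+1 1%R); apply: le_measure; rewrite ?inE.
- exact: measurable_pball.
- exact: measurable_box.
- by move=> x /andP[_ xb] i; rewrite (le_trans (coord_le_enorm _ _)).
Qed.

(** If the domain were null, polar coordinates would make the area of the unit sphere zero, hence
    the punctured ball null, and then, by polar coordinates again, the whole space. *)
Lemma leb_dom_gt0 : 0 < leb n.+1 om.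
Proof.
rewrite lt0e measure_ge0 andbT; apply/negP => /eqP d0.
have E1 : \int[leb n.+1]_(x in om) 1 = 0 by rewrite integral_cst ?d0 ?mule0//; exact: measurable_dom.
have p0 : leb n.+1 (pball (R := R) (n := n)) = 0.
  have W0 := wint_pow_gt0 n ab a0.
  move: E1; rewrite dom_integral//.
  rewrite (@oint_eq _ _ _ (fun=> (wint a b n (fun=> 1%R))%:E)); last first.
    move=> th th1; rewrite rayintE// /wint /Rintegral fineK.
      by apply: eq_integral => r _; rewrite mule1 mul1r.
    apply: integrable_fin_num; first exact: measurable_oo.
    by apply: wintegrable => //; exact: bmeas_cst.
  rewrite /oint integral_cst//; last exact: measurable_pball.
  move/eqP; rewrite !mule_eq0 eqe pnatr_eq0 /= eqe gt_eqF//=.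
  by move/eqP.
have := @polar R n (cst 1) (@measurable_cst _ _ _ _ _ _) (fun=> lee01).
rewrite null_set_integral//; last 2 first.
- exact: measurable_pball.
- apply: measurable_funTS; apply: (@measurable_fun_fubini_tonelli_F _ _ _ _ R mu (fun p => (wt p.2)%:E * cst 1 (p.2 *: sproj 1 p.1)%R)).
    apply: emeasurable_funM => //; apply/measurable_EFinP.
    exact: measurableT_comp measurable_wt _.
  by move=> p; rewrite mule1 lee_fin wt_ge0.
rewrite mule0 integral_cst//; last first.
  have := @measurable_enormT R n measurableT _ (measurable_itv `]0%R, +oo[).
  by rewrite setTI; congr measurable; apply/seteqP; split => x /=; rewrite in_itv/= andbT.
rewrite mul1e => /esym e0.
have : leb n.+1 [set: E] <= 0; last by rewrite leb_setT.
apply: (@le_trans _ _ (leb n.+1 ([set (0%R : E)] `|` [set x | (0 < enorm x)%R]))).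
  apply: le_measure; rewrite ?inE//.
    rewrite (_ : _ `|` _ = setT)//; apply/seteqP; split => // x _.
    have [->|x0] := eqVneq x 0%R; [by left|right => /=].
    by rewrite lt_neqAle enorm_ge0 eq_sym enorm_eq0 x0.
  move=> x _; have [->|x0] := eqVneq x 0%R; [by left|right => /=].
  by rewrite lt_neqAle enorm_ge0 eq_sym enorm_eq0 x0.
apply: (@le_trans _ _ (leb n.+1 [set (0%R : E)] + leb n.+1 [set x : E | (0 < enorm x)%R])); last first.
  by rewrite leb_set0 e0 adde0.
apply: measureU2.
- rewrite (_ : [set 0%R] = box 0%R); first exact: measurable_box.
  apply/seteqP; split => x /=; first by move=> -> i; rewrite mxE normr0.
  by move=> h; apply/rowP => i; rewrite mxE; apply/eqP; rewrite -normr_le0.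
- have := @measurable_enormT R n measurableT _ (measurable_itv `]0%R, +oo[).
  by rewrite setTI; congr measurable; apply/seteqP; split => x /=; rewrite in_itv/= andbT.
Qed.

Local Close Scope ereal_scope.

Lemma ray_measurable (F : E -> R) th : measurable_fun om F -> enorm th = 1 ->
  measurable_fun I (fun r : R => F (r *: th)).
Proof.
move=> mF th1; have mF' : measurable_fun setT (F \_ om).
  exact/(measurable_restrictT _ (measurable_dom hs)).
have : measurable_fun I (fun r : R => (F \_ om) (r *: th)).
  apply: measurable_funTS; apply: (measurableT_comp mF').
  have := measurableT_comp (@measurable_scale R n) (@measurable_pair1 _ _ _ _ th).
  exact.
apply: eq_measurable_fun => r /set_mem /=; rewrite in_itv/= => rab; rewrite patchE mem_set//.
by apply/dom_ray => //; case/andP: rab => ar _; exact: le_lt_trans ar.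
Qed.

Lemma ray_bmeas (F : E -> R) th : bmeas om F -> enorm th = 1 ->
  bmeas I (fun r : R => F (r *: th)).
Proof.
move=> [mF [C hC]] th1; split; first exact: ray_measurable.
exists C => r /=; rewrite in_itv/= => rab; apply: hC.
by apply/dom_ray => //; case/andP: rab => ar _; exact: le_lt_trans ar.
Qed.

Lemma max0B (R' : realDomainType) (x : R') : x = Num.max x 0 - Num.max (- x) 0.
Proof.
have [x0|x0] := leP x 0.
  by rewrite (max_idPl _) ?oppr_ge0// sub0r opprK.
by rewrite (max_idPr _) ?subr0// oppr_le0 ltW.
Qed.

(** Since [slice_mono] compares nonnegative integrands, the negative parts are moved to the other
    side first. *)
Lemma slice_ge0 (F G : E -> R) : bmeas om F ->
  (bdry_measure s).-integrable bd (EFin \o G) ->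
  (forall th, enorm th = 1 ->
     0 <= wint a b n (fun r => F (r *: th)) + (w1 * G (a *: th) + w2 * G (b *: th))) ->
  0 <= \int[leb n.+1]_(x in om) F x + \int[bdry_measure s]_(x in bd) G x.
Proof.
move=> bF iG H.
have mom := @measurable_dom R n s hs; have mbd := @measurable_bdry R n s hs.
have mG : measurable_fun bd G by apply/measurable_EFinP; exact: measurable_int iG.
have mF := proj1 bF.
pose Fp x := Num.max (F x) 0; pose Fm x := Num.max (- F x) 0.
pose Gp x := Num.max (G x) 0; pose Gm x := Num.max (- G x) 0.
have bFp : bmeas om Fp by exact: bmeas_max0.
have bFm : bmeas om Fm by apply: bmeas_max0 => //; exact: bmeasN.
have max0 (x : R) : 0 <= Num.max x 0 by rewrite le_max lexx orbT.
have iGp : (bdry_measure s).-integrable bd (EFin \o Gp).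
  apply: le_integrable iG => //; first by apply/measurable_EFinP; exact: measurable_maxr.
  move=> x _; rewrite lee_fin ger0_norm ?max0// /Gp ge_max ler_norm; exact: normr_ge0.
have iGm : (bdry_measure s).-integrable bd (EFin \o Gm).
  apply: le_integrable iG => //.
    by apply/measurable_EFinP; apply: measurable_maxr => //; exact: measurable_funN.
  by move=> x _; rewrite lee_fin ger0_norm ?max0// /Gm ge_max -normrN ler_norm; exact: normr_ge0.
have iFp : (leb n.+1).-integrable om (EFin \o Fp) := bmeas_integrable mom leb_dom_lty bFp.
have iFm : (leb n.+1).-integrable om (EFin \o Fm) := bmeas_integrable mom leb_dom_lty bFm.
have -> : \int[leb n.+1]_(x in om) F x = \int[leb n.+1]_(x in om) Fp x - \int[leb n.+1]_(x in om) Fm x.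
  by rewrite -RintegralB//; apply: eq_Rintegral => x _; exact: max0B.
have -> : \int[bdry_measure s]_(x in bd) G x =
    \int[bdry_measure s]_(x in bd) Gp x - \int[bdry_measure s]_(x in bd) Gm x.
  by rewrite -RintegralB//; apply: eq_Rintegral => x _; exact: max0B.
rewrite addrACA -opprD subr_ge0 -lee_fin !EFinD.
have fK d (T : measurableType d) (m : {measure set T -> \bar R}) D (h : T -> R) :
    measurable D -> m.-integrable D (EFin \o h) ->
    (\int[m]_(x in D) h x)%:E = (\int[m]_(x in D) (h x)%:E)%E.
  by move=> mD ih; rewrite fineK//; exact: integrable_fin_num.
rewrite !fK//; apply: slice_mono => //.
- exact: proj1 bFm.
- exact: proj1 bFp.
- by apply: measurable_maxr => //; exact: measurable_funN.
- exact: measurable_maxr.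
- by move=> x _; exact: max0.
- by move=> x _; exact: max0.
- by move=> x _; exact: max0.
- by move=> x _; exact: max0.
move=> th th1.
have cv (h : E -> R) : bmeas om h ->
    (\int[mu]_(r in I) ((r ^+ n)%:E * (h (r *: th))%:E) = (wint a b n (fun r => h (r *: th)))%:E)%E.
  move=> bh; rewrite /wint fK; last 2 first.
  - exact: measurable_oo.
  - by apply: (@wintegrable R a b n ab (fun r => h (r *: th))); exact: (ray_bmeas bh th1).
  by apply: eq_integral => r _; rewrite -EFinM mulrC.
rewrite !cv// -!EFinD lee_fin -subr_ge0.
have := H th th1.
have -> : wint a b n (fun r => F (r *: th)) =
  wint a b n (fun r => Fp (r *: th)) - wint a b n (fun r => Fm (r *: th)).
  rewrite -wintB//; [|exact: ray_bmeas|exact: ray_bmeas].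
  by apply: eq_wint => r _; exact: max0B.
rewrite {1}(max0B (G (a *: th))) {1}(max0B (G (b *: th))) -/(Gp _) -/(Gm _).
move=> h; apply: le_trans h _; rewrite le_eqVlt; apply/orP; left; apply/eqP.
by rewrite -/(Gp _) -/(Gm _); ring.
Qed.

(** The area of the unit sphere, recovered as the volume of the domain divided by its radial
    integral. *)
Definition omega : R := fine (leb n.+1 om) / wint a b n (fun=> 1).

Lemma omega_gt0 : 0 < omega.
Proof.
apply: divr_gt0; last exact: wint_pow_gt0.
by apply: fine_gt0; rewrite leb_dom_gt0 leb_dom_lty.
Qed.

(** Both inequalities come from [slice_ge0], by comparison with the constant bulk function [K / W],
    whose integral along each ray is [K]. *)
Lemma slice_eq (F G : E -> R) (K : R) : bmeas om F ->
  (bdry_measure s).-integrable bd (EFin \o G) ->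
  (forall th, enorm th = 1 ->
     wint a b n (fun r => F (r *: th)) + (w1 * G (a *: th) + w2 * G (b *: th)) = K) ->
  \int[leb n.+1]_(x in om) F x + \int[bdry_measure s]_(x in bd) G x = omega * K.
Proof.
move=> bF iG H; have W0 := wint_pow_gt0 n ab a0.
have mom := @measurable_dom R n s hs; have mbd := @measurable_bdry R n s hs.
set W := wint a b n (fun=> 1) in W0.
have bc : bmeas om (fun=> K / W) by exact: bmeas_cst.
have i1 := bmeas_integrable mom leb_dom_lty bF.
have i2 := bmeas_integrable mom leb_dom_lty bc.
have EK : \int[leb n.+1]_(x in om) (K / W) = omega * K.
  by rewrite Rintegral_cst// /omega -/W; field; rewrite gt_eqF.
have wc : wint a b n (fun=> K / W) = K.
  rewrite -[X in _ = X](@divfK _ W) ?gt_eqF//.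
  rewrite -wintZ//; last exact: bmeas_cst.
  by apply: eq_wint => r _; rewrite mulr1.
apply/eqP; rewrite eq_le -EK; apply/andP; split.
- rewrite -subr_ge0 opprD addrA -RintegralB// -[X in _ + X]mulN1r -RintegralZl//.
  apply: slice_ge0; first exact: bmeasB.
    exact: (integrableZl mbd (-1) iG).
  move=> th th1; rewrite (wintB n ab); [|exact: bmeas_cst|exact: ray_bmeas].
  rewrite wc -(H th th1).
  by rewrite le_eqVlt; apply/orP; left; apply/eqP; ring.
- rewrite -subr_ge0 addrAC -RintegralB//.
  apply: slice_ge0 => //; first exact: bmeasB.
  move=> th th1; rewrite (wintB n ab); [|exact: ray_bmeas|exact: bmeas_cst].
  rewrite wc -(H th th1).
  by rewrite le_eqVlt; apply/orP; left; apply/eqP; ring.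
Qed.

Lemma dom_radial (F : E -> R) (h : R -> R) : bmeas om F ->
  (forall x, om x -> F x = h (enorm x)) ->
  \int[leb n.+1]_(x in om) F x = omega * wint a b n h.
Proof.
move=> bF Fh.
have bz : (bdry_measure s).-integrable bd (EFin \o (fun=> 0 : R)) by exact: integrable0.
have z : \int[bdry_measure s]_(x in bd) (0 : R) = 0.
  by rewrite Rintegral_cst ?mul0r//; exact: measurable_bdry.
rewrite -[LHS]addr0 -z; apply: slice_eq => // th th1.
rewrite !mulr0 !addr0; apply: eq_wint => r rab.
have r0 : 0 < r by case/andP: rab => ar _; exact: le_lt_trans ar.
rewrite Fh; last exact/dom_ray.
by rewrite enormZ th1 mulr1 gtr0_norm.
Qed.

Lemma bdry_radial (G : E -> R) (g1 g2 : R) :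
  (bdry_measure s).-integrable bd (EFin \o G) ->
  (forall th, enorm th = 1 -> w1 != 0 -> G (a *: th) = g1) ->
  (forall th, enorm th = 1 -> G (b *: th) = g2) ->
  \int[bdry_measure s]_(x in bd) G x = omega * (w1 * g1 + w2 * g2).
Proof.
move=> iG G1 G2.
have bz : bmeas om (fun=> 0 : R) by exact: bmeas_cst.
have z : \int[leb n.+1]_(x in om) (0 : R) = 0.
  by rewrite Rintegral_cst ?mul0r//; exact: measurable_dom.
rewrite -[LHS]add0r -z; apply: slice_eq => // th th1.
rewrite [X in X + _ = _](_ : _ = 0).
  rewrite add0r G2//; have [->|w10] := eqVneq w1 0; first by rewrite !mul0r.
  by rewrite G1.
by rewrite /wint; under eq_Rintegral do rewrite mul0r; rewrite Rintegral_cst ?mul0r//; exact: measurable_oo.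
Qed.

End slicing.

Lemma discriminant_le (R : realFieldType) (q0 B q1 : R) :
  (forall s, 0 <= q0 + 2 * s * B + s ^+ 2 * q1) -> B ^+ 2 <= q0 * q1.
Proof.
move=> h.
have q00 : 0 <= q0 by have := h 0; rewrite expr0n /= mulr0 !mul0r !addr0.
have q10 : 0 <= q1.
  rewrite leNgt; apply/negP => q1n.
  (* Chosen so that [q0 + 2 * |B| + s * q1 = q1 - 1], which is negative; since [s >= 1], multiplying
     by [s] bounds the polynomial from above. *)
  pose s := (q0 + 2 * `|B| + 1) / - q1 + 1.
  have s1 : 1 <= s.
    rewrite lerDr; apply: divr_ge0; last by rewrite oppr_ge0 ltW.
    by rewrite addr_ge0// addr_ge0// mulr_ge0.
  have hs := h s.
  have E : (s - 1) * - q1 = q0 + 2 * `|B| + 1 by rewrite /s addrK divfK// oppr_eq0 lt_eqF.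
  have Bs : B <= `|B| by exact: ler_norm.
  have : q0 + 2 * s * B + s ^+ 2 * q1 <= s * (q0 + 2 * `|B| + s * q1).
    have : 2 * s * B <= s * (2 * `|B|) by rewrite mulrAC mulrC ler_wpM2l ?ler_wpM2l// (le_trans ler01).
    have : q0 <= s * q0 by rewrite ler_peMl.
    nra.
  have : q0 + 2 * `|B| + s * q1 < 0 by nra.
  have s0 : 0 < s by exact: lt_le_trans s1.
  by move=> hneg /(le_trans hs); rewrite pmulr_rge0// leNgt hneg.
have [q1z|q1n] := eqVneq q1 0.
  have B0 : B = 0.
    apply/eqP/negPn/negP => Bn.
    (* With [q1 = 0] the polynomial is affine, and here it takes the value [-1]. *)
    have := h (- (q0 + 1) / (2 * B)); rewrite q1z mulr0 addr0.
    have -> : 2 * (- (q0 + 1) / (2 * B)) * B = - (q0 + 1) by field.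
    lra.
  by rewrite B0 q1z mulr0 expr0n.
have q1p : 0 < q1 by rewrite lt_neqAle eq_sym q1n.
have := h (- B / q1).
have -> : q0 + 2 * (- B / q1) * B + (- B / q1) ^+ 2 * q1 = (q0 * q1 - B ^+ 2) / q1 by field.
by rewrite pmulr_lge0 ?invr_gt0// subr_ge0.
Qed.

(** * Forms on radial profiles *)

Section interpolation.
Context {R : realType}.
Local Notation mu := (@lebesgue_measure R).

Lemma itv_measure_lty (x y : R) : (mu `]x, y[ < +oo)%E.
Proof. by rewrite lebesgue_measure_itv/= lte_fin; case: ifP => // _; rewrite -EFinB ltry. Qed.

Lemma Rintegral_itv_cst (x y c : R) : x <= y -> \int[mu]_(t in `]x, y[) c = c * (y - x).
Proof.
move=> xy; rewrite Rintegral_cst//; congr (_ * _).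
rewrite [X in fine X](_ : _ = (y - x)%:E)//.
rewrite [LHS]lebesgue_measure_itv/= lte_fin; case: ltP => // yx.
by rewrite (@le_anti _ _ x y) ?subrr// xy.
Qed.

Lemma Rintegral_sub_le (c e c' e' : R) (f : R -> R) : c' <= c -> e <= e' ->
  bmeas `]c', e'[ f -> (forall x, c' < x < e' -> 0 <= f x) ->
  \int[mu]_(x in `]c, e[) f x <= \int[mu]_(x in `]c', e'[) f x.
Proof.
move=> cc ee [mf [C hC]] f0.
have sub : `]c, e[%classic `<=` (`]c', e'[%classic : set R).
  move=> x /=; rewrite !in_itv/= => /andP[h1 h2].
  by rewrite (le_lt_trans cc h1) (lt_le_trans h2 ee).
have f0' (x : R) : `]c', e'[%classic x -> (0 <= (f x)%:E)%E.
  by rewrite /= in_itv/= => /f0; rewrite lee_fin.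
rewrite /Rintegral fine_le//.
- apply: integrable_fin_num => //; apply: bmeas_integrable => //; first exact: itv_measure_lty.
  by split; [exact: measurable_funS mf|exists C => x /sub; exact: hC].
- apply: integrable_fin_num => //; apply: bmeas_integrable => //; first exact: itv_measure_lty.
  by split => //; exists C.
apply: ge0_subset_integral => //; exact/measurable_EFinP.
Qed.

(** Cauchy-Schwarz for [v'] against the constant 1, obtained from the discriminant of the integral
    of [(l * v' - 1) ^+ 2] as a polynomial in [l]. *)
Lemma increment_sqr_le (v v' : R -> R) (x y : R) : isC1 v v' -> x < y ->
  (v y - v x) ^+ 2 <= (\int[mu]_(t in `]x, y[) (v' t ^+ 2)) * (y - x).
Proof.
move=> hv xy.
have cv' := proj2 hv.
have bv' := continuous_bmeas x y cv'.
rewrite -sqrrN mulrC; apply: discriminant_le => l.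
have fin : (mu `]x, y[ < +oo)%E by exact: itv_measure_lty.
have e1 : y - x = \int[mu]_(t in `]x, y[) (1 : R).
  by rewrite Rintegral_itv_cst ?mul1r// ltW.
have iv' : mu.-integrable `]x, y[ (EFin \o v') by exact: bmeas_integrable.
have i2 : mu.-integrable `]x, y[ (EFin \o (fun t => v' t ^+ 2)).
  by apply: bmeas_integrable => //; exact: bmeasX.
have i1 : mu.-integrable `]x, y[ (EFin \o (fun=> 1 : R)).
  by apply: bmeas_integrable => //; exact: bmeas_cst.
have i3 : mu.-integrable `]x, y[ (EFin \o (fun t => (- 2 * l) * v' t)).
  by apply: bmeas_integrable => //; apply: bmeasM => //; exact: bmeas_cst.
have i4 : mu.-integrable `]x, y[ (EFin \o (fun t => l ^+ 2 * v' t ^+ 2)).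
  apply: bmeas_integrable => //; apply: bmeasM; first exact: bmeas_cst.
  exact: bmeasX.
have i5 : mu.-integrable `]x, y[ (EFin \o (fun t => 1 + (- 2 * l) * v' t)).
  apply: bmeas_integrable => //; apply: bmeasD; first exact: bmeas_cst.
  by apply: bmeasM => //; exact: bmeas_cst.
have -> : y - x + 2 * l * - (v y - v x) + l ^+ 2 * \int[mu]_(t in `]x, y[) (v' t ^+ 2) =
  \int[mu]_(t in `]x, y[) (l * v' t - 1) ^+ 2.
  rewrite -(FTC_isC1 xy hv) {1}e1.
  transitivity (\int[mu]_(t in `]x, y[) (1 + (- 2 * l) * v' t + l ^+ 2 * v' t ^+ 2)).
    rewrite RintegralD// RintegralD// !RintegralZl//; ring.
  by apply: eq_Rintegral => t _; ring.
by apply: Rintegral_ge0 => t _; exact: sqr_ge0.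
Qed.

Section weighted.
Variables (a b : R) (n : nat).
Hypotheses (a0 : 0 <= a) (ab : a < b).

(** Compare [v r] with the minimum of [v] over the cell [[s0, s0 + l]]: the minimum is controlled by
    the weighted integral of [v], the difference by [increment_sqr_le] over a distance of at most
    [2 * l]. The constant [c] compares the weight at [r] with the weight on the way to the cell,
    which keeps the estimate valid when [a = 0]. *)
Lemma pointwise_interpolation (v v' : R -> R) (r s0 l c : R) : isC1 v v' ->
  (forall t, a <= t <= b -> 0 <= v t) -> 0 < l -> 0 < c ->
  a <= s0 -> s0 + l <= b -> a <= r <= b ->
  s0 - l <= r -> r <= s0 + 2 * l ->
  (forall t, s0 < t < s0 + l -> l ^+ n <= t ^+ n) ->
  (forall t, (s0 < t < r) || (r < t < s0 + l) -> c * r ^+ n <= t ^+ n) ->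
  r ^+ n * v r ^+ 2 <= 4 * l / c * wint a b n (fun t => v' t ^+ 2) +
    2 * (b ^+ n / (l * l ^+ n) ^+ 2) * wint a b n v ^+ 2.
Proof.
move=> hv v0 l0 c0 as0 slb /andP[ar rb] sr rs hJ hr.
have cv := isC1_continuous hv; have cv' := proj2 hv.
have sl : s0 <= s0 + l by rewrite lerDl ltW.
have [t /[!in_itv]/= /andP[st ts] tmin] := EVT_min sl (continuous_subspaceT cv).
have sl' : s0 < s0 + l by rewrite ltrDl.
have bvw : bmeas `]a, b[ (fun x => v x * x ^+ n).
  by apply: bmeasM; [exact: continuous_bmeas|exact: bmeas_pow].
have vt0 : 0 <= v t by apply: v0; rewrite (le_trans as0 st) (le_trans ts slb).
have avg : v t * (l * l ^+ n) <= wint a b n v.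
  apply: (@le_trans _ _ (\int[mu]_(x in `]s0, (s0 + l)[) (v x * x ^+ n))); last first.
    apply: Rintegral_sub_le => //.
    move=> x /andP[ax xb]; rewrite mulr_ge0//; first by apply: v0; rewrite !ltW.
    by rewrite exprn_ge0// (le_trans a0)// ltW.
  have -> : v t * (l * l ^+ n) = \int[mu]_(x in `]s0, (s0 + l)[) (v t * l ^+ n).
    by rewrite Rintegral_itv_cst//; ring.
  have fin : (mu `]s0, (s0 + l)%R[ < +oo)%E.
    by exact: itv_measure_lty.
  apply: le_Rintegral => //.
  - by apply: bmeas_integrable => //; exact: bmeas_cst.
  - apply: bmeas_integrable => //.
    by apply: bmeasM; [exact: continuous_bmeas|exact: bmeas_pow].
  move=> x /=; rewrite in_itv/= => xs; have /andP[x1 x2] := xs.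
  apply: ler_pM => //; first by rewrite exprn_ge0// ltW.
    by apply: tmin; rewrite in_itv/= !ltW.
  exact: hJ.
have w0 : 0 <= wint a b n v.
  by apply: wint_ge0 => // x /andP[x1 x2]; apply: v0; rewrite !ltW.
set L := l * l ^+ n in avg *.
have L0 : 0 < L by rewrite mulr_gt0// exprn_gt0.
have vt2 : v t ^+ 2 <= (1 / L ^+ 2) * wint a b n v ^+ 2.
  rewrite mul1r mulrC ler_pdivlMr ?exprn_gt0// -exprMn lerXn2r ?nnegrE//.
  by rewrite mulr_ge0// ltW.
have rn0 : 0 <= r ^+ n by rewrite exprn_ge0// (le_trans a0).
have rbn : r ^+ n <= b ^+ n by rewrite lerXn2r ?nnegrE// (le_trans a0)// ltW.
set S := wint a b n (fun t => v' t ^+ 2).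
have S0 : 0 <= S by apply: wint_ge0 => // x _; exact: sqr_ge0.
have bv'2 : bmeas `]a, b[ (fun x => v' x ^+ 2 * x ^+ n).
  by apply: bmeasM; [apply: bmeasX; exact: continuous_bmeas|exact: bmeas_pow].
have inc : c * r ^+ n * (v r - v t) ^+ 2 <= 2 * l * S.
  have gen x y : x < y -> a <= x -> y <= b -> y - x <= 2 * l ->
     (forall z, x < z < y -> c * r ^+ n <= z ^+ n) ->
     c * r ^+ n * (v y - v x) ^+ 2 <= 2 * l * S.
    move=> xy ax yb xyl hz.
    have cr0 : 0 <= c * r ^+ n by rewrite mulr_ge0// ltW.
    apply: le_trans (ler_wpM2l cr0 (increment_sqr_le hv xy)) _.
    rewrite mulrA [leRHS]mulrC; apply: ler_pM => //.
    - by rewrite mulr_ge0// Rintegral_ge0// => z _; exact: sqr_ge0.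
    - by rewrite subr_ge0 ltW.
    have fin : (mu `]x, y[ < +oo)%E by exact: itv_measure_lty.
    apply: (@le_trans _ _ (\int[mu]_(z in `]x, y[) (v' z ^+ 2 * z ^+ n))); last first.
      apply: Rintegral_sub_le => // z /andP[az _]; rewrite mulr_ge0 ?sqr_ge0//.
      by rewrite exprn_ge0// (le_trans a0)// ltW.
    have bb : bmeas `]x, y[ (fun z => v' z ^+ 2) by apply: bmeasX; exact: continuous_bmeas.
    rewrite -RintegralZl//; last by apply: bmeas_integrable.
    apply: le_Rintegral => //.
    - by apply: bmeas_integrable => //; apply: bmeasM => //; exact: bmeas_cst.
    - by apply: bmeas_integrable => //; apply: bmeasM => //; exact: bmeas_pow.
    by move=> z /=; rewrite in_itv/= => /hz h; rewrite mulrC ler_wpM2l ?sqr_ge0.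
  have [rt|tr|->] := ltgtP r t.
  - rewrite -sqrrN opprB; apply: gen => //.
    + exact: le_trans slb.
    + by move: sr ts; lra.
    + by move=> z /andP[z1 z2]; apply: hr; rewrite z1 (lt_le_trans z2 ts) orbT.
  - apply: gen => //.
    + exact: le_trans st.
    + by move: rs st; lra.
    + by move=> z /andP[z1 z2]; apply: hr; rewrite z2 (le_lt_trans st z1).
  - by rewrite subrr expr0n mulr0 !mulr_ge0// ltW.
have -> : 4 * l / c * S = 2 * (2 * l * S / c) by field; rewrite gt_eqF.
have inc' : r ^+ n * (v r - v t) ^+ 2 <= 2 * l * S / c.
  by rewrite ler_pdivlMr// mulrC mulrA.
have vr2 : v r ^+ 2 <= 2 * (v r - v t) ^+ 2 + 2 * v t ^+ 2.
  by have := sqr_ge0 (v r - 2 * v t); nra.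
have h2 : r ^+ n * v t ^+ 2 <= b ^+ n / L ^+ 2 * wint a b n v ^+ 2.
  apply: le_trans (ler_wpM2r (sqr_ge0 _) rbn) _.
  by rewrite -mulrA ler_wpM2l ?exprn_ge0 ?(le_trans a0 (ltW ab))// -[L^-2]mul1r.
apply: le_trans (ler_wpM2l rn0 vr2) _; rewrite mulrDr.
have -> : r ^+ n * (2 * (v r - v t) ^+ 2) = 2 * (r ^+ n * (v r - v t) ^+ 2) by ring.
have -> : r ^+ n * (2 * v t ^+ 2) = 2 * (r ^+ n * v t ^+ 2) by ring.
by rewrite -[X in _ <= _ + X]mulrA lerD// ler_wpM2l.
Qed.

(* The cell of length [l] compared with the point [r] lies to its right, where
   the weight is larger, unless [r] is close to [b], where it is bounded below. *)
Lemma interpolation (th : R) : 0 < th -> exists2 K, 0 <= K &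
  forall v v' : R -> R, isC1 v v' -> (forall t, a <= t <= b -> 0 <= v t) ->
  wint a b n (fun t => v t ^+ 2) <=
    th * wint a b n (fun t => v' t ^+ 2) + K * wint a b n v ^+ 2.
Proof.
(* The factor [1 / 2] is the worst ratio between a radius met on the way to the cell and [r]. *)
move=> th0; pose c : R := (2^-1) ^+ n.
have c0 : 0 < c by rewrite exprn_gt0// invr_gt0.
have c1 : c <= 1 by rewrite exprn_ile1// ?invr_ge0// invf_le1// ler1n.
(* The first bound leaves room for the cell on one side of [r]; the second makes the coefficient of
   the gradient term at most [th] after integration over an interval of length [b - a]. *)
pose l := Num.min ((b - a) / 8) (th * c / (4 * (b - a))).
have ba : 0 < b - a by rewrite subr_gt0.
have l0 : 0 < l by rewrite lt_min !divr_gt0// ?mulr_gt0.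
have l1 : 8 * l <= b - a by rewrite mulrC -ler_pdivlMr// ge_min lexx.
have l2 : 4 * l / c * (b - a) <= th.
  have : l <= th * c / (4 * (b - a)) by rewrite ge_min lexx orbT.
  rewrite ler_pdivlMr ?mulr_gt0// => h.
  by rewrite mulrAC ler_pdivrMr//; move: h; lra.
clearbody l; pose K1 := 2 * (b ^+ n / (l * l ^+ n) ^+ 2).
have b0 : 0 <= b by rewrite (le_trans a0)// ltW.
exists (K1 * (b - a)).
  apply: mulr_ge0; last exact: ltW.
  by rewrite mulr_ge0// divr_ge0 ?exprn_ge0// mulr_ge0 ?exprn_ge0// ltW.
move=> v v' hv v0.
set S := wint a b n (fun t => v' t ^+ 2); set W := wint a b n v.
have a0' := a0.
have pt r : a <= r <= b -> r ^+ n * v r ^+ 2 <= 4 * l / c * S + K1 * W ^+ 2.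
  move=> /[dup] rab /andP[ar rb].
  have r0 : 0 <= r by exact: le_trans ar.
  have [h|h] := leP (r + 2 * l) b.
  - apply: (@pointwise_interpolation v v' r (r + l) l c) => //; try lra.
      by move=> t /andP[t1 t2]; rewrite lerXn2r ?nnegrE//; lra.
    move=> t ht; have tr : r <= t by case/orP: ht => /andP[]; lra.
    apply: (@le_trans _ _ (r ^+ n)); first by rewrite ler_piMl// exprn_ge0.
    by rewrite lerXn2r ?nnegrE//; lra.
  (* Here [r > b - 2 * l >= 6 * l], so that [r - 2 * l >= r / 2]: this is where [c] comes from. *)
  - apply: (@pointwise_interpolation v v' r (r - 2 * l) l c) => //; try lra.
      by move=> t /andP[t1 t2]; rewrite lerXn2r ?nnegrE//; lra.
    move=> t ht; have tr : r - 2 * l <= t by case/orP: ht => /andP[]; lra.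
    rewrite /c -exprMn lerXn2r ?nnegrE//; lra.
have bv : bmeas `]a, b[ (fun t => v t ^+ 2).
  by apply: bmeasX; apply: continuous_bmeas; exact: isC1_continuous hv.
rewrite [leRHS](_ : _ = 4 * l / c * (b - a) * S + (th - 4 * l / c * (b - a)) * S + K1 * W ^+ 2 * (b - a)); last by ring.
have S0 : 0 <= S by apply: wint_ge0 => // x _; exact: sqr_ge0.
apply: (@le_trans _ _ ((4 * l / c * S + K1 * W ^+ 2) * (b - a))); last first.
  have : 0 <= (th - 4 * l / c * (b - a)) * S by rewrite mulr_ge0// subr_ge0.
  lra.
rewrite -(Rintegral_itv_cst _ (ltW ab)); apply: le_Rintegral => //.
- exact: wintegrable.
- apply: bmeas_integrable => //; first exact: itv_measure_lty.
  exact: bmeas_cst.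
by move=> r /=; rewrite in_itv/= => /andP[ar rb]; rewrite mulrC pt// !ltW.
Qed.

End weighted.
End interpolation.

Lemma scale_sqr_ge0 (R : realDomainType) (c x : R) : 0 <= c -> 0 <= c * x ^+ 2.
Proof. by move=> c0; rewrite mulr_ge0 ?sqr_ge0. Qed.

(** * Coercivity of the form on smooth radial profiles *)

Section radial_form.
Context {R : realType}.
Implicit Types (v w phi : R -> R).

(* Radial profiles that are C^1 functions of [r ^+ 2]: exactly what makes
   [x |-> v (enorm x)] of class C^1 at the origin. *)
Definition smooth v v' := exists W W', [/\ isC1 W W',
  v = (fun r => W (r ^+ 2)) & v' = (fun r => W' (r ^+ 2) * (2 * r))].

Lemma smooth_isC1 v v' : smooth v v' -> isC1 v v'.
Proof.
move=> [W [W' [hW -> ->]]]; have := isC1_comp hW (isC1X 1 isC1_id).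
by congr isC1; apply/funext => r; rewrite expr1 mulr1.
Qed.

Lemma smoothD v v' w w' s : smooth v v' -> smooth w w' ->
  smooth (fun r => v r + s * w r) (fun r => v' r + s * w' r).
Proof.
move=> [V [V' [hV -> ->]]] [W [W' [hW -> ->]]].
exists (fun t => V t + s * W t), (fun t => V' t + s * W' t); split => //.
  by apply: isC1D => //; exact: isC1Z.
by apply/funext => r; ring.
Qed.

Lemma smooth_cst c : smooth (fun=> c) (fun=> 0).
Proof.
exists (fun=> c), (fun=> 0); split => //; first exact: isC1_cst.
by apply/funext => r; rewrite mul0r.
Qed.

Variables (a b : R) (n : nat).
Hypotheses (a0 : 0 <= a) (ab : a < b).
Variables (d m nn k1 k2 b1 b2 p1 p2 : R) (C : R -> R).
Hypotheses (d0 : 0 < d) (m0 : 0 < m) (nn0 : 0 < nn) (k10 : 0 <= k1) (k20 : 0 <= k2)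
  (b10 : 0 <= b1) (b20 : 0 < b2) (bC : bmeas `]a, b[ C).
Local Notation I := (`]a, b[%classic : set R).

(* The energy minus [lambda] times the squared norm, for a radial [V] with profile
   [v] and [U] equal to [u1] on the inner and [u2] on the outer sphere, divided by
   the area of the unit sphere; [C], [p1] and [p2] include [lambda], and [b1 = 0]
   for a ball. *)
Definition qf (u1 u2 : R) v v' : R :=
  wint a b n (fun r => d * v' r ^+ 2 - C r * v r ^+ 2)
  + b1 * (k1 * (m * u1 - nn * v a) ^+ 2 - p1 * u1 ^+ 2)
  + b2 * (k2 * (m * u2 - nn * v b) ^+ 2 - p2 * u2 ^+ 2).

(** The symmetric bilinear form whose quadratic form is [qf]. *)
Definition qB (u1 u2 : R) v v' (x1 x2 : R) phi phi' : R :=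
  wint a b n (fun r => d * (v' r * phi' r) - C r * (v r * phi r))
  + b1 * (k1 * (m * u1 - nn * v a) * (m * x1 - nn * phi a) - p1 * u1 * x1)
  + b2 * (k2 * (m * u2 - nn * v b) * (m * x2 - nn * phi b) - p2 * u2 * x2).

Lemma bmeas_isC1 v v' : isC1 v v' -> bmeas I v /\ bmeas I v'.
Proof.
move=> hv; split; apply: continuous_bmeas; first exact: isC1_continuous hv.
exact: proj2 hv.
Qed.

Lemma qf_expand u1 u2 v v' x1 x2 phi phi' s : isC1 v v' -> isC1 phi phi' ->
  qf (u1 + s * x1) (u2 + s * x2) (fun r => v r + s * phi r) (fun r => v' r + s * phi' r) =
  qf u1 u2 v v' + 2 * s * qB u1 u2 v v' x1 x2 phi phi' + s ^+ 2 * qf x1 x2 phi phi'.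
Proof.
move=> /bmeas_isC1[bv bv'] /bmeas_isC1[bp bp'].
have bd : bmeas I (fun=> d) by exact: bmeas_cst.
rewrite /qf /qB.
have -> : wint a b n (fun r => d * (v' r + s * phi' r) ^+ 2 - C r * (v r + s * phi r) ^+ 2) =
  wint a b n (fun r => d * v' r ^+ 2 - C r * v r ^+ 2) +
  2 * s * wint a b n (fun r => d * (v' r * phi' r) - C r * (v r * phi r)) +
  s ^+ 2 * wint a b n (fun r => d * phi' r ^+ 2 - C r * phi r ^+ 2).
  have B f g : bmeas I f -> bmeas I g -> bmeas I (fun r => d * f r - C r * g r).
    by move=> hf hg; apply: bmeasB; exact: bmeasM.
  have BB1 : bmeas I (fun r => d * v' r ^+ 2 - C r * v r ^+ 2) by apply: B; exact: bmeasX.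
  have BB2 : bmeas I (fun r => d * (v' r * phi' r) - C r * (v r * phi r)) by apply: B; exact: bmeasM.
  have BB3 : bmeas I (fun r => d * phi' r ^+ 2 - C r * phi r ^+ 2) by apply: B; exact: bmeasX.
  have bc (c : R) : bmeas I (fun=> c) by exact: bmeas_cst.
  have S2 := bmeasM (bc (2 * s)) BB2; have S3 := bmeasM (bc (s ^+ 2)) BB3.
  have S12 := bmeasD BB1 S2.
  rewrite -!(wintZ n ab)// -!(wintD n ab)//.
  by apply: eq_wint => r _; ring.
ring.
Qed.

Hypothesis q0 : forall u1 u2 v v', smooth v v' -> 0 <= qf u1 u2 v v'.
Variable eta : R.
Hypothesis eta0 : 0 < eta.

(** With [eta = (D2 - D1) * alpha ^+ 2] and [qf] the form for [D2] at the level [Lambda D2 alpha],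
    this is the form for [D1] at the same level. *)
Definition qX u1 u2 v v' := qf u1 u2 v v' + eta * (b1 * u1 ^+ 2 + b2 * u2 ^+ 2).

Section test.
Variables (u1 u2 : R) (v v' : R -> R).
Hypothesis hv : smooth v v'.
Local Notation X := (qX u1 u2 v v').

Lemma qf_le_X : qf u1 u2 v v' <= X.
Proof.
rewrite lerDl; apply: mulr_ge0; first exact: ltW.
by apply: addr_ge0; apply: mulr_ge0; rewrite ?sqr_ge0// ltW.
Qed.

Lemma X_ge0 : 0 <= X. Proof. exact: le_trans (q0 u1 u2 hv) qf_le_X. Qed.

Lemma u1_le_X : b1 * u1 ^+ 2 <= eta^-1 * X.
Proof.
rewrite [leRHS]mulrC ler_pdivlMr// mulrC /qX; have := q0 u1 u2 hv.
have : 0 <= eta * (b2 * u2 ^+ 2) by rewrite mulrA scale_sqr_ge0// ltW// mulr_gt0.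
lra.
Qed.

Lemma u2_le_X : b2 * u2 ^+ 2 <= eta^-1 * X.
Proof.
rewrite [leRHS]mulrC ler_pdivlMr// mulrC /qX; have := q0 u1 u2 hv.
have : 0 <= eta * (b1 * u1 ^+ 2) by rewrite mulrA scale_sqr_ge0// mulr_ge0// ltW.
lra.
Qed.

(** Cauchy-Schwarz for the nonnegative form [qf]. It stands in for the Euler-Lagrange equation: when
    [X] is small, the profile nearly satisfies the weak equation against any fixed smooth test. *)
Lemma qB_le_X x1 x2 phi phi' : smooth phi phi' ->
  qB u1 u2 v v' x1 x2 phi phi' ^+ 2 <= qf x1 x2 phi phi' * X.
Proof.
move=> hp; apply: (@le_trans _ _ (qf u1 u2 v v' * qf x1 x2 phi phi')).
  apply: discriminant_le => s; rewrite -qf_expand; [|exact: smooth_isC1|exact: smooth_isC1].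
  by apply: q0; exact: smoothD.
by rewrite mulrC ler_wpM2l ?q0// qf_le_X.
Qed.

Lemma wint0 : wint a b n (fun=> 0) = 0.
Proof.
have bc : bmeas I (fun=> 0 : R) by exact: bmeas_cst.
rewrite -[RHS](mul0r (wint a b n (fun=> 0))) -(wintZ n ab)//.
by apply: eq_wint => r _; rewrite mulr0.
Qed.

End test.

(** Testing with [U = 1] on the outer sphere and [V = 0] isolates the boundary equation
    [P * u2 - g * v b]. As [u2] is controlled by [X] through [eta], so is [v b]; a positive [k2]
    makes [g] invertible. *)
Lemma outer_trace_bound : 0 < k2 -> exists c, forall u1 u2 v v', smooth v v' ->
  v b ^+ 2 <= c * qX u1 u2 v v'.
Proof.
move=> k2p; pose P := b2 * (k2 * m ^+ 2 - p2); pose g := b2 * k2 * m * nn.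
have g0 : 0 < g by rewrite !mulr_gt0.
exists ((2 * (P ^+ 2 / b2 / eta) + 2 * P) / g ^+ 2) => u1 u2 v v' hv.
set X := qX _ _ _ _.
have := qB_le_X u1 u2 hv 0 1 (smooth_cst 0); rewrite -/X.
have -> : qf 0 1 (fun=> 0) (fun=> 0) = P.
  rewrite /qf; under eq_wint do rewrite expr0n /= !mulr0 subrr.
  by rewrite wint0 /P; ring.
have -> : qB u1 u2 v v' 0 1 (fun=> 0) (fun=> 0) = P * u2 - g * v b.
  rewrite /qB; under eq_wint do rewrite !mulr0 subrr.
  by rewrite wint0 /P /g; ring.
move=> hB; rewrite mulrAC ler_pdivlMr ?exprn_gt0//.
have hu : P ^+ 2 * u2 ^+ 2 <= P ^+ 2 / b2 / eta * X.
  have := u2_le_X u1 u2 hv; rewrite -/X => h.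
  have -> : P ^+ 2 * u2 ^+ 2 = P ^+ 2 / b2 * (b2 * u2 ^+ 2) by field; rewrite gt_eqF.
  rewrite -[leRHS]mulrA; apply: ler_wpM2l => //; apply: divr_ge0; first exact: sqr_ge0.
  exact: ltW.
have : (g * v b) ^+ 2 <= 2 * (P ^+ 2 * u2 ^+ 2) + 2 * (P * u2 - g * v b) ^+ 2.
  have := sqr_ge0 (2 * P * u2 - g * v b); nra.
rewrite exprMn; move: hB hu; rewrite mulrDl; lra.
Qed.

Lemma inner_trace_bound : 0 < k1 -> 0 < b1 -> exists c, forall u1 u2 v v', smooth v v' ->
  v a ^+ 2 <= c * qX u1 u2 v v'.
Proof.
move=> k1p b1p; pose P := b1 * (k1 * m ^+ 2 - p1); pose g := b1 * k1 * m * nn.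
have g0 : 0 < g by rewrite !mulr_gt0.
exists ((2 * (P ^+ 2 / b1 / eta) + 2 * P) / g ^+ 2) => u1 u2 v v' hv.
set X := qX _ _ _ _.
have := qB_le_X u1 u2 hv 1 0 (smooth_cst 0); rewrite -/X.
have -> : qf 1 0 (fun=> 0) (fun=> 0) = P.
  rewrite /qf; under eq_wint do rewrite expr0n /= !mulr0 subrr.
  by rewrite wint0 /P; ring.
have -> : qB u1 u2 v v' 1 0 (fun=> 0) (fun=> 0) = P * u1 - g * v a.
  rewrite /qB; under eq_wint do rewrite !mulr0 subrr.
  by rewrite wint0 /P /g; ring.
move=> hB; rewrite mulrAC ler_pdivlMr ?exprn_gt0//.
have hu : P ^+ 2 * u1 ^+ 2 <= P ^+ 2 / b1 / eta * X.
  have := u1_le_X u1 u2 hv; rewrite -/X => h.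
  have -> : P ^+ 2 * u1 ^+ 2 = P ^+ 2 / b1 * (b1 * u1 ^+ 2) by field; rewrite gt_eqF.
  rewrite -[leRHS]mulrA; apply: ler_wpM2l => //; apply: divr_ge0; first exact: sqr_ge0.
  exact: ltW.
have : (g * v a) ^+ 2 <= 2 * (P ^+ 2 * u1 ^+ 2) + 2 * (P * u1 - g * v a) ^+ 2.
  have := sqr_ge0 (2 * P * u1 - g * v a); nra.
rewrite exprMn; move: hB hu; rewrite mulrDl; lra.
Qed.

Definition gauss (sg : R) (r : R) : R := expR (sg * r ^+ 2).
Definition gauss' (sg : R) (r : R) : R := expR (sg * r ^+ 2) * sg * (2 * r).

Lemma smooth_gauss sg : smooth (gauss sg) (gauss' sg).
Proof.
exists (fun t => expR (sg * t)), (fun t => expR (sg * t) * sg); split => //.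
have := isC1_comp isC1_expR (isC1Z sg isC1_id).
by congr isC1; apply/funext => t; rewrite mulr1.
Qed.

(** The factor [2 * sg * n.+1 + 4 * sg ^+ 2 * r ^+ 2] is the Laplacian of [exp (sg * |x| ^+ 2)] in
    dimension [n.+1], divided by this function; [2 * sg * r ^+ n.+1 * gauss sg r] is its weighted
    flux. *)
Lemma gauss_by_parts sg v v' : isC1 v v' ->
  wint a b n (fun r => v' r * gauss' sg r) +
  wint a b n (fun r => v r * gauss sg r * (2 * sg * n.+1%:R + 4 * sg ^+ 2 * r ^+ 2)) =
  2 * sg * b ^+ n.+1 * gauss sg b * v b - 2 * sg * a ^+ n.+1 * gauss sg a * v a.
Proof.
move=> hv; have hg := smooth_isC1 (smooth_gauss sg).
have h := isC1M hv (isC1M (isC1Z (2 * sg) (isC1X n isC1_id)) hg).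
have [bv bv'] := bmeas_isC1 hv; have [bg bg'] := bmeas_isC1 hg.
have bid : bmeas I (fun r => r) by apply: continuous_bmeas => x; exact: cvg_id.
have bc (c : R) : bmeas I (fun=> c) by exact: bmeas_cst.
transitivity (v b * (2 * sg * b ^+ n.+1 * gauss sg b) - v a * (2 * sg * a ^+ n.+1 * gauss sg a)); last by ring.
rewrite -(FTC_isC1 ab h) -(wintD n ab); last 2 first.
- exact: bmeasM.
- apply: bmeasM; first exact: bmeasM.
  by apply: bmeasD => //; apply: bmeasM => //; exact: bmeasX.
by apply: eq_Rintegral => r _; rewrite /gauss' /gauss ![r ^+ n.+1]exprS; ring.
Qed.

(* Testing the form against [gauss sg]; for suitable [sg] the right-hand side is
   controlled by a single endpoint, which makes [wint v] small. *)
Lemma gauss_test u1 u2 v v' sg : isC1 v v' ->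
  wint a b n (fun r => v r * gauss sg r *
     (d * (2 * sg * n.+1%:R + 4 * sg ^+ 2 * r ^+ 2) + C r)) =
  - qB u1 u2 v v' 0 0 (gauss sg) (gauss' sg)
  + (2 * d * sg * b ^+ n.+1 + b2 * k2 * nn ^+ 2) * (gauss sg b * v b)
  + (- (2 * d * sg * a ^+ n.+1) + b1 * k1 * nn ^+ 2) * (gauss sg a * v a)
  - b1 * k1 * m * nn * gauss sg a * u1 - b2 * k2 * m * nn * gauss sg b * u2.
Proof.
move=> hv; have E := gauss_by_parts sg hv; have hg := smooth_isC1 (smooth_gauss sg).
have [bv bv'] := bmeas_isC1 hv; have [bg bg'] := bmeas_isC1 hg.
have bid : bmeas I (fun r => r) by apply: continuous_bmeas => x; exact: cvg_id.
have bc (c : R) : bmeas I (fun=> c) by exact: bmeas_cst.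
have B1 := bmeasM bv' bg'; have B2 := bmeasM bv bg.
have B3 : bmeas I (fun r => v r * gauss sg r * (2 * sg * n.+1%:R + 4 * sg ^+ 2 * r ^+ 2)).
  by apply: bmeasM => //; apply: bmeasD => //; apply: bmeasM => //; exact: bmeasX.
have B4 : bmeas I (fun r => C r * (v r * gauss sg r)) by exact: bmeasM.
have B5 := bmeasM (bc d) B1; have B6 := bmeasM (bc d) B3.
rewrite /qB (wintB n ab)// (wintZ n ab)//.
transitivity (d * wint a b n (fun r => v r * gauss sg r * (2 * sg * n.+1%:R + 4 * sg ^+ 2 * r ^+ 2))
    + wint a b n (fun r => C r * (v r * gauss sg r))).
  by rewrite -(wintZ n ab)// -(wintD n ab)//; apply: eq_wint => r _; ring.
have -> : wint a b n (fun r => v r * gauss sg r * (2 * sg * n.+1%:R + 4 * sg ^+ 2 * r ^+ 2)) =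
  2 * sg * b ^+ n.+1 * gauss sg b * v b - 2 * sg * a ^+ n.+1 * gauss sg a * v a
   - wint a b n (fun r => v' r * gauss' sg r) by rewrite -E addrC addKr.
ring.
Qed.

Lemma sum5_sqr_le (y z1 z2 z3 z4 z5 : R) : 0 <= y -> y <= z1 + z2 + z3 + z4 + z5 ->
  y ^+ 2 <= 5 * (z1 ^+ 2 + z2 ^+ 2 + z3 ^+ 2 + z4 ^+ 2 + z5 ^+ 2).
Proof.
move=> y0 yz; apply: (@le_trans _ _ ((z1 + z2 + z3 + z4 + z5) ^+ 2)).
  by rewrite lerXn2r ?nnegrE// (le_trans y0).
rewrite -subr_ge0.
have -> : 5 * (z1 ^+ 2 + z2 ^+ 2 + z3 ^+ 2 + z4 ^+ 2 + z5 ^+ 2) - (z1 + z2 + z3 + z4 + z5) ^+ 2 =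
  (z1 - z2) ^+ 2 + (z1 - z3) ^+ 2 + (z1 - z4) ^+ 2 + (z1 - z5) ^+ 2 + (z2 - z3) ^+ 2
  + (z2 - z4) ^+ 2 + (z2 - z5) ^+ 2 + (z3 - z4) ^+ 2 + (z3 - z5) ^+ 2 + (z4 - z5) ^+ 2 by ring.
by rewrite !addr_ge0// sqr_ge0.
Qed.

(** The first hypothesis says that [gauss sg] is a strict subsolution, so that the left side of
    [gauss_test] dominates a multiple of the integral of [v]. At each end, either the coefficient
    has a sign that lets the term be dropped, or the trace is already controlled. *)
Lemma mean_bound sg : 
  (forall r, a < r < b -> 1 <= d * (2 * sg * n.+1%:R + 4 * sg ^+ 2 * r ^+ 2) + C r) ->
  (2 * d * sg * b ^+ n.+1 + b2 * k2 * nn ^+ 2 <= 0 \/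
    exists c, forall u1 u2 v v', smooth v v' -> v b ^+ 2 <= c * qX u1 u2 v v') ->
  (- (2 * d * sg * a ^+ n.+1) + b1 * k1 * nn ^+ 2 <= 0 \/
    exists c, forall u1 u2 v v', smooth v v' -> v a ^+ 2 <= c * qX u1 u2 v v') ->
  exists2 c, 0 <= c & forall u1 u2 v v', smooth v v' -> (forall r, a <= r <= b -> 0 <= v r) ->
    wint a b n v ^+ 2 <= c * qX u1 u2 v v'.
Proof.
move=> hC Hb Ha.
have gp r : 0 < gauss sg r by exact: expR_gt0.
have [al [al0 hal]] : exists al, 0 < al /\ forall r, a < r < b -> al <= gauss sg r.
  exists (expR (- (`|sg| * b ^+ 2))); split; first exact: expR_gt0.
  move=> r /andP[ar rb]; rewrite ler_expR lerNl.
  have r2 : r ^+ 2 <= b ^+ 2 by rewrite lerXn2r ?nnegrE ?(le_trans a0) ?ltW// (lt_trans ar).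
  apply: (@le_trans _ _ (`|sg| * r ^+ 2)); last by rewrite ler_wpM2l.
  by rewrite -mulNr ler_wpM2r ?sqr_ge0// -normrN ler_norm.
(* A term with nonpositive coefficient is bounded by [z = 0] because [v >= 0]; otherwise the term
   itself serves as [z]. *)
have endpoint A (f : (R -> R) -> R) (e : R) : (forall v, f v = v e) -> a <= e <= b ->
  (A <= 0 \/ exists c, forall u1 u2 v v', smooth v v' -> f v ^+ 2 <= c * qX u1 u2 v v') ->
  exists2 c, 0 <= c & forall u1 u2 v v', smooth v v' -> (forall r, a <= r <= b -> 0 <= v r) ->
    exists2 z, A * (gauss sg e * v e) <= z & z ^+ 2 <= c * qX u1 u2 v v'.
  move=> fE eab [A0|[c hc]].
    exists 0 => // u1 u2 v v' hv v0; exists 0; last by rewrite expr0n mul0r.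
    by rewrite mulr_le0_ge0// mulr_ge0 ?v0// ltW.
  exists ((A * gauss sg e) ^+ 2 * `|c|); first by rewrite mulr_ge0 ?sqr_ge0.
  move=> u1 u2 v v' hv v0; exists (A * gauss sg e * v e); first by rewrite mulrA.
  rewrite exprMn -[leRHS]mulrA ler_wpM2l ?sqr_ge0// -fE.
  apply: le_trans (hc u1 u2 v v' hv) _; rewrite ler_wpM2r ?ler_norm//.
  exact: X_ge0.
have [cb cb0 hb] := endpoint _ (fun v => v b) b (fun=> erefl) ltac:(by rewrite lexx ltW) Hb.
have [ca ca0 ha] := endpoint _ (fun v => v a) a (fun=> erefl) ltac:(by rewrite lexx ltW) Ha.
pose Q := qf 0 0 (gauss sg) (gauss' sg).
have Q0 : 0 <= Q by apply: q0; exact: smooth_gauss.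
pose e1 := b1 * (k1 * m * nn * gauss sg a) ^+ 2 / eta.
pose e2 := b2 * (k2 * m * nn * gauss sg b) ^+ 2 / eta.
have e10 : 0 <= e1 by apply: divr_ge0; [exact: scale_sqr_ge0|exact: ltW].
have e20 : 0 <= e2 by apply: divr_ge0; [apply: scale_sqr_ge0; exact: ltW|exact: ltW].
exists (5 * (Q + cb + ca + e1 + e2) / al ^+ 2).
  apply: divr_ge0; last exact: sqr_ge0.
  by apply: mulr_ge0 => //; do 4 (apply: addr_ge0 => //).
move=> u1 u2 v v' hv v0; set X := qX _ _ _ _.
have hv1 := smooth_isC1 hv; have hg := smooth_isC1 (smooth_gauss sg).
have [bv bv'] := bmeas_isC1 hv1; have [bg bg'] := bmeas_isC1 hg.
have bid : bmeas I (fun r => r) by apply: continuous_bmeas => x; exact: cvg_id.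
have bc (c : R) : bmeas I (fun=> c) by exact: bmeas_cst.
have W0 : 0 <= wint a b n v.
  by apply: wint_ge0 => // r /andP[ar rb]; apply: v0; rewrite !ltW.
have [zb zb1 zb2] := hb u1 u2 v v' hv v0; have [za za1 za2] := ha u1 u2 v v' hv v0.
have hB := qB_le_X u1 u2 hv 0 0 (smooth_gauss sg); rewrite -/Q -/X in hB.
have key : al * wint a b n v <= - qB u1 u2 v v' 0 0 (gauss sg) (gauss' sg) + zb + za
   + (- (b1 * k1 * m * nn * gauss sg a * u1)) + (- (b2 * k2 * m * nn * gauss sg b * u2)).
  apply: (@le_trans _ _ (wint a b n (fun r => v r * gauss sg r *
     (d * (2 * sg * n.+1%:R + 4 * sg ^+ 2 * r ^+ 2) + C r)))); last first.
    by rewrite (gauss_test u1 u2 sg hv1); move: zb1 za1; lra.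
  rewrite -(wintZ n ab)//; apply: le_wint => //.
  - exact: bmeasM.
  - apply: bmeasM; first exact: bmeasM.
    apply: bmeasD => //; apply: bmeasM => //; apply: bmeasD => //; apply: bmeasM => //.
    exact: bmeasX.
  move=> r rab; have vr : 0 <= v r by apply: v0; case/andP: rab => h1 h2; rewrite !ltW.
  apply: (@le_trans _ _ (v r * gauss sg r)).
    by rewrite mulrC ler_wpM2l// hal.
  by rewrite ler_peMr ?hC// mulr_ge0// ltW.
have := sum5_sqr_le (mulr_ge0 (ltW al0) W0) key.
rewrite exprMn mulrC => h.
rewrite mulrAC ler_pdivlMr ?exprn_gt0//; apply: le_trans h _.
rewrite -[leRHS]mulrA; apply: ler_wpM2l => //; rewrite !sqrrN.
rewrite (_ : (Q + cb + ca + e1 + e2) * X = Q * X + cb * X + ca * X + e1 * X + e2 * X); last by ring.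
have h1 : (b1 * k1 * m * nn * gauss sg a * u1) ^+ 2 <= e1 * X.
  have -> : (b1 * k1 * m * nn * gauss sg a * u1) ^+ 2 =
    b1 * (k1 * m * nn * gauss sg a) ^+ 2 * (b1 * u1 ^+ 2) by ring.
  rewrite -[leRHS]mulrA; apply: ler_wpM2l; first exact: scale_sqr_ge0.
  exact: u1_le_X.
have h2 : (b2 * k2 * m * nn * gauss sg b * u2) ^+ 2 <= e2 * X.
  have -> : (b2 * k2 * m * nn * gauss sg b * u2) ^+ 2 =
    b2 * (k2 * m * nn * gauss sg b) ^+ 2 * (b2 * u2 ^+ 2) by ring.
  rewrite -[leRHS]mulrA; apply: ler_wpM2l; first by apply: scale_sqr_ge0; exact: ltW.
  exact: u2_le_X.
by do 4 (apply: lerD => //).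
Qed.

(** Three bounds by [X] are combined: the boundary values through [eta], the integral of [v] through
    [mean_bound], and the gradient through the form itself up to a multiple of the squared norm of
    [v]. The last is absorbed by [interpolation]. The alternatives in the hypotheses separate
    annulus from ball and the sphere on which [kappa] is positive. *)
Lemma smooth_profile_gap : (0 < a \/ b1 = 0) -> (0 < k2 \/ 0 < k1 /\ 0 < b1) ->
  exists2 dl, 0 < dl & forall u1 u2 v v', smooth v v' -> (forall r, a <= r <= b -> 0 <= v r) ->
    dl * (b1 * u1 ^+ 2 + b2 * u2 ^+ 2 + wint a b n (fun r => v r ^+ 2)) <= qX u1 u2 v v'.
Proof.
move=> hab hk; have [_ [Cm hCm]] := bC.
have b0 : 0 < b by exact: le_lt_trans a0 ab.
have Cm0 : 0 <= Cm.
  apply: le_trans (normr_ge0 (C ((a + b) / 2))) _; apply: hCm.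
  by rewrite /= in_itv/= !midf_lt.
have [c c0 hc] : exists2 c, 0 <= c & forall u1 u2 v v', smooth v v' ->
    (forall r, a <= r <= b -> 0 <= v r) -> wint a b n v ^+ 2 <= c * qX u1 u2 v v'.
  case: hk => [k2p|[k1p b1p]].
  (* The trace is known at the outer end, so the exponent is positive: the first summand outweighs
     [C], the second makes the inner flux beat the coupling term there. *)
  - pose L := (1 + Cm) / d + (if b1 == 0 then 0 else b1 * k1 * nn ^+ 2 / (d * a ^+ n.+1)).
    have L1 : (1 + Cm) / d <= L.
      rewrite lerDl; case: ifPn => // b1n; apply: divr_ge0.
        by rewrite scale_sqr_ge0// mulr_ge0.
      by rewrite mulr_ge0 ?exprn_ge0// ltW.
    have L0 : 0 <= L by apply: le_trans L1; rewrite divr_ge0 ?addr_ge0// ltW.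
    apply: (@mean_bound L).
    + move=> r rab; have := hCm r; rewrite /= in_itv/= => /(_ rab); rewrite ler_norml => /andP[hC _].
      have h : 1 + Cm <= d * L by rewrite mulrC -ler_pdivrMr.
      have h1 : 0 <= d * (4 * L ^+ 2 * r ^+ 2).
        by rewrite mulr_ge0 ?(ltW d0)// scale_sqr_ge0// scale_sqr_ge0.
      have h2 : d * L <= d * (2 * L * n.+1%:R).
        rewrite ler_wpM2l ?(ltW d0)// mulrAC -[leLHS]mul1r ler_wpM2r//.
        by rewrite mulr_ege1// ?ler1n.
      rewrite mulrDr; move: hC h h1 h2; lra.
    + by right; exact: outer_trace_bound.
    + left; case: hab => [ap|->]; last first.
        rewrite !mul0r addr0 oppr_le0 mulr_ge0 ?exprn_ge0// mulr_ge0// mulr_ge0// ltW//.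
      have an : 0 < d * a ^+ n.+1 by rewrite mulr_gt0// exprn_gt0.
      have h : b1 * k1 * nn ^+ 2 <= d * a ^+ n.+1 * L.
        have [->|b1n] := eqVneq b1 0; first by rewrite !mul0r mulr_ge0// ltW.
        rewrite [leRHS]mulrC -ler_pdivrMr// /L (negbTE b1n).
        by rewrite lerDr divr_ge0 ?addr_ge0// ltW.
      have h0 : 0 <= d * a ^+ n.+1 * L by rewrite mulr_ge0// ltW.
      rewrite (_ : 2 * d * L * a ^+ n.+1 = 2 * (d * a ^+ n.+1 * L)); last by ring.
      move: h h0; lra.
  - have ap : 0 < a by case: hab => // b1z; rewrite b1z ltxx in b1p.
    (* The trace is known at the inner end, so the exponent is [- L]. The term [- 2 * L * n.+1] of
       the Laplacian is now adverse and must be beaten by [4 * L ^+ 2 * r ^+ 2], which works because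
       [r >= a > 0]; the last summand settles the outer flux. *)
    pose L := ((1 + Cm) / d + 2 * n.+1%:R) / (4 * a ^+ 2) + 1 + b2 * k2 * nn ^+ 2 / (d * b ^+ n.+1).
    have e1 : 0 <= ((1 + Cm) / d + 2 * n.+1%:R) / (4 * a ^+ 2).
      apply: divr_ge0; last exact: scale_sqr_ge0.
      by apply: addr_ge0; [apply: divr_ge0; [exact: addr_ge0|exact: ltW]|exact: mulr_ge0].
    have bn : 0 < d * b ^+ n.+1 by rewrite mulr_gt0// exprn_gt0.
    have e2 : 0 <= b2 * k2 * nn ^+ 2 / (d * b ^+ n.+1).
      by rewrite divr_ge0 ?(ltW bn)// scale_sqr_ge0// mulr_ge0// ltW.
    have L1 : 1 <= L by rewrite /L; move: e1 e2; lra.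
    have L2 : (1 + Cm) / d + 2 * n.+1%:R <= L * (4 * a ^+ 2).
      rewrite -ler_pdivrMr ?mulr_gt0 ?exprn_gt0// /L; move: e2; lra.
    have L3 : b2 * k2 * nn ^+ 2 <= L * (d * b ^+ n.+1).
      rewrite -ler_pdivrMr// /L; move: e1; lra.
    clearbody L; apply: (@mean_bound (- L)).
    + move=> r rab; have := hCm r; rewrite /= in_itv/= => /(_ rab); rewrite ler_norml => /andP[hC _].
      have ar2 : a ^+ 2 <= r ^+ 2.
        case/andP: rab => ar _; rewrite lerXn2r ?nnegrE// ?ltW//.
        by rewrite (lt_trans ap).
      have h1 : (1 + Cm) <= d * (L * (4 * a ^+ 2) - 2 * n.+1%:R).
        by rewrite mulrC -ler_pdivrMr// lerBrDr.
      have h2 : L * (4 * a ^+ 2) - 2 * n.+1%:R <= L * (L * (4 * a ^+ 2) - 2 * n.+1%:R).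
        rewrite ler_peMl// subr_ge0; apply: le_trans L2; rewrite lerDr.
        by rewrite divr_ge0 ?addr_ge0// ltW.
      have h3 : L * (L * (4 * a ^+ 2)) <= L * (L * (4 * r ^+ 2)).
        have L0 : 0 <= L by exact: le_trans L1.
        by do 3 (apply: ler_wpM2l => //).
      have h4 : d * (L * (4 * a ^+ 2) - 2 * n.+1%:R) <= d * (2 * - L * n.+1%:R + 4 * (- L) ^+ 2 * r ^+ 2).
        rewrite ler_wpM2l ?(ltW d0)//; apply: le_trans h2 _.
        rewrite sqrrN (_ : 4 * L ^+ 2 * r ^+ 2 = L * (L * (4 * r ^+ 2))); last by ring.
        move: h3; rewrite mulrBr; lra.
      move: h1 h4 hC; lra.
    + left; rewrite (_ : 2 * d * - L * b ^+ n.+1 = - 2 * (L * (d * b ^+ n.+1))); last by ring.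
      have : 0 <= L * (d * b ^+ n.+1) by rewrite mulr_ge0 ?(ltW bn)// (le_trans ler01).
      move: L3; lra.
    + by right; exact: inner_trace_bound.
(* With this weight the bound [d * S <= c3 * X + Cm * V] gives [th * S <= c3 * X + V / 2], and half
   of [V] is absorbed. *)
pose th := d / (2 * (Cm + 1)).
have Cm1 : 0 < Cm + 1 by rewrite ltr_wpDl.
have th0 : 0 < th by rewrite divr_gt0// mulr_gt0.
have [K K0 hK] := interpolation n a0 ab th0.
pose c3 := 1 + (`|p1| + `|p2|) / eta.
have c30 : 0 <= c3 by rewrite addr_ge0// divr_ge0 ?addr_ge0// ltW.
(* The boundary part is at most [2 / eta * X]; after absorption [V] is at most
   [2 * (c3 + K * c) * X]. *)
pose T := 2 / eta + 2 * c3 + 2 * K * c.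
have T0 : 0 < T.
  have : 0 < eta^-1 by rewrite invr_gt0.
  have : 0 <= K * c by rewrite mulr_ge0.
  rewrite /T; move: c30; lra.
exists T^-1; first by rewrite invr_gt0.
move=> u1 u2 v v' hv v0; set X := qX _ _ _ _.
have hv1 := smooth_isC1 hv; have [bv bv'] := bmeas_isC1 hv1.
have bc (e : R) : bmeas I (fun=> e) by exact: bmeas_cst.
set V := wint a b n (fun r => v r ^+ 2).
pose S := wint a b n (fun r => v' r ^+ 2).
have X0 : 0 <= X := X_ge0 u1 u2 hv.
have V0 : 0 <= V by apply: wint_ge0 => // r _; exact: sqr_ge0.
have hU1 := u1_le_X u1 u2 hv; have hU2 := u2_le_X u1 u2 hv; rewrite -/X in hU1 hU2.
have bvX : bmeas I (fun r => v r ^+ 2) by exact: bmeasX.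
have bvX' : bmeas I (fun r => v' r ^+ 2) by exact: bmeasX.
have hS : d * S <= c3 * X + Cm * V.
  have E1 : wint a b n (fun r => d * v' r ^+ 2 - C r * v r ^+ 2) =
      d * S - wint a b n (fun r => C r * v r ^+ 2).
    rewrite (wintB n ab) ?(wintZ n ab)//; first exact: bmeasM.
    exact: bmeasM.
  have E2 : wint a b n (fun r => C r * v r ^+ 2) <= Cm * V.
    rewrite -(wintZ n ab)//; apply: le_wint => //; [exact: bmeasM|exact: bmeasM|].
    move=> r rab; rewrite ler_wpM2r ?sqr_ge0//; apply: le_trans (ler_norm _) _.
    by apply: hCm; rewrite /= in_itv.
  have E3 := qf_le_X u1 u2 v v'; rewrite -/X /qf E1 in E3.
  have E4 : 0 <= b1 * (k1 * (m * u1 - nn * v a) ^+ 2) by rewrite mulr_ge0// scale_sqr_ge0.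
  have E5 : 0 <= b2 * (k2 * (m * u2 - nn * v b) ^+ 2) by rewrite mulr_ge0 ?(ltW b20)// scale_sqr_ge0.
  have E6 : b1 * (p1 * u1 ^+ 2) <= `|p1| * (eta^-1 * X).
    apply: (@le_trans _ _ (`|p1| * (b1 * u1 ^+ 2))); last by rewrite ler_wpM2l.
    by rewrite mulrCA ler_wpM2r ?scale_sqr_ge0// ler_norm.
  have E7 : b2 * (p2 * u2 ^+ 2) <= `|p2| * (eta^-1 * X).
    apply: (@le_trans _ _ (`|p2| * (b2 * u2 ^+ 2))); last by rewrite ler_wpM2l.
    by rewrite mulrCA ler_wpM2r ?ler_norm// scale_sqr_ge0// ltW.
  rewrite (_ : c3 * X = X + `|p1| * (eta^-1 * X) + `|p2| * (eta^-1 * X)); last by rewrite /c3; ring.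
  rewrite !mulrBr in E3; move: E2 E3 E4 E5 E6 E7; lra.
have hV := hK v v' hv1 v0; rewrite -/V -/S in hV.
have hW := hc u1 u2 v v' hv v0; rewrite -/X in hW.
have hthS : th * S <= c3 * X + V / 2.
  have -> : th * S = d * S / (2 * (Cm + 1)) by rewrite /th mulrAC.
  rewrite ler_pdivrMr ?mulr_gt0//; apply: le_trans hS _.
  have : 0 <= c3 * X by rewrite mulr_ge0.
  have : 0 <= Cm * (c3 * X) by rewrite !mulr_ge0.
  have : 0 <= Cm * V by rewrite mulr_ge0.
  rewrite (_ : (c3 * X + V / 2) * (2 * (Cm + 1)) =
    2 * (c3 * X) + 2 * (Cm * (c3 * X)) + Cm * V + V); last by field.
  move: V0; lra.
have hKW : K * wint a b n v ^+ 2 <= K * (c * X) by rewrite ler_wpM2l.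
rewrite mulrC ler_pdivrMr//.
rewrite (_ : X * T = eta^-1 * X + eta^-1 * X + 2 * (c3 * X) + 2 * (K * (c * X))); last first.
  by rewrite /T; ring.
move: hV hthS hKW hU1 hU2; lra.
Qed.
End radial_form.

(** * From smooth nonnegative profiles to arbitrary C^1 profiles *)

Section smoothing.
Context {R : realType}.
Local Notation mu := (@lebesgue_measure R).
Implicit Types (v : R -> R).

Lemma wint_cvg (a b : R) (n : nat) (h : nat -> R -> R) (f : R -> R) (M : R) :
  a < b -> (forall k, bmeas `]a, b[ (h k)) -> bmeas `]a, b[ f ->
  (forall k r, a < r < b -> `|h k r| <= M) ->
  (forall r, a < r < b -> h k r @[k --> \oo] --> f r) ->
  wint a b n (h k) @[k --> \oo] --> wint a b n f.
Proof.
move=> ab bh bf hM hf.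
have [_ [Mn hMn]] := @bmeas_pow R a b n.
have ih k := wintegrable n ab (bh k).
have if_ := wintegrable n ab bf.
apply: fine_cvg; rewrite fineK; last exact: integrable_fin_num.
have H1 k : measurable_fun `]a, b[ (fun r => (h k r * r ^+ n)%:E) := measurable_int _ (ih k).
have H2 : measurable_fun `]a, b[ (fun r => (f r * r ^+ n)%:E) := measurable_int _ if_.
have H3 : {ae mu, forall r, `]a, b[%classic r -> (h k r * r ^+ n)%:E @[k --> \oo] --> (f r * r ^+ n)%:E}.
  apply: aeW => r /=; rewrite in_itv/= => rab.
  apply: cvg_EFin; first exact: nearW.
  by apply: cvgM; [exact: hf|exact: cvg_cst].
have H4 : mu.-integrable `]a, b[ (EFin \o (fun _ : R => M * Mn)).
  by apply: bmeas_integrable => //; [exact: itv_measure_lty|exact: bmeas_cst].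
have H5 : {ae mu, forall r k, `]a, b[%classic r -> (`|(h k r * r ^+ n)%:E| <= (M * Mn)%:E)%E}.
  apply: aeW => r k /= rab; rewrite lee_fin normrM ler_pM//; last exact: hMn.
  by apply: hM; move: rab; rewrite in_itv.
by have [_ _] := @dominated_convergence _ _ R mu _ (measurable_oo a b) _ _ _ H1 H2 H3 H4 H5.
Qed.

(* Replacing [r] by [sroot e (r ^+ 2)] turns a [C^1] profile into a smooth one
   (in the sense of [smooth]) that converges to it as [e] tends to [0]. *)
Definition sroot (e t : R) : R := Num.sqrt (Num.sqrt (t ^+ 2 + e)).

Lemma sroot_ge (e r : R) : 0 <= e -> 0 <= r -> r <= sroot e (r ^+ 2).
Proof.
move=> e0 r0; rewrite /sroot -{1}(ger0_norm r0) -sqrtr_sqr ler_wsqrtr//.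
by rewrite -[leLHS]ger0_norm ?sqr_ge0// -sqrtr_sqr ler_wsqrtr// lerDl.
Qed.

Lemma sroot_le (e r c : R) : 0 <= e <= 1 -> 0 <= r <= c -> sroot e (r ^+ 2) <= c + 1.
Proof.
move=> /andP[e0 e1] /andP[r0 rc]; have c0 : 0 <= c by exact: le_trans rc.
have c1 : 0 <= c + 1 by rewrite addr_ge0.
rewrite /sroot -(ger0_norm c1) -sqrtr_sqr ler_wsqrtr//.
rewrite -[leRHS]ger0_norm ?sqr_ge0// -sqrtr_sqr ler_wsqrtr//.
have h : r ^+ 2 <= c ^+ 2 by rewrite lerXn2r ?nnegrE.
have h2 : (r ^+ 2) ^+ 2 <= (c ^+ 2) ^+ 2 by rewrite lerXn2r ?nnegrE ?sqr_ge0.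
have c3 : 0 <= c ^+ 2 by rewrite sqr_ge0.
have c4 : 0 <= c * c ^+ 2 by rewrite mulr_ge0.
rewrite (_ : ((c + 1) ^+ 2) ^+ 2 = (c ^+ 2) ^+ 2 + 4 * (c * c ^+ 2) + 6 * c ^+ 2 + 4 * c + 1); last by ring.
lra.
Qed.

(** The outer root smooths the absolute value, since the gap is known for nonnegative profiles, and
    [sroot] smooths the radius as a function of [r ^+ 2]. Neither increases the derivative beyond
    that of [v] at the displaced radius. *)
Lemma smoothed_profile v v' e : 0 < e -> isC1 v v' -> exists w w',
  [/\ smooth w w',
      forall r, w r = Num.sqrt (v (sroot e (r ^+ 2)) ^+ 2 + e) &
      forall r, 0 <= r -> w' r ^+ 2 <= v' (sroot e (r ^+ 2)) ^+ 2].
Proof.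
move=> e0 hv.
have hA : isC1 (fun t : R => t ^+ 2 + e) (fun t => 2%:R * t ^+ 1 * 1 + 0).
  by apply: isC1D; [exact: (isC1X 1 isC1_id)|exact: isC1_cst].
have A0 t : 0 < t ^+ 2 + e by rewrite ltr_wpDl ?sqr_ge0.
have hP := isC1_sqrt_pos hA A0.
have P0 t : 0 < Num.sqrt (t ^+ 2 + e) by rewrite sqrtr_gt0.
have hS := isC1_sqrt_pos hP P0.
have hvS := isC1_comp hv hS.
have hZ := isC1D (isC1X 1 hvS) (isC1_cst e).
have Z0 t : 0 < v (Num.sqrt (Num.sqrt (t ^+ 2 + e))) ^+ 2 + e by rewrite ltr_wpDl ?sqr_ge0.
have hW := isC1_sqrt_pos hZ Z0.
pose w := fun r : R => Num.sqrt (v (sroot e (r ^+ 2)) ^+ 2 + e).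
eexists w, _; split => //.
  eexists _, _; split; [exact: hW|by []|by []].
move=> r r0 /=; rewrite expr1 !mulr1 !addr0 expr1.
rewrite -/(sroot e (r ^+ 2)); set S := sroot e (r ^+ 2).
set W := Num.sqrt (v S ^+ 2 + e).
set P := Num.sqrt ((r ^+ 2) ^+ 2 + e).
have Sp : 0 < S by rewrite /S /sroot sqrtr_gt0 sqrtr_gt0.
have Pp : 0 < P by exact: P0.
have Wp : 0 < W by rewrite sqrtr_gt0 ltr_wpDl ?sqr_ge0.
have rS : r <= S by apply: sroot_ge => //; exact: ltW.
have rP : r ^+ 2 <= P.
  by rewrite -[leLHS]ger0_norm ?sqr_ge0// -sqrtr_sqr ler_wsqrtr// lerDl ltW.
have vW : v S ^+ 2 <= W ^+ 2.
  by rewrite sqr_sqrtr ?lerDl ?ltW// addr_ge0 ?sqr_ge0// ltW.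
(* The chain rule gives [v' S] times [v S / W], [r / S] and [r ^+ 2 / P], each of absolute value at
   most 1. *)
rewrite [leLHS](_ : _ = v' S ^+ 2 * ((v S ^+ 2 / W ^+ 2) * (r / S * (r ^+ 2 / P)) ^+ 2)); last first.
  by field; rewrite !gt_eqF.
rewrite ler_piMr ?sqr_ge0// mulr_ile1 ?sqr_ge0 ?divr_ge0 ?sqr_ge0//.
  by rewrite ler_pdivrMr ?mul1r// exprn_gt0.
have h1 : 0 <= r / S <= 1 by rewrite divr_ge0 ?(ltW Sp)//= ler_pdivrMr// mul1r.
have h2 : 0 <= r ^+ 2 / P <= 1 by rewrite divr_ge0 ?sqr_ge0 ?(ltW Pp)//= ler_pdivrMr// mul1r.
move: h1 h2 => /andP[h1 h1'] /andP[h2 h2'].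
by apply: exprn_ile1; [exact: mulr_ge0|exact: mulr_ile1].
Qed.

Lemma sroot_cvg (r : R) : 0 <= r -> sroot (harmonic k) (r ^+ 2) @[k --> \oo] --> r.
Proof.
move=> r0; rewrite -[X in _ --> X](ger0_norm r0) -sqrtr_sqr.
apply: (@continuous_cvg _ _ _ _ _ _ Num.sqrt); first exact: sqrt_continuous.
rewrite -[X in _ --> X]ger0_norm ?sqr_ge0// -sqrtr_sqr.
apply: (@continuous_cvg _ _ _ _ _ _ Num.sqrt); first exact: sqrt_continuous.
rewrite -[X in _ --> X]addr0; apply: cvgD; first exact: cvg_cst.
exact: cvg_harmonic.
Qed.

(** Passing to absolute values can only lower the coupling term: the squares are unchanged and the
    cross term decreases. *)
Lemma abs_diff_sqr_le (k m nn u x : R) : 0 <= k -> 0 <= m -> 0 <= nn ->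
  k * (m * `|u| - nn * `|x|) ^+ 2 <= k * (m * u - nn * x) ^+ 2.
Proof.
move=> k0 m0 nn0; rewrite ler_wpM2l// !sqrrB.
have e1 : (m * `|u|) ^+ 2 = (m * u) ^+ 2 by rewrite !exprMn real_normK ?num_real.
have e2 : (nn * `|x|) ^+ 2 = (nn * x) ^+ 2 by rewrite !exprMn real_normK ?num_real.
rewrite e1 e2 lerD2r lerD2l lerNl opprK lerMn2r /=.
rewrite mulrACA [leRHS]mulrACA ler_wpM2l ?mulr_ge0// -normrM; exact: ler_norm.
Qed.

(** The gap is applied to smoothings of [|v|] with the boundary values [|u1|] and [|u2|], and the
    limit is taken. As the gradient term has a favourable sign, the derivative of the smoothing is
    replaced by its upper bound [v'] at the displaced radius, which converges; [abs_diff_sqr_le]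
    removes the absolute values at the end. *)
Lemma profile_gap (a b : R) (n : nat) (d m nn k1 k2 b1 b2 p1 p2 : R) (C : R -> R) (eta : R) :
  0 <= a -> a < b -> 0 < d -> 0 < m -> 0 < nn -> 0 <= k1 -> 0 <= k2 -> 0 <= b1 -> 0 < b2 ->
  bmeas `]a, b[ C -> 0 < eta -> (0 < a \/ b1 = 0) -> (0 < k2 \/ 0 < k1 /\ 0 < b1) ->
  (forall u1 u2 v v', smooth v v' -> 0 <= qf a b n d m nn k1 k2 b1 b2 p1 p2 C u1 u2 v v') ->
  exists2 dl, 0 < dl & forall u1 u2 v v', isC1 v v' ->
    dl * (b1 * u1 ^+ 2 + b2 * u2 ^+ 2 + wint a b n (fun r => v r ^+ 2)) <=
    qX a b n d m nn k1 k2 b1 b2 p1 p2 C eta u1 u2 v v'.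
Proof.
move=> a0 ab d0 m0 nn0 k10 k20 b10 b20 bC eta0 hab hk q0.
have [dl dl0 hdl] := smooth_profile_gap a0 ab d0 m0 nn0 k10 k20 b10 b20 bC q0 eta0 hab hk.
exists dl => // u1 u2 v v' hv.
have b0 : 0 < b by exact: le_lt_trans a0 ab.
have cv := isC1_continuous hv; have cv' := proj2 hv.
pose e (k : nat) : R := harmonic k.
have e0 k : 0 < e k by rewrite /e harmonic_gt0.
have e1 k : e k <= 1 by rewrite /e /harmonic /= invf_le1// ler1n.
have /choice[ww hww] k := smoothed_profile (e0 k) hv.
have {hww}/choice[ww' hww] k := hww k.
have vabs r : 0 <= r -> ww k r @[k --> \oo] --> `|v r|.
  move=> r0; under eq_fun do rewrite (let: And3 _ h _ := hww _ in h r).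
  rewrite -sqrtr_sqr; apply: (@continuous_cvg _ _ _ _ _ _ Num.sqrt); first exact: sqrt_continuous.
  rewrite -[X in _ --> X]addr0; apply: cvgD; last exact: cvg_harmonic.
  have h : v (sroot (e k) (r ^+ 2)) @[k --> \oo] --> v r.
    by apply: (@continuous_cvg _ _ _ _ _ _ v); [exact: cv|exact: sroot_cvg].
  by rewrite !expr2; apply: cvgM.
have [bv bv'] := bmeas_isC1 a b hv.
(* The displaced radii stay in [[0, b + 1]], so this larger interval gives bounds uniform in [k] for
   dominated convergence. *)
have [_ [Mv hMv]] := continuous_bmeas (-1) (b + 2) cv.
have [_ [Mv' hMv']] := continuous_bmeas (-1) (b + 2) cv'.
have [_ [MC hMC]] := bC.
have Srange k r : a < r < b -> sroot (e k) (r ^+ 2) \in `]-1, (b + 2)[.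
  move=> /andP[ar rb]; have r0 : 0 <= r by rewrite (le_trans a0)// ltW.
  have h1 := @sroot_ge (e k) r (ltW (e0 k)) r0.
  have h2 := @sroot_le (e k) r b.
  rewrite in_itv/=; apply/andP; split; first by move: h1 r0; lra.
  have : sroot (e k) (r ^+ 2) <= b + 1 by apply: h2; [rewrite e1 ltW|rewrite r0 ltW].
  lra.
have smw k : smooth (ww k) (ww' k) by case: (hww k).
have c1w k := smooth_isC1 (smw k).
have bw k : bmeas `]a, b[ (ww k) by exact: (bmeas_isC1 a b (c1w k)).1.
have bw' k : bmeas `]a, b[ (ww' k) by exact: (bmeas_isC1 a b (c1w k)).2.
have w2 k r : ww k r ^+ 2 = v (sroot (e k) (r ^+ 2)) ^+ 2 + e k.
  case: (hww k) => _ -> _; rewrite sqr_sqrtr// addr_ge0 ?sqr_ge0// ltW//.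
have w2M k r : a < r < b -> `|ww k r ^+ 2| <= Mv ^+ 2 + 1.
  move=> rab; rewrite ger0_norm ?sqr_ge0// w2 lerD//.
  have h := hMv _ (Srange k r rab).
  rewrite -[v _ ^+ 2]real_normK ?num_real// lerXn2r ?nnegrE//.
  exact: le_trans (normr_ge0 _) h.
have cS k : continuous (fun r : R => sroot (e k) (r ^+ 2)).
  move=> r; apply: (@continuous_comp _ _ _ (fun r : R => r ^+ 2) (sroot (e k))); first exact: exprn_continuous.
  apply: (@continuous_comp _ _ _ (fun t : R => Num.sqrt (t ^+ 2 + e k)) Num.sqrt); last exact: sqrt_continuous.
  apply: (@continuous_comp _ _ _ (fun t : R => t ^+ 2 + e k) Num.sqrt); last exact: sqrt_continuous.
  by apply: cvgD; [exact: exprn_continuous|exact: cvg_cst].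
have bdS k : bmeas `]a, b[ (fun r : R => v' (sroot (e k) (r ^+ 2)) ^+ 2).
  apply: bmeasX; apply: continuous_bmeas => r.
  by apply: (@continuous_comp _ _ _ (fun r : R => sroot (e k) (r ^+ 2)) v'); [exact: cS|exact: cv'].
have d2M k r : a < r < b -> `|v' (sroot (e k) (r ^+ 2)) ^+ 2| <= Mv' ^+ 2.
  move=> rab; have h := hMv' _ (Srange k r rab).
  rewrite normrX lerXn2r ?nnegrE//; exact: le_trans (normr_ge0 _) h.
have bc (x : R) : bmeas `]a, b[ (fun=> x) by exact: bmeas_cst.
have bfk k : bmeas `]a, b[ (fun r => d * v' (sroot (e k) (r ^+ 2)) ^+ 2 - C r * ww k r ^+ 2).
  by apply: bmeasB; apply: bmeasM => //; exact: bmeasX.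
have ww2cvg r : 0 <= r -> ww k r ^+ 2 @[k --> \oo] --> v r ^+ 2.
  move=> r0; rewrite -[v r ^+ 2]real_normK ?num_real//.
  have h := vabs r r0; rewrite [X in _ --> X]expr2.
  by under eq_fun do rewrite expr2; exact: cvgM.
have L1 : wint a b n (fun r => ww k r ^+ 2) @[k --> \oo] --> wint a b n (fun r => v r ^+ 2).
  apply: (@wint_cvg a b n _ _ (Mv ^+ 2 + 1)) => //.
  - by move=> k; exact: bmeasX.
  - exact: bmeasX.
  - by move=> r /andP[ar _]; apply: ww2cvg; rewrite (le_trans a0)// ltW.
have L2 : wint a b n (fun r => d * v' (sroot (e k) (r ^+ 2)) ^+ 2 - C r * ww k r ^+ 2) @[k --> \oo]
   --> wint a b n (fun r => d * v' r ^+ 2 - C r * v r ^+ 2).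
  apply: (@wint_cvg a b n _ _ (d * Mv' ^+ 2 + MC * (Mv ^+ 2 + 1))) => //.
  - by apply: bmeasB; apply: bmeasM => //; exact: bmeasX.
  - move=> k r rab; apply: le_trans (ler_normB _ _) _.
    apply: lerD; first by rewrite normrM (gtr0_norm d0) ler_wpM2l ?(ltW d0)// d2M.
    by rewrite normrM; apply: ler_pM => //; [apply: hMC; rewrite /= in_itv|exact: w2M].
  - move=> r /andP[ar _]; have r0 : 0 <= r by rewrite (le_trans a0)// ltW.
    apply: cvgB; apply: cvgM; [exact: cvg_cst| |exact: cvg_cst|exact: ww2cvg].
    have h : v' (sroot (e k) (r ^+ 2)) @[k --> \oo] --> v' r.
      by apply: (@continuous_cvg _ _ _ _ _ _ v'); [exact: cv'|exact: sroot_cvg].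
    by rewrite !expr2; apply: cvgM.
have L3 (k0 m' nn' u x p : R) (y : nat -> R) : y k @[k --> \oo] --> x ->
    k0 * (m' * u - nn' * y k) ^+ 2 - p * u ^+ 2 @[k --> \oo] --> k0 * (m' * u - nn' * x) ^+ 2 - p * u ^+ 2.
  move=> yx; apply: cvgB; last exact: cvg_cst.
  apply: cvgM; first exact: cvg_cst.
  have h : m' * u - nn' * y k @[k --> \oo] --> m' * u - nn' * x.
    by apply: cvgB; [exact: cvg_cst|apply: cvgM => //; exact: cvg_cst].
  by rewrite !expr2; apply: cvgM.
pose rhs (v1 v2 z : R) : R := z + b1 * (k1 * (m * `|u1| - nn * v1) ^+ 2 - p1 * `|u1| ^+ 2)
   + b2 * (k2 * (m * `|u2| - nn * v2) ^+ 2 - p2 * `|u2| ^+ 2)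
   + eta * (b1 * `|u1| ^+ 2 + b2 * `|u2| ^+ 2).
have LL : dl * (b1 * `|u1| ^+ 2 + b2 * `|u2| ^+ 2 + wint a b n (fun r => ww k r ^+ 2)) @[k --> \oo] -->
     dl * (b1 * `|u1| ^+ 2 + b2 * `|u2| ^+ 2 + wint a b n (fun r => v r ^+ 2)).
  by apply: cvgM; [exact: cvg_cst|apply: cvgD => //; exact: cvg_cst].
have LR : rhs (ww k a) (ww k b) (wint a b n (fun r => d * v' (sroot (e k) (r ^+ 2)) ^+ 2 - C r * ww k r ^+ 2)) @[k --> \oo]
   --> rhs `|v a| `|v b| (wint a b n (fun r => d * v' r ^+ 2 - C r * v r ^+ 2)).
  apply: cvgD; last exact: cvg_cst.
  apply: cvgD; last by apply: cvgM; [exact: cvg_cst|apply: L3; apply: vabs; exact: ltW].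
  by apply: cvgD => //; apply: cvgM; [exact: cvg_cst|apply: L3; exact: vabs].
have ineq k : dl * (b1 * `|u1| ^+ 2 + b2 * `|u2| ^+ 2 + wint a b n (fun r => ww k r ^+ 2)) <=
   rhs (ww k a) (ww k b) (wint a b n (fun r => d * v' (sroot (e k) (r ^+ 2)) ^+ 2 - C r * ww k r ^+ 2)).
  apply: le_trans (hdl _ _ _ _ (smw k) _) _.
    by move=> r _; case: (hww k) => _ -> _; exact: sqrtr_ge0.
  rewrite /qX /qf /rhs lerD2r !lerD2r; apply: le_wint => //.
    by apply: bmeasB; apply: bmeasM => //; exact: bmeasX.
  move=> r /andP[ar _]; rewrite lerD2r ler_wpM2l ?(ltW d0)//.
  by case: (hww k) => _ _; apply; rewrite (le_trans a0)// ltW.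
have := ler_cvg_to LL LR (nearW _ ineq).
rewrite (real_normK (num_real u1)) (real_normK (num_real u2)) => h.
apply: le_trans (h _ _) _.
rewrite /rhs /qX /qf !real_normK ?num_real// lerD2r.
by rewrite lerD// ?lerD2l ?ler_wpM2l ?(ltW b20)// lerD2r abs_diff_sqr_le// ltW.
Qed.

End smoothing.

(** * Functions of class C^1 and Sobolev spaces *)

Section lines.
Context {R : realType} {n : nat}.
Local Notation E := 'rV[R]_n.
Implicit Types (f : E -> R) (x v : E).

Lemma is_derive_line f x v (t l : R) : is_derive (t *: v + x) v f l ->
  is_derive t 1 (fun r : R => f (r *: v + x)) l.
Proof.
move=> [df dl].
have E1 : (fun h : R => h^-1 *: (((fun r : R => f (r *: v + x)) \o shift t) (h *: (1 : R)) - f (t *: v + x))) =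
   (fun h : R => h^-1 *: ((f \o shift (t *: v + x)) (h *: v) - f (t *: v + x))).
  apply/funext => h /=; congr (_ *: (f _ - _)).
  by rewrite [h *: 1]mulr1 scalerDl addrA.
by split; [rewrite /derivable E1; exact: df|rewrite /derive E1; exact: dl].
Qed.

Lemma is_derive_of_line f x v (l : R) :
  is_derive (0 : R) 1 (fun r : R => f (r *: v + x)) l -> is_derive x v f l.
Proof.
move=> [df dl].
have E1 : (fun h : R => h^-1 *: (((fun r : R => f (r *: v + x)) \o shift 0) (h *: (1 : R)) - f (0 *: v + x))) =
   (fun h : R => h^-1 *: ((f \o shift x) (h *: v) - f x)).
  apply/funext => h /=; rewrite scale0r add0r; congr (_ *: (f _ - _)).
  by rewrite [h *: 1]mulr1 addr0.
by split; [rewrite /derivable -E1; exact: df|rewrite /derive -E1; exact: dl].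
Qed.

Lemma derive_grad f x v : differentiable f x -> 'D_v f x = dotr (grad f x) v.
Proof.
move=> df; rewrite deriveE// {1}(row_sum_delta v) linear_sum/=.
apply: eq_bigr => i _; rewrite linearZ/= mxE deriveE// mulrC.
by rewrite /GRing.scale/=.
Qed.

Lemma C1_continuous f : C1 f -> continuous f.
Proof. by move=> [df _] x; exact: differentiable_continuous. Qed.

Lemma isC1_line f x v : C1 f ->
  isC1 (fun r : R => f (r *: v + x)) (fun r => dotr (grad f (r *: v + x)) v).
Proof.
move=> [df cg]; split => [t|].
  apply: is_derive_line; apply: DeriveDef; first exact: diff_derivable.
  exact: derive_grad.
have cl : continuous (fun r : R => r *: v + x).
  move=> r; apply: (@continuousD _ _ _ (fun r : R => r *: v) (fun=> x)); last exact: cst_continuous.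
  exact: scalel_continuous.
rewrite /dotr; apply: continuous_big => [|i _ r]; first exact: add_continuous.
apply: cvgM; last exact: cvg_cst.
apply: (@continuous_comp _ _ _ (fun r : R => r *: v + x) (fun y => grad f y ord0 i)); first exact: cl.
apply: (@continuous_comp _ _ _ (grad f) (fun M : 'rV[R]_n => M ord0 i)); first exact: cg.
exact: coord_continuous.
Qed.

Lemma grad_coord_continuous f i : C1 f -> continuous (fun x => grad f x ord0 i).
Proof.
move=> [_ cg] x; apply: (@continuous_comp _ _ _ (grad f) (fun M : 'rV[R]_n => M ord0 i)).
  exact: cg.
exact: coord_continuous.
Qed.

Lemma continuous_box_bounded f (c : R) : continuous f ->
  exists C, forall x, box c x -> `|f x| <= C.
Proof.
move=> cf.
have cb : compact (box c : set E).
  rewrite (_ : box c = [set v : 'rV[R]_n | forall i, `[(- c), c]%classic (v ord0 i)]).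
    by apply: (@rV_compact R n (fun=> `[(- c), c]%classic)) => i; exact: segment_compact.
  by apply/seteqP; split => x h i; have := h i; rewrite /= in_itv/= ler_norml.
have := @compact_bounded R R (f @` box c) (continuous_compact (continuous_subspaceT cf) cb).
move=> [M [_ hM]]; exists (M + 1) => x bx; apply: (hM (M + 1)).
  by rewrite ltrDl.
by exists x.
Qed.

Lemma continuous_bmeas_box f (c : R) (A : set E) : measurable A -> A `<=` box c ->
  continuous f -> bmeas A f.
Proof.
move=> mA Ac cf; split.
  by apply: measurable_funTS; exact: continuous_row_measurable.
by have [C hC] := continuous_box_bounded c cf; exists C => x /Ac; exact: hC.
Qed.

End lines.

Section radial_lift.
Context {R : realType} {n : nat}.
Local Notation E := 'rV[R]_n.

Lemma differentiable_dotr (x : E) : differentiable (fun x : E => dotr x x) x.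
Proof.
rewrite (_ : (fun x : E => dotr x x) = \sum_(i < n) (fun x : E => x ord0 i * x ord0 i)); last first.
  by apply/funext => y; rewrite fct_sumE.
apply: differentiable_sum => i; apply: differentiableM; exact: differentiable_coord.
Qed.

Lemma dotrDl (x y z : E) : dotr (x + y) z = dotr x z + dotr y z.
Proof. by rewrite /dotr -big_split; apply: eq_bigr => i _; rewrite mxE mulrDl. Qed.

Lemma dotr_delta (x : E) i : dotr x (delta_mx ord0 i) = x ord0 i.
Proof.
rewrite /dotr (bigD1 i)//= mxE !eqxx mulr1 big1 ?addr0// => j ji.
by rewrite mxE (negbTE ji) andbF mulr0.
Qed.

Lemma dotr_line (x v : E) (r : R) :
  dotr (r *: v + x) (r *: v + x) = dotr v v * r ^+ 2 + 2 * dotr x v * r + dotr x x.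
Proof.
rewrite !dotrDl !(dotrC _ (_ + _)) !dotrDl !dotrZl !dotrZr (dotrC v x) expr2.
set A := dotr v v; set B := dotr x v; set D := dotr x x; ring.
Qed.

Variables (W W' : R -> R).
Hypothesis hW : isC1 W W'.
Definition rlift (x : E) : R := W (dotr x x).

Lemma is_derive_lift (x v : E) : is_derive x v rlift (2 * W' (dotr x x) * dotr x v).
Proof.
apply: is_derive_of_line; rewrite /rlift.
have h := isC1_comp hW (isC1D (isC1D (isC1Z (dotr v v) (isC1X 1 isC1_id))
   (isC1Z (2 * dotr x v) isC1_id)) (isC1_cst (dotr x x))).
have -> : (fun r : R => W (dotr (r *: v + x) (r *: v + x))) =
   (fun r => W (dotr v v * r ^+ 2 + 2 * dotr x v * r + dotr x x)).
  by apply/funext => r; rewrite dotr_line.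
have [d _] := h; apply: (is_derive_eq (d 0)).
rewrite (_ : _ + 2 * dotr x v * 0 + _ = dotr x x); first by ring.
by rewrite mulr0 expr0n/= mulr0 !add0r.
Qed.

Lemma grad_lift (x : E) : grad rlift x = (2 * W' (dotr x x)) *: x.
Proof.
apply/rowP => i; rewrite !mxE.
have [_ ->] := is_derive_lift x (delta_mx ord0 i).
by rewrite dotr_delta.
Qed.

Lemma C1_lift : C1 rlift.
Proof.
split => [x|].
  apply: (@differentiable_comp _ _ _ _ (fun x : E => dotr x x) W); first exact: differentiable_dotr.
  by apply/derivable1_diffP; have [] := hW.1 (dotr x x).
rewrite (_ : grad rlift = (fun x => (2 * W' (dotr x x)) *: x)); last first.
  by apply/funext => x; rewrite grad_lift.
have cm : continuous (fun x : E => 2 * W' (dotr x x)).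
  move=> x; apply: (@continuous_comp _ _ _ (fun x : E => dotr x x) (fun t => 2 * W' t)).
    exact: continuous_dotr.
  by apply: cvgM; [exact: cvg_cst|exact: hW.2].
by move=> x; apply: (@cvgZ _ _ _ (nbhs x)); [exact: cm|exact: cvg_id].
Qed.

End radial_lift.

(** * Integration by parts on the whole space *)

Section no_flux.
Context {R : realType} {n : nat}.
Local Notation E := 'rV[R]_n.

Lemma integral_translation (f : E -> R) (b : E) : measurable_fun setT f ->
  (\int[leb n]_x (f (x + b)%R)%:E = \int[leb n]_x (f x)%:E)%E.
Proof.
move=> mf.
have aff (F : E -> \bar R) : measurable_fun setT F -> (forall x : E, 0 <= F x)%E ->
    (\int[leb n]_x F (x + b)%R = \int[leb n]_x F x)%E.
  move=> mF F0; rewrite [RHS](ge0_integral_leb_affine b (@ltr01 R))// expr1n mul1e.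
  by apply: eq_integral => x _; rewrite scale1r.
have mEf : measurable_fun setT (EFin \o f) by exact/measurable_EFinP.
rewrite integralE [RHS]integralE; congr (_ - _)%E.
  by rewrite -(aff ((EFin \o f)^\+)%E)//; [rewrite unlock|exact: measurable_funepos].
by rewrite -(aff ((EFin \o f)^\-)%E)//; [rewrite unlock|exact: measurable_funeneg].
Qed.

Lemma integrable_box (f : E -> R) (c : R) : bmeas (box c) f ->
  (forall x, ~ box c x -> f x = 0) -> (leb n).-integrable setT (EFin \o f).
Proof.
move=> bf f0.
have : (leb n).-integrable (box c) (EFin \o f).
  by apply: bmeas_integrable => //; [exact: measurable_box|exact: leb_box_lty].
rewrite (integrable_mkcond _ (measurable_box (n:=n) c)).
apply: eq_integrable => // x _; rewrite patchE; case: ifPn => // /negP xc.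
by rewrite /= f0// => bx; apply: xc; exact/mem_set.
Qed.

(** The derivative is the limit of difference quotients, whose integrals vanish by translation
    invariance. The mean value theorem and the bounded support give an integrable bound. *)
Lemma integral_derive0 (psi : E -> R) (i : 'I_n) (c : R) : C1 psi ->
  (forall x, ~ box c x -> psi x = 0) ->
  \int[leb n]_x (grad psi x ord0 i) = 0.
Proof.
move=> hp psi0; pose e : E := delta_mx ord0 i.
have cp := C1_continuous hp; have mp := continuous_row_measurable cp.
have cg := grad_coord_continuous (i:=i) hp.
(* Increments are at most 1: the quotients live on [box (c + 1)], and the intermediate points of the
   mean value theorem on [box (c + 2)]. *)
have [L hL] := continuous_box_bounded (c + 2) cg.
have L0 : (0 <= Num.max L 0) by rewrite le_max lexx orbT.
pose h (k : nat) : R := harmonic k.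
have h0 k : 0 < h k by exact: harmonic_gt0.
have h1 k : h k <= 1 by rewrite /h /harmonic /= invf_le1// ler1n.
pose q (k : nat) (x : E) := (psi (x + h k *: e) - psi x) / h k.
have mq k : measurable_fun setT (q k).
  apply: measurable_funM => //; apply: measurable_funB => //.
  apply: (measurableT_comp mp).
  have := measurable_affine (1 : R) (h k *: e); under eq_fun do rewrite scale1r; exact.
have ip f : continuous f -> (forall x : E, ~ box c x -> f x = 0) -> (leb n).-integrable setT (EFin \o f).
  move=> cf; apply: integrable_box.
  by apply: (@continuous_bmeas_box R n f c) => //; exact: measurable_box.
have iq k : \int[leb n]_x q k x = 0.
  have i1 := ip _ cp psi0.
  have i2 : (leb n).-integrable setT (EFin \o (fun x => psi (x + h k *: e))).
    apply/integrableP; split.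
      apply/measurable_EFinP; apply: (measurableT_comp mp).
      have := measurable_affine (1 : R) (h k *: e); under eq_fun do rewrite scale1r; exact.
    have /integrableP[_] := i1; apply: le_lt_trans.
    rewrite le_eqVlt; apply/orP; left; apply/eqP.
    apply: (@integral_translation (fun x => `|psi x|) (h k *: e)).
    exact: measurableT_comp.
  rewrite /q RintegralZr//; last exact: (integrableB measurableT i2 i1).
  by rewrite RintegralB// /Rintegral integral_translation// subrr mul0r.
have bound k x : `|q k x| <= Num.max L 0 * \1_(box (c + 1)) x.
  rewrite indicE; case: (boolP (x \in _)) => [/set_mem xb|/negP xb]; last first.
    have nb (y : E) : (forall j, `|y ord0 j - x ord0 j| <= 1) -> ~ box c y.
      move=> hy yb; apply: xb; apply/mem_set => j.
      have := yb j; have := hy j; rewrite distrC => h2 h3.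
      by rewrite -(subrK (y ord0 j) (x ord0 j)) addrC (le_trans (ler_normD _ _))// lerD.
    rewrite /q !psi0 ?subrr ?mul0r ?normr0 ?mulr0//.
      by apply: nb => j; rewrite subrr normr0.
    apply: nb => j; rewrite !mxE; set z := h k * _.
    rewrite (_ : _ - _ = z); last by ring.
    rewrite /z normrM gtr0_norm//.
    apply: le_trans (h1 k); apply: ler_piMr; first exact: ltW.
    by case: (_ && _); rewrite ?normr1 ?normr0.
  have line := isC1_line x e hp.
  have cl := isC1_continuous line.
  have [t tI E1] := @MVT R _ _ 0 (h k) (h0 k) (fun t _ => line.1 t) (continuous_subspaceT cl).
  move: E1; rewrite scale0r add0r subr0 => E1.
  rewrite mulr1 /q [x + _]addrC E1 mulfK ?gt_eqF// dotr_delta.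
  apply: (@le_trans _ _ L); last by rewrite le_max lexx.
  apply: hL => j; rewrite !mxE.
  have xj := xb j; move: tI; rewrite in_itv/= => /andP[t0 th].
  apply: le_trans (ler_normD _ _) _.
  have : `|t * (((ord0 : 'I_1) == ord0) && (j == i))%:R| <= 1.
    rewrite normrM gtr0_norm//; apply: le_trans (h1 k); apply: le_trans (ltW th).
    apply: ler_piMr; first exact: ltW.
    by case: (_ && _); rewrite ?normr1 ?normr0.
  by move: xj; lra.
have qcvg x : q k x @[k --> \oo] --> grad psi x ord0 i.
  have [dd dv] := (isC1_line x e hp).1 0.
  pose F (r : R) := psi (r *: e + x).
  pose g (r : R) : R := r^-1 *: ((F \o shift 0) (r *: (1 : R)) - F 0).
  have gl : g r @[r --> 0^'] --> grad psi x ord0 i.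
    suff -> : grad psi x ord0 i = lim (g r @[r --> 0^']) by exact: dd.
    by rewrite -[LHS]dotr_delta -[in LHS](add0r x) -(scale0r e) -dv.
  have -> : (fun k => q k x) = (fun k => g (h k)).
    apply/funext => k; rewrite /q /g /= addr0 [h k *: 1]mulr1 mulrC /GRing.scale/=.
    by rewrite /F scale0r add0r [h k *: e + x]addrC.
  move/cvgr_dnbhsP: gl; apply; split; last exact: cvg_harmonic.
  by move=> k; rewrite gt_eqF.
have ig : (leb n).-integrable setT (EFin \o (fun x => Num.max L 0 * \1_(box (c + 1)) x)).
  apply: (@integrable_box _ (c + 1)) => [|x xb].
    by apply: (@eq_bmeas _ _ _ _ (fun=> Num.max L 0)) => [x xb|]; [rewrite indicE mem_set// mulr1|exact: bmeas_cst].
  by rewrite indicE memNset// mulr0.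
have mg : measurable_fun setT (fun x => grad psi x ord0 i) by exact: continuous_row_measurable.
have H1 k : measurable_fun setT (fun x => (q k x)%:E) by exact/measurable_EFinP.
have H2 : measurable_fun setT (fun x : E => (grad psi x ord0 i)%:E) by exact/measurable_EFinP.
have H3 : {ae leb n, forall x : E, [set: E] x -> (fun k => (q k x)%:E) @ \oo --> (grad psi x ord0 i)%:E}.
  by apply: aeW => x _; apply: cvg_EFin; [exact: nearW|exact: qcvg].
have H5 : {ae leb n, forall (x : E) (k : nat), [set: E] x -> (`|(q k x)%:E| <= (Num.max L 0 * \1_(box (c + 1)) x)%:E)%E}.
  by apply: aeW => x k _; rewrite /= lee_fin.
have [_ _ hq] := @dominated_convergence _ _ R (leb n) setT measurableT _ _ _ H1 H2 H3 ig H5.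
have h' : (fun k => \int[leb n]_x (q k x)%:E)%E @ \oo --> 0%E.
  rewrite (_ : (fun k => _) = cst 0%E); first exact: cvg_cst.
  apply/funext => k; rewrite /= -[LHS]fineK; first by congr EFin; exact: iq.
  apply: integrable_fin_num => //; apply: (le_integrable measurableT (H1 k) _ ig).
  by move=> x _; rewrite /= lee_fin; apply: le_trans (bound k x) _; exact: ler_norm.
by rewrite /Rintegral (cvg_unique _ hq h').
Qed.

End no_flux.

(** * Square-integrable functions and convergence of weighted squares *)

Section square_integrable.
Context {d : measure_display} {T : measurableType d} {R : realType}.
Variables (m : {measure set T -> \bar R}) (A : set T).
Hypothesis mA : measurable A.
Implicit Types (X Y w : T -> R).

Lemma integrable_sqr X : measurable_fun A X ->
  (\int[m]_(x in A) ((X x) ^+ 2)%:E < +oo)%E ->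
  m.-integrable A (EFin \o (fun x => X x ^+ 2)).
Proof.
move=> mX fX; apply/integrableP; split.
  by apply/measurable_EFinP; exact: measurable_funX.
by under eq_integral do rewrite /= ger0_norm ?sqr_ge0//.
Qed.

Lemma weighted_integrable w X : bmeas A w -> m.-integrable A (EFin \o X) ->
  m.-integrable A (EFin \o (fun x => w x * X x)).
Proof.
move=> [mw [C hC]] iX; have mX := (iffLR (measurable_EFinP _ _) (measurable_int _ iX)).
apply: (le_integrable mA _ _ (integrableZl mA C (integrable_abse iX))).
  by apply/measurable_EFinP; exact: measurable_funM.
move=> x Ax; rewrite /= lee_fin normrM [leRHS]ger0_norm; first by rewrite ler_wpM2r// hC.
by rewrite mulr_ge0// (le_trans _ (hC x Ax)).
Qed.

Lemma mul_integrable X Y : measurable_fun A X -> measurable_fun A Y ->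
  m.-integrable A (EFin \o (fun x => X x ^+ 2)) ->
  m.-integrable A (EFin \o (fun x => Y x ^+ 2)) ->
  m.-integrable A (EFin \o (fun x => X x * Y x)).
Proof.
move=> mX mY iX iY; apply: (le_integrable mA _ _ (integrableD mA iX iY)).
  by apply/measurable_EFinP; exact: measurable_funM.
move=> x Ax; rewrite /= lee_fin normrM [leRHS]ger0_norm ?addr_ge0 ?sqr_ge0//.
rewrite -[X x ^+ 2]real_normK ?num_real// -[Y x ^+ 2]real_normK ?num_real//.
have h : 0 <= (`|X x| - `|Y x|) ^+ 2 by exact: sqr_ge0.
have h2 : 0 <= `|X x| * `|Y x| by exact: mulr_ge0.
by move: h h2; rewrite sqrrB; lra.
Qed.

Lemma integrable_sqrB X Y (p q : R) : measurable_fun A X -> measurable_fun A Y ->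
  m.-integrable A (EFin \o (fun x => X x ^+ 2)) ->
  m.-integrable A (EFin \o (fun x => Y x ^+ 2)) ->
  m.-integrable A (EFin \o (fun x => (p * X x - q * Y x) ^+ 2)).
Proof.
move=> mX mY iX iY; have iXY := mul_integrable mX mY iX iY.
have := integrableD mA (integrableZl mA (p ^+ 2) iX)
  (integrableD mA (integrableZl mA (q ^+ 2) iY) (integrableZl mA (- 2 * p * q) iXY)).
apply: eq_integrable => // x _; rewrite /= -!EFinM -!EFinD; congr EFin; ring.
Qed.

(** By Young's inequality the difference of the squares is at most [(1 + t^-1)] times the squared
    error plus [t] times the limit squared, for every [t > 0]. First [t] is fixed small, then the
    error is let go to zero. *)
Lemma weighted_sqr_cvg w X (X_ : nat -> T -> R) : bmeas A w ->
  (forall k, measurable_fun A (X_ k)) -> measurable_fun A X ->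
  (forall k, m.-integrable A (EFin \o (fun x => X_ k x ^+ 2))) ->
  m.-integrable A (EFin \o (fun x => X x ^+ 2)) ->
  (fun k => \int[m]_(x in A) ((X_ k x - X x) ^+ 2)%:E)%E @ \oo --> (0%E : \bar R) ->
  (fun k => \int[m]_(x in A) (w x * X_ k x ^+ 2)) @ \oo -->
    \int[m]_(x in A) (w x * X x ^+ 2).
Proof.
move=> bw mX_ mX iX_ iX cX; have [mw [C0 hC0]] := bw.
pose C := Num.max C0 1; have C1 : 1 <= C by rewrite le_max lexx orbT.
have hC x : A x -> `|w x| <= C by move=> /hC0 h; rewrite le_max h.
pose e k := \int[m]_(x in A) (X_ k x - X x) ^+ 2.
have ie k : m.-integrable A (EFin \o (fun x => (X_ k x - X x) ^+ 2)).
  have := integrable_sqrB 1 1 (mX_ k) mX (iX_ k) iX.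
  by apply: eq_integrable => // x _; rewrite /= !mul1r.
have ce : e k @[k --> \oo] --> 0 by exact: fine_cvg cX.
pose S := \int[m]_(x in A) X x ^+ 2.
have S0 : 0 <= S by apply: Rintegral_ge0 => x _; exact: sqr_ge0.
have bound t k : 0 < t -> `|\int[m]_(x in A) (w x * X_ k x ^+ 2) - \int[m]_(x in A) (w x * X x ^+ 2)|
    <= C * ((1 + t^-1) * e k + t * S).
  move=> t0; rewrite -RintegralB//; [|exact: weighted_integrable..].
  have i1 : m.-integrable A (EFin \o (fun x => (1 + t^-1) * (X_ k x - X x) ^+ 2)).
    by have := integrableZl mA (1 + t^-1) (ie k); apply: eq_integrable => // x _; rewrite /= EFinM.
  have i2 : m.-integrable A (EFin \o (fun x => t * X x ^+ 2)).
    by have := integrableZl mA t iX; apply: eq_integrable => // x _; rewrite /= EFinM.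
  have i3 : m.-integrable A (EFin \o (fun x => (1 + t^-1) * (X_ k x - X x) ^+ 2 + t * X x ^+ 2)).
    by have := integrableD mA i1 i2; apply: eq_integrable.
  have i4 : m.-integrable A (EFin \o (fun x => w x * X_ k x ^+ 2 - w x * X x ^+ 2)).
    have := integrableB mA (weighted_integrable bw (iX_ k)) (weighted_integrable bw iX).
    exact: eq_integrable.
  apply: le_trans (le_normr_Rintegral mA i4) _.
  rewrite /e /S -!RintegralZl// -RintegralD// -RintegralZl//.
  apply: le_Rintegral => //.
  - by have := integrable_abse i4; apply: eq_integrable.
  - by have := integrableZl mA C i3; apply: eq_integrable => // x _; rewrite /= EFinM.
  move=> x Ax; rewrite -mulrBr normrM; apply: ler_pM => //; first exact: hC.
  have y0 : 0 < t^-1 by rewrite invr_gt0.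
  have tv : t * t^-1 = 1 by rewrite divff ?gt_eqF.
  set D := X_ k x - X x; have -> : X_ k x = X x + D by rewrite /D; ring.
  move: tv y0; set y := t^-1; move: (X x) => z tv y0.
  have h1 : 0 <= t * (z - y * D) ^+ 2 by rewrite mulr_ge0 ?sqr_ge0// ltW.
  have h2 : 0 <= t * (z + y * D) ^+ 2 by rewrite mulr_ge0 ?sqr_ge0// ltW.
  have e1 : t * (z - y * D) ^+ 2 = t * z ^+ 2 - 2 * (t * y) * z * D + (t * y) * y * D ^+ 2 by ring.
  have e2 : t * (z + y * D) ^+ 2 = t * z ^+ 2 + 2 * (t * y) * z * D + (t * y) * y * D ^+ 2 by ring.
  have h3 : 0 <= D ^+ 2 by exact: sqr_ge0.
  have h4 : 0 <= y * D ^+ 2 by rewrite mulr_ge0 // ltW.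
  rewrite e1 e2 tv !mul1r !mulr1 in h1 h2.
  have -> : (z + D) ^+ 2 - z ^+ 2 = 2 * z * D + D ^+ 2 by ring.
  rewrite ler_norml mulrDl mul1r; apply/andP; split; lra.
apply/cvgrPdist_le => /= ep ep0.
(* This makes [C * t * S <= ep / 2]; the [+ 1] covers [S = 0]. *)
pose t := ep / (2 * C * (S + 1)).
have CS : 0 < 2 * C * (S + 1) by rewrite !mulr_gt0 //; lra.
have t0 : 0 < t by rewrite divr_gt0.
have K0 : 0 < C * (1 + t^-1) by rewrite mulr_gt0 ?addr_gt0 ?invr_gt0//; lra.
have q0 : 0 < ep / 2 / (C * (1 + t^-1)) by rewrite !divr_gt0.
move/cvgr0Pnorm_le: ce => /(_ _ q0).
apply: filterS => k ek; rewrite distrC; apply: le_trans (bound t k t0) _.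
have {}ek : C * (1 + t^-1) * e k <= ep / 2.
  by rewrite mulrC -ler_pdivlMr//; apply: le_trans ek; exact: ler_norm.
have h : C * (t * S) <= ep / 2.
  have -> : ep / 2 = C * (t * (S + 1)).
    by rewrite /t; field; rewrite !gt_eqF//; lra.
  by apply: ler_wpM2l; [lra|apply: ler_wpM2l; [exact: ltW|lra]].
by rewrite mulrDr mulrA; lra.
Qed.

End square_integrable.

Section C1_products.
Context {R : realType} {n : nat}.
Local Notation E := 'rV[R]_n.
Implicit Types f g : E -> R.

Lemma gradM f g x : differentiable f x -> differentiable g x ->
  grad (fun x => f x * g x) x = f x *: grad g x + g x *: grad f x.
Proof.
move=> df dg; apply/rowP => i; rewrite !mxE.
by rewrite (@deriveM _ _ f g)//; exact: diff_derivable.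
Qed.

Lemma C1M f g : C1 f -> C1 g -> C1 (fun x => f x * g x).
Proof.
move=> hf hg; have cf := C1_continuous hf; have cg := C1_continuous hg.
split => [x|]; first by apply: (@differentiableM _ _ f g); [exact: hf.1|exact: hg.1].
rewrite (_ : grad _ = fun x => f x *: grad g x + g x *: grad f x); last first.
  by apply/funext => x; rewrite gradM; [|exact: hf.1|exact: hg.1].
move=> x; apply: (@continuousD _ _ _ (fun x => f x *: grad g x) (fun x => g x *: grad f x)).
  by apply: continuousZ; [exact: cf|exact: hg.2].
by apply: continuousZ; [exact: cg|exact: hf.2].
Qed.

End C1_products.

(** * Smooth functions as members of the Sobolev spaces *)

Section sobolev_smooth.
Context {R : realType} {n : nat}.
Local Notation E := 'rV[R]_n.+1.
Variable s : radial_domain R.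
Hypothesis hs : admissible s.
Local Notation om := (dom n.+1 s).
Local Notation bd := (boundary om).
Local Notation lam := (leb n.+1).
Local Notation sig := (bdry_measure s).
Local Notation a := (inner s).
Local Notation b := (outer s).
Let mom : measurable om := measurable_dom hs.
Let mbd : measurable bd := measurable_bdry hs.

Lemma bdry_enorm (y : E) : bd y -> enorm y = a \/ enorm y = b.
Proof. by rewrite boundary_dom//; case: s => [r|r1 r2] /=; [right|]. Qed.

Lemma bdry_dotr_neq0 (y : E) : bd y -> dotr y y != 0.
Proof. by move=> /(bdry_gt0 hs) y0; rewrite -enorm_sqr gt_eqF// exprn_gt0. Qed.

Lemma dom_box : om `<=` box b.
Proof. by move=> x /(dom_lt hs) h i; rewrite (le_trans (coord_le_enorm _ _))// ltW. Qed.

Lemma bdry_box : bd `<=` box b.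
Proof.
move=> x bx i; rewrite (le_trans (coord_le_enorm _ _))//.
have ab := inner_lt_outer hs.
by case: (bdry_enorm bx) => ->//; exact: ltW.
Qed.

Lemma continuous_bmeas_dom (f : E -> R) : continuous f -> bmeas om f.
Proof. by move=> cf; apply: continuous_bmeas_box cf; [exact: mom|exact: dom_box]. Qed.

Lemma continuous_bmeas_bdry (f : E -> R) : continuous f -> bmeas bd f.
Proof. by move=> cf; apply: continuous_bmeas_box cf; [exact: mbd|exact: bdry_box]. Qed.

Lemma bmeas_dotr (A : set E) (G : E -> E) : measurable A ->
  (forall i, bmeas A (fun x => G x ord0 i)) -> bmeas A (fun x => dotr (G x) (G x)).
Proof.
move=> mA hG; rewrite /dotr; move: (index_enum _) => r; elim: r => [|i r ih].
  by under [X in bmeas _ X]eq_fun do rewrite big_nil; exact: bmeas_cst.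
under [X in bmeas _ X]eq_fun do rewrite big_cons.
by apply: bmeasD => //; exact: bmeasM.
Qed.

(** The boundary has at most two radii, so a radial function is a simple function there, however
    irregular [k] is. *)
Lemma bmeas_bdry_radial (k : R -> R) : bmeas bd (fun y : E => k (enorm y)).
Proof.
have ab := inner_lt_outer hs.
apply: (@eq_bmeas _ _ _ _ (fun y : E => k a + (k b - k a) * \1_(sph b) y)).
  move=> y /bdry_enorm[e|e]; rewrite indicE.
    by rewrite memNset ?mulr0 ?addr0 ?e// /sph/= e => e'; move: ab; rewrite e' ltxx.
  by rewrite mem_set ?mulr1 ?e//; ring.
apply: bmeasD => //; first exact: bmeas_cst.
apply: bmeasM => //; first exact: bmeas_cst.
split; first by apply: measurable_indic; exact: measurable_sph.
by exists 1 => y _; rewrite indicE; case: (_ \in _); rewrite ?normr1 ?normr0.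
Qed.

Lemma bmeas_L2 (mu : {measure set E -> \bar R}) (A : set E) (f : E -> R) :
  measurable A -> (mu A < +oo)%E -> bmeas A f -> L2 mu A f.
Proof.
move=> mA fA bf; split; first by case: bf.
have /integrableP[_] := bmeas_integrable mA fA (bmeasX 2 bf).
by under eq_integral do rewrite /= ger0_norm ?sqr_ge0//.
Qed.

(** The product [V * phi] vanishes outside a box, so [integral_derive0] applies to it and the
    product rule splits its derivative. *)
Lemma weak_grad_C1 (V : E -> R) : C1 V -> weak_grad om V (grad V).
Proof.
move=> hV phi hphi [K [cK Ko K0]] i.
have cl : closed K by apply: compact_closed cK; exact: norm_hausdorff.
(* The support is closed, so [phi] vanishes near any point outside [om], boundary points
   included. *)
have g0 x : ~ om x -> grad phi x ord0 i = 0.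
  move=> nx; rewrite mxE -[RHS](derive_cst (V := E) (0 : R) (delta_mx ord0 i) x).
  apply: near_eq_derive; have : (~` K) x by move=> /Ko.
  move=> Kx; have := open_nbhs_nbhs (conj (closed_openC cl) Kx).
  by apply: filterS => y; exact: K0.
have phi0 x : ~ om x -> phi x = 0 by move=> nx; apply: K0 => /Ko.
have hpsi := C1M hV hphi.
have gpsi x : grad (fun x => V x * phi x) x ord0 i = V x * grad phi x ord0 i + phi x * grad V x ord0 i.
  rewrite gradM; [by rewrite !mxE|exact: hV.1|exact: hphi.1].
have := integral_derive0 i (c := b) hpsi; rewrite (_ : \int[lam]_x _ =
   \int[lam]_(x in om) (V x * grad phi x ord0 i + grad V x ord0 i * phi x)); last first.
  rewrite [RHS]Rintegral_mkcond; apply: eq_Rintegral => x _; rewrite patchE gpsi.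
  by case: ifPn => [_|/negP nx]; [ring|rewrite phi0 ?g0 ?mul0r ?mulr0 ?addr0// => /mem_set].
have bV := continuous_bmeas_dom (C1_continuous hV).
have bphi := continuous_bmeas_dom (C1_continuous hphi).
have bgV := continuous_bmeas_dom (grad_coord_continuous (i := i) hV).
have bgphi := continuous_bmeas_dom (grad_coord_continuous (i := i) hphi).
have fin := leb_dom_lty (n := n) hs.
have i1 := bmeas_integrable mom fin (bmeasM bV bgphi).
have i2 := bmeas_integrable mom fin (bmeasM bgV bphi).
rewrite RintegralD//.
move=> h; apply/eqP; rewrite -addr_eq0; apply/eqP; apply: h => x xb.
by rewrite phi0 ?mulr0// => /dom_box.
Qed.

Lemma C1_H1 (V : E -> R) : C1 V -> H1 om V (grad V).
Proof.
move=> hV; have fin := leb_dom_lty (n := n) hs; split; last exact: weak_grad_C1.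
  by apply: bmeas_L2 => //; apply: continuous_bmeas_dom; exact: C1_continuous.
by move=> i; apply: bmeas_L2 => //; apply: continuous_bmeas_dom; exact: grad_coord_continuous.
Qed.

Lemma L2_cvg_cst (mu : {measure set E -> \bar R}) (A : set E) (f g : E -> R) :
  (forall x, A x -> f x = g x) -> L2_cvg mu A (fun=> f) g.
Proof.
move=> fg; rewrite /L2_cvg (_ : (fun k : nat => _) = cst 0%E); first exact: cvg_cst.
by apply/funext => k; apply: integral0_eq => x Ax; rewrite fg// subrr expr0n.
Qed.

Lemma C1_trace (V : E -> R) : C1 V -> trace s V (grad V) V.
Proof.
move=> hV; have fin := bdry_lty (n := n) hs; split.
  by apply: bmeas_L2 => //; apply: continuous_bmeas_bdry; exact: C1_continuous.
exists (fun=> V); split => // [|i|]; exact: L2_cvg_cst.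
Qed.

(** The gradient of a radial function is a multiple of [x], which the tangential projection removes;
    the boundary avoids the origin, so the division in [tgrad] is harmless. *)
Lemma rlift_H1_bdry (W W' : R -> R) : isC1 W W' -> H1_bdry s (rlift W : E -> R) (fun=> 0).
Proof.
move=> hW; have hU := C1_lift (n := n.+1) hW; have fin := bdry_lty (n := n) hs; split.
- by apply: bmeas_L2 => //; apply: continuous_bmeas_bdry; exact: C1_continuous.
- by move=> i; apply: bmeas_L2 => //; under eq_fun do rewrite mxE; exact: bmeas_cst.
exists (fun=> rlift W); split => // [|i]; apply: L2_cvg_cst => // x bx.
rewrite /tgrad (grad_lift hW) dotrZl mulfK ?bdry_dotr_neq0//.
by rewrite subrr mxE.
Qed.

End sobolev_smooth.

(** * Regularity of the linearised coefficients *)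

Section boundary_derivative.
Context {R : realType} {n : nat}.
Local Notation E := 'rV[R]_n.
Variables (beta : R) (A : set E) (f : E -> R -> R).
Hypothesis hf : C1holder beta (A `*` [set v : R | 0 <= v]) (fun p : E * R => f p.1 p.2).

(** The one-sided derivative at 0 is the differential at [(y, 0)] applied to [(0, 1)], so it
    inherits the Hoelder bound. *)
Lemma rderiv0_holder (K : R) : exists2 C, 0 <= C &
  forall y z, A y -> A z -> `|y| <= K -> `|z| <= K ->
    `|rderiv0 (f y) - rderiv0 (f z)| <= C * `|y - z| `^ beta.
Proof.
have [p [dp hp]] := hf; have [C hC] := hp K.
have rd y : A y -> rderiv0 (f y) = p (y, 0) (0, 1).
  move=> Ay; apply: cvg_lim => //; apply/cvgrPdist_le => /= e e0.
  have A0 : (A `*` [set v : R | 0 <= v]) (y, 0) by split => /=.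
  have := dp _ A0 _ e0; rewrite near_withinE.
  rewrite -nbhs_ballE => -[r /= r0 hr].
  near=> t; have t0 : 0 < t by near: t; exact: nbhs_right_gt.
  have tr : t < r by near: t; exact: nbhs_right_lt.
  have : `|f y t - f y 0 - p (y, 0) ((y, t) - (y, 0))| <= e * `|((y, t) : E * R) - (y, 0)|.
    apply: (hr (y, t)); last by split => //=; exact: ltW.
    split => /=; first exact: ballxx.
    by rewrite /ball/= sub0r normrN gtr0_norm.
  have -> : ((y, t) : E * R) - (y, 0) = t *: ((0, 1) : E * R).
    rewrite (_ : _ - _ = (y - y, t - 0))// (_ : t *: _ = (t *: (0 : E), t * 1))//.
    by rewrite subrr subr0 scaler0 mulr1.
  rewrite linearZ normrZ (_ : `|((0, 1) : E * R)| = 1); last first.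
    by rewrite prod_normE/= normr0 normr1 max_r.
  rewrite mulr1 gtr0_norm// -ler_pdivrMr// => h; rewrite distrC.
  set P := p (y, 0) (0, 1) in h *.
  have -> : (f y t - f y 0) / t - P = (f y t - f y 0 - t * P) / t by field; rewrite gt_eqF.
  by rewrite normrM normfV (gtr0_norm t0).
exists (Num.max C 0) => [|y z Ay Az yK zK]; first by rewrite le_max lexx orbT.
have n0 (x : E) : `|((x, 0) : E * R)| = `|x| by rewrite prod_normE/= normr0 max_l.
rewrite !rd//; apply: le_trans (hC (y, 0) (z, 0) (0, 1) _ _ _ _) _; rewrite ?n0//.
- by split => /=.
- by split => /=.
rewrite (_ : ((y, 0) : E * R) - (z, 0) = (y - z, 0 - 0))// subrr.
rewrite n0 prod_normE/= normr0 normr1 max_r// mulr1.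
by apply: ler_wpM2r; [exact: powR_ge0|rewrite le_max lexx].
Unshelve. all: by end_near. Qed.

End boundary_derivative.

Section coefficients.
Context {R : realType} {n : nat}.
Local Notation E := 'rV[R]_n.+1.
Variables (s : radial_domain R) (beta : R) (f : E -> R -> R).
Hypothesis hs : admissible s.
Local Notation om := (dom n.+1 s).
Local Notation b := (outer s).
Hypothesis beta0 : 0 < beta.
Hypothesis hf : C1holder beta (om `*` [set v : R | 0 <= v]) (fun p : E * R => f p.1 p.2).
Hypothesis hrad : radial_on om (fun y => rderiv0 (f y)).

Lemma dom_enorm_eq (x y : E) : enorm x = enorm y -> om x -> om y.
Proof. by move=> e; rewrite !domE//; case: s => [r|r1 r2] /=; rewrite e. Qed.

Let e0 : E := delta_mx ord0 ord0.
Let enorm_e0 : enorm e0 = 1.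
Proof. by rewrite /enorm dotr_delta mxE !eqxx sqrtr1. Qed.

Let ft (r : R) := rderiv0 (f (r *: e0)).

Let om_ray y : om y -> om (enorm y *: e0).
Proof.
by apply: dom_enorm_eq; rewrite enormZ enorm_e0 mulr1 ger0_norm ?enorm_ge0.
Qed.

Let radial_ft y : om y -> rderiv0 (f y) = ft (enorm y).
Proof.
move=> oy; have [k hk] := hrad; rewrite /ft hk// hk; last exact: om_ray.
by rewrite enormZ enorm_e0 mulr1 ger0_norm ?enorm_ge0.
Qed.

Let dom_norm y : om y -> `|y| <= b.
Proof. by move=> /(dom_box hs) h; apply: norm_le_coord => //; exact/ltW/outer_gt0. Qed.

(** Radial symmetry reduces the claim to the line through [e0], where the Hoelder bound gives
    continuity on an open set of radii; boundedness is the same bound against one reference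
    point. *)
Lemma rderiv0_bmeas : bmeas om (fun y => rderiv0 (f y)).
Proof.
have [C C0 hC] := rderiv0_holder hf b.
pose S : set R := [set r | om (r *: e0)].
have oS : open S.
  apply: (@open_comp _ _ (fun r : R => r *: e0)); last exact: open_dom.
  by move=> r _; exact: scalel_continuous.
have cft : {in S, continuous ft}.
  move=> r /set_mem Sr; apply/cvgrPdist_le => /= e ep.
  (* This radius solves [(C + 1) * rho ^ beta = e]. *)
  have ep' : 0 < (e / (C + 1)) `^ beta^-1 by apply: powR_gt0; rewrite divr_gt0 ?ltr_wpDl.
  have := open_nbhs_nbhs (conj oS Sr); move=> nS.
  have nb := @nbhsx_ballx _ _ r _ ep'.
  near=> t; have St : S t by near: t.
  have bt : ball r ((e / (C + 1)) `^ beta^-1) t by near: t.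
  apply: le_trans (hC _ _ Sr St (dom_norm Sr) (dom_norm St)) _.
  rewrite -scalerBl normrZ; have -> : `|e0| = 1.
    apply/eqP; rewrite eq_le; apply/andP; split.
      apply: norm_le_coord => // i; rewrite mxE; case: (_ && _); by rewrite ?normr1 ?normr0.
    by rewrite (le_trans _ (coord_le_norm e0 ord0))// mxE !eqxx normr1.
  rewrite mulr1; have h : `|r - t| `^ beta <= e / (C + 1).
    have -> : e / (C + 1) = ((e / (C + 1)) `^ beta^-1) `^ beta.
      by rewrite -powRrM mulVf ?gt_eqF// powRr1// divr_ge0 ?addr_ge0// ltW.
    by apply: ge0_ler_powR; rewrite ?nnegrE ?(ltW beta0) ?(ltW ep') ?(ltW bt).
  apply: le_trans (ler_wpM2l C0 h) _.
  by rewrite mulrCA ler_piMr ?(ltW ep)// ler_pdivrMr ?ltr_wpDl// mul1r lerDl.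
have mS : measurable S by exact: open_measurable.
have mft : measurable_fun S ft by exact: open_continuous_measurable_fun.
split.
  apply: (@eq_measurable_fun _ _ _ _ _ (ft \o enorm)) => [y /set_mem oy|]; first by rewrite radial_ft.
  apply: (measurable_comp mS _ mft); last by apply: measurable_funTS; exact: measurable_enorm.
  by move=> _ [y oy <-]; exact: om_ray.
have [[y0 oy0]|no] := pselect (exists y, om y); last by exists 0 => x ox; case: no; exists x.
exists (`|rderiv0 (f y0)| + C * (2 * b) `^ beta) => x ox.
rewrite -[X in `|X|](subrK (rderiv0 (f y0))) addrC; apply: le_trans (ler_normD _ _) _.
rewrite lerD2l; apply: le_trans (hC _ _ ox oy0 (dom_norm ox) (dom_norm oy0)) _.
apply: ler_wpM2l => //; apply: ge0_ler_powR; rewrite ?nnegrE ?(ltW beta0)//.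
  by rewrite mulr_ge0// ltW// outer_gt0.
by rewrite (le_trans (ler_normB _ _))// mulr_natl mulr2n lerD// dom_norm.
Unshelve. all: by end_near. Qed.

Lemma rderiv0_radial : exists ft : R -> R, bmeas `]inner s, outer s[ ft /\
  forall y, om y -> rderiv0 (f y) = ft (enorm y).
Proof.
exists ft; split; last exact: radial_ft.
exact: (ray_bmeas hs rderiv0_bmeas enorm_e0).
Qed.

End coefficients.

Lemma Rintegral_dotr (d : measure_display) (T : measurableType d) (R : realType) (n : nat)
    (mu : {measure set T -> \bar R}) (A : set T) (G : T -> 'rV[R]_n) :
  measurable A ->
  (forall i, mu.-integrable A (EFin \o (fun x => G x ord0 i ^+ 2))) ->
  \int[mu]_(x in A) dotr (G x) (G x) = \sum_(i < n) \int[mu]_(x in A) (G x ord0 i ^+ 2).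
Proof.
move=> mA iG; rewrite /dotr.
have : mu.-integrable A (EFin \o (fun x => \sum_(i < n) G x ord0 i * G x ord0 i)) /\
    \int[mu]_(x in A) \sum_(i < n) G x ord0 i * G x ord0 i =
    \sum_(i < n) \int[mu]_(x in A) (G x ord0 i ^+ 2).
  move: (index_enum _) => r; elim: r => [|i r [ih1 ih2]].
    split; last by under eq_Rintegral do rewrite big_nil; rewrite big_nil Rintegral_cst// mul0r.
    rewrite (_ : EFin \o _ = cst 0%E); first exact: integrable0.
    by apply/funext => x; rewrite /= big_nil.
  have i1 : mu.-integrable A (EFin \o (fun x => G x ord0 i * G x ord0 i)) by have := iG i.
  split.
    have := integrableD mA i1 ih1; apply: eq_integrable => // x _.
    by rewrite /= big_cons EFinD.
  by rewrite big_cons -ih2 -RintegralD//; apply: eq_Rintegral => x _; rewrite big_cons.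
by case.
Qed.

(** * From the inequality on profiles to the form on the domain *)

Section quadratic_form.
Context {R : realType} {n : nat}.
Local Notation E := 'rV[R]_n.+1.
Variable s : radial_domain R.
Hypothesis hs : admissible s.
Local Notation om := (dom n.+1 s).
Local Notation bd := (boundary om).
Local Notation lam := (leb n.+1).
Local Notation sig := (bdry_measure s).
Local Notation a := (inner s).
Local Notation b := (outer s).
Local Notation w1 := (@winner R n s).
Local Notation w2 := (@wouter R n s).
Let mom : measurable om := measurable_dom hs.
Let mbd : measurable bd := measurable_bdry hs.
Let fom : (lam om < +oo)%E := leb_dom_lty hs.
Let fbd : (sig bd < +oo)%E := bdry_lty hs.
Let ab := inner_lt_outer hs.
Let a0 := inner_ge0 hs.

Variables (d m nn : R) (Cw kw pw : E -> R) (C k p : R -> R).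
Hypothesis bCw : bmeas om Cw.
Hypothesis bC : bmeas `]a, b[ C.
Hypothesis hC : forall y, om y -> Cw y = C (enorm y).
Hypothesis hk : forall y, bd y -> kw y = k (enorm y).
Hypothesis hp : forall y, bd y -> pw y = p (enorm y).

(** The energy minus a level times the squared norm, without the surface gradient; the level is
    absorbed in [Cw] and [pw]. *)
Definition reduced_form (U V : E -> R) (GV : E -> E) (T : E -> R) : R :=
  d * \int[lam]_(y in om) dotr (GV y) (GV y) - \int[lam]_(y in om) (Cw y * V y ^+ 2)
  + \int[sig]_(y in bd) (kw y * (m * U y - nn * T y) ^+ 2)
  - \int[sig]_(y in bd) (pw y * U y ^+ 2).

Let bkw : bmeas bd kw.
Proof. by apply: eq_bmeas (bmeas_bdry_radial hs k) => y /hk ->. Qed.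

Let bpw : bmeas bd pw.
Proof. by apply: eq_bmeas (bmeas_bdry_radial hs p) => y /hp ->. Qed.

Local Notation q := (qf a b n d m nn (k a) (k b) w1 w2 (p a) (p b) C).

Let sphere_values th : enorm th = 1 ->
  [/\ w1 != 0 -> kw (a *: th) = k a, w1 != 0 -> pw (a *: th) = p a,
      kw (b *: th) = k b & pw (b *: th) = p b].
Proof.
move=> th1; have ea : enorm (a *: th) = a by rewrite enormZ th1 mulr1 ger0_norm.
have eb : enorm (b *: th) = b by rewrite enormZ th1 mulr1 gtr0_norm// outer_gt0.
split => [w10|w10||]; rewrite ?hk ?hp ?ea ?eb//;
  by [exact: bdry_inner|exact: bdry_outer].
Qed.

(** On each ray [U] enters only through its two endpoint values, as free parameters of the
    inequality on profiles, so square integrability is enough for it. By Cauchy-Schwarz the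
    derivative along a ray is at most the full gradient. *)
Lemma form_C1_ge0 (U phi : E -> R) : 0 <= d ->
  (forall u1 u2 v v', isC1 v v' -> 0 <= q u1 u2 v v') ->
  L2 sig bd U -> C1 phi -> 0 <= reduced_form U phi (grad phi) phi.
Proof.
move=> d0 q0 [mU fU] hphi.
have iU := integrable_sqr mU fU.
have bphi := continuous_bmeas_dom hs (C1_continuous hphi).
have bphi' := continuous_bmeas_bdry hs (C1_continuous hphi).
have bg i := continuous_bmeas_dom hs (grad_coord_continuous (i := i) hphi).
have bgg := bmeas_dotr mom bg.
have bd_ : bmeas om (fun=> d : R) by exact: bmeas_cst.
pose F y := d * dotr (grad phi y) (grad phi y) - Cw y * phi y ^+ 2.
pose K y := kw y * (m * U y - nn * phi y) ^+ 2.
pose P y := pw y * U y ^+ 2.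
have bF1 : bmeas om (fun y => d * dotr (grad phi y) (grad phi y)) by exact: bmeasM.
have bF2 : bmeas om (fun y => Cw y * phi y ^+ 2) by apply: bmeasM => //; exact: bmeasX.
have bF : bmeas om F by exact: bmeasB.
have iphi : sig.-integrable bd (EFin \o (fun y => phi y ^+ 2)).
  by apply: bmeas_integrable => //; exact: bmeasX.
have iK : sig.-integrable bd (EFin \o K).
  exact: (weighted_integrable mbd bkw (integrable_sqrB mbd m nn mU bphi'.1 iU iphi)).
have iP : sig.-integrable bd (EFin \o P) by exact: (weighted_integrable mbd bpw iU).
have iG : sig.-integrable bd (EFin \o (fun y => K y - P y)).
  by have := integrableB mbd iK iP; apply: eq_integrable.
have -> : reduced_form U phi (grad phi) phi =
    \int[lam]_(y in om) F y + \int[sig]_(y in bd) (K y - P y).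
  have i1 := bmeas_integrable mom fom bF1; have i2 := bmeas_integrable mom fom bF2.
  have -> : \int[lam]_(y in om) F y = d * \int[lam]_(y in om) dotr (grad phi y) (grad phi y) -
      \int[lam]_(y in om) (Cw y * phi y ^+ 2).
    by rewrite /F RintegralB// RintegralZl//; exact: bmeas_integrable.
  by rewrite RintegralB// addrA.
apply: slice_ge0 => // th th1.
have line := isC1_line 0 th hphi.
have := q0 (U (a *: th)) (U (b *: th)) _ _ line; rewrite /qf => /le_trans; apply.
rewrite -addrA; apply: lerD.
  have [bv bv'] := bmeas_isC1 a b line.
  apply: le_wint => //.
  - have bdI : bmeas `]a, b[ (fun=> d : R) by exact: bmeas_cst.
    by apply: bmeasB; apply: bmeasM => //; exact: bmeasX.
  - exact: ray_bmeas.
  move=> r /andP[ar rb]; have r0 : 0 < r by exact: le_lt_trans ar.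
  have er : enorm (r *: th) = r by rewrite enormZ th1 mulr1 gtr0_norm.
  have omr : om (r *: th) by apply/dom_ray => //; rewrite ar.
  rewrite /F hC// er !addr0 lerB// ler_wpM2l//.
  apply: le_trans (dotr_cauchy _ _) _.
  by rewrite -(enorm_sqr th) th1 expr1n mulr1.
have [ka pa kb pb] := sphere_values th1.
rewrite !addr0 /K /P kb pb; apply: lerD => //.
have [->|w10] := eqVneq w1 0; first by rewrite !mul0r.
by rewrite ka// pa.
Qed.

(** The definition of the trace supplies [C^1] functions converging at once in the bulk, in gradient
    and on the boundary, and every term of the form is continuous along them. *)
Lemma form_ge0 (U V : E -> R) (GV : E -> E) (T : E -> R) : 0 <= d ->
  (forall u1 u2 v v', isC1 v v' -> 0 <= q u1 u2 v v') ->
  L2 sig bd U -> L2 lam om V -> L2_vec lam om GV -> trace s V GV T ->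
  0 <= reduced_form U V GV T.
Proof.
move=> d0 q0 LU [mV fV] LG [[mT fT] [phi [hphi cV cG cT]]].
have [mU fU] := LU; have iU := integrable_sqr mU fU.
have iV := integrable_sqr mV fV; have iT := integrable_sqr mT fT.
have iG i := integrable_sqr (LG i).1 (LG i).2.
have bphi j := continuous_bmeas_dom hs (C1_continuous (hphi j)).
have bphi' j := continuous_bmeas_bdry hs (C1_continuous (hphi j)).
have bg j i := continuous_bmeas_dom hs (grad_coord_continuous (i := i) (hphi j)).
have iphi j : lam.-integrable om (EFin \o (fun y => phi j y ^+ 2)).
  by apply: bmeas_integrable => //; exact: bmeasX.
have iphi' j : sig.-integrable bd (EFin \o (fun y => phi j y ^+ 2)).
  by apply: bmeas_integrable => //; exact: bmeasX.
have ig j i : lam.-integrable om (EFin \o (fun y => grad (phi j) y ord0 i ^+ 2)).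
  by apply: bmeas_integrable => //; apply: bmeasX => //; exact: bg.
suff cvf : (fun j => reduced_form U (phi j) (grad (phi j)) (phi j)) @ \oo --> reduced_form U V GV T.
  have f0 j : 0 <= reduced_form U (phi j) (grad (phi j)) (phi j) by exact: form_C1_ge0.
  have c0 : (fun _ : nat => 0 : R) @ \oo --> (0 : R) by exact: cvg_cst.
  have h := ler_cvg_to c0 cvf (nearW _ f0); exact: h _ _.
have cA : (fun j => \int[lam]_(y in om) dotr (grad (phi j) y) (grad (phi j) y)) @ \oo -->
    \int[lam]_(y in om) dotr (GV y) (GV y).
  rewrite Rintegral_dotr//; under eq_fun do rewrite Rintegral_dotr//.
  apply: cvg_big => [|i _]; first exact: add_continuous.
  have b1 : bmeas om (fun=> 1 : R) by exact: bmeas_cst.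
  have e1 (X : E -> R) : \int[lam]_(y in om) (1 * X y ^+ 2) = \int[lam]_(y in om) (X y ^+ 2).
    by apply: eq_Rintegral => y _; rewrite mul1r.
  rewrite -(e1 (fun y => GV y ord0 i)).
  under eq_fun do rewrite -(e1 (fun y => grad (phi _) y ord0 i)).
  exact: (weighted_sqr_cvg mom b1 (fun j => (bg j i).1) (LG i).1 (ig^~ i) (iG i) (cG i)).
have cB := weighted_sqr_cvg mom bCw (fun j => (bphi j).1) mV iphi iV cV.
have mX j : measurable_fun bd (fun y => m * U y - nn * phi j y).
  by apply: measurable_funB; apply: measurable_funM => //; case: (bphi' j).
have mXT : measurable_fun bd (fun y => m * U y - nn * T y).
  by apply: measurable_funB; apply: measurable_funM.
have iX j := integrable_sqrB mbd m nn mU (bphi' j).1 iU (iphi' j).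
have iXT := integrable_sqrB mbd m nn mU mT iU iT.
have cX : (fun j => \int[sig]_(y in bd) (((m * U y - nn * phi j y) - (m * U y - nn * T y)) ^+ 2)%:E)%E
    @ \oo --> (0%E : \bar R).
  have E1 j : (\int[sig]_(y in bd) (((m * U y - nn * phi j y) - (m * U y - nn * T y)) ^+ 2)%:E =
      (nn ^+ 2)%:E * \int[sig]_(y in bd) ((phi j y - T y) ^+ 2)%:E)%E.
    rewrite -ge0_integralZl_EFin ?sqr_ge0//.
    - by apply: eq_integral => y _; rewrite -EFinM; congr EFin; ring.
    - by move=> y _; rewrite lee_fin sqr_ge0.
    apply/measurable_EFinP; apply: measurable_funX; apply: measurable_funB => //.
    by case: (bphi' j).
  under eq_fun do rewrite E1; rewrite -(mule0 (nn ^+ 2)%:E).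
  by apply: cvgeZl => //; exact: cT.
have cK := weighted_sqr_cvg mbd bkw mX mXT iX iXT cX.
rewrite /reduced_form; apply: cvgB; last exact: cvg_cst.
apply: cvgD; last exact: cK.
by apply: cvgB; [apply: cvgM; [exact: cvg_cst|exact: cA]|exact: cB].
Qed.

Section radial_functions.
Variables (Wu Wu' W W' : R -> R).
Hypotheses (hWu : isC1 Wu Wu') (hW : isC1 W W').
Local Notation U := (rlift Wu : E -> R).
Local Notation V := (rlift W : E -> R).
Local Notation v := (fun r : R => W (r ^+ 2)).
Local Notation v' := (fun r : R => W' (r ^+ 2) * (2 * r)).

Let rlift_sph (X : R -> R) (r : R) th : enorm th = 1 -> rlift X (r *: th : E) = X (r ^+ 2).
Proof. by move=> th1; rewrite /rlift -enorm_sqr enormZ th1 mulr1 real_normK ?num_real. Qed.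

Let bV : bmeas om V.
Proof. by apply: continuous_bmeas_dom => //; exact: C1_continuous (C1_lift hW). Qed.
Let bV' : bmeas bd V.
Proof. by apply: continuous_bmeas_bdry => //; exact: C1_continuous (C1_lift hW). Qed.
Let bU : bmeas bd U.
Proof. by apply: continuous_bmeas_bdry => //; exact: C1_continuous (C1_lift hWu). Qed.

Let vv' : isC1 v v'.
Proof. by apply: smooth_isC1; exists W, W'. Qed.

Lemma sqr_norm_radial :
  \int[sig]_(y in bd) (U y ^+ 2) + \int[lam]_(y in om) (V y ^+ 2) =
  omega (n := n) s * (w1 * Wu (a ^+ 2) ^+ 2 + w2 * Wu (b ^+ 2) ^+ 2 + wint a b n (fun r => v r ^+ 2)).
Proof.
rewrite [RHS]mulrDr; congr (_ + _).
  apply: bdry_radial => // [|th th1 _|th th1]; rewrite ?rlift_sph//.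
  by apply: bmeas_integrable => //; exact: bmeasX.
by apply: dom_radial => // [|x _]; [exact: bmeasX|rewrite /rlift enorm_sqr].
Qed.

Lemma form_radial : reduced_form U V (grad V) V =
  omega (n := n) s * q (Wu (a ^+ 2)) (Wu (b ^+ 2)) v v'.
Proof.
have bg i := continuous_bmeas_dom hs (grad_coord_continuous (i := i) (C1_lift hW)).
have [bv bv'] := bmeas_isC1 a b vv'.
have bdI : bmeas `]a, b[ (fun=> d : R) by exact: bmeas_cst.
rewrite /reduced_form (dom_radial hs (h := fun r => v' r ^+ 2)); [|exact: bmeas_dotr|]; last first.
  move=> x _; rewrite (grad_lift hW) dotrZl dotrZr -enorm_sqr; ring.
rewrite (dom_radial hs (h := fun r => C r * v r ^+ 2)); last first.
- by move=> x ox; rewrite hC// /rlift enorm_sqr.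
- by apply: bmeasM => //; exact: bmeasX.
have bm (c : R) (X : E -> R) : bmeas bd X -> bmeas bd (fun y => c * X y).
  by move=> bX; apply: bmeasM => //; exact: bmeas_cst.
have bK : bmeas bd (fun y => kw y * (m * U y - nn * V y) ^+ 2).
  by apply: bmeasM => //; apply: bmeasX => //; apply: bmeasB; exact: bm.
have bP : bmeas bd (fun y => pw y * U y ^+ 2) by apply: bmeasM => //; exact: bmeasX.
rewrite (bdry_radial hs (g1 := k a * (m * Wu (a ^+ 2) - nn * W (a ^+ 2)) ^+ 2)
  (g2 := k b * (m * Wu (b ^+ 2) - nn * W (b ^+ 2)) ^+ 2)) //; first last.
- by move=> th th1; have [_ _ kb _] := sphere_values th1; rewrite kb !rlift_sph.
- by move=> th th1 w10; have [ka _ _ _] := sphere_values th1; rewrite ka// !rlift_sph.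
- exact: bmeas_integrable.
rewrite (bdry_radial hs (g1 := p a * Wu (a ^+ 2) ^+ 2) (g2 := p b * Wu (b ^+ 2) ^+ 2)) //; first last.
- by move=> th th1; have [_ _ _ pb] := sphere_values th1; rewrite pb rlift_sph.
- by move=> th th1 w10; have [_ pa _ _] := sphere_values th1; rewrite pa// rlift_sph.
- exact: bmeas_integrable.
rewrite /qf (wintB n ab); first last.
- by apply: bmeasM => //; exact: bmeasX.
- by apply: bmeasM => //; exact: bmeasX.
rewrite (wintZ n ab); last exact: bmeasX.
ring.
Qed.

End radial_functions.

End quadratic_form.

Lemma Rintegral_weightD (R : realType) (n : nat)
    (mu : {measure set 'rV[R]_n -> \bar R}) (A : set 'rV[R]_n) (w X : 'rV[R]_n -> R) (l : R) :
  measurable A -> bmeas A w -> L2 mu A X ->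
  \int[mu]_(x in A) ((w x + l) * X x ^+ 2) =
  \int[mu]_(x in A) (w x * X x ^+ 2) + l * \int[mu]_(x in A) (X x ^+ 2).
Proof.
move=> mA bw [mX fX]; have iX := integrable_sqr mX fX.
have bl : bmeas A (fun=> l) by exact: bmeas_cst.
have i1 := weighted_integrable mA bw iX; have i2 := weighted_integrable mA bl iX.
rewrite -RintegralZl// -RintegralD//.
by apply: eq_Rintegral => x _; rewrite mulrDl.
Qed.

(** The values at [s] and [- s] are added to cancel [B]; then [s] is small enough for [c * s ^+ 2]
    not to compensate a negative [A]. *)
Lemma quadratic_limit_ge0 (R : realType) (A B c : R) :
  (forall s, s != 0 -> 0 <= A + B * s + c * s ^+ 2) -> 0 <= A.
Proof.
move=> h; rewrite leNgt; apply/negP => A0.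
pose s := Num.min 1 (- A / (2 * (`|c| + 1))).
have c1 : 0 < 2 * (`|c| + 1) by rewrite mulr_gt0// ltr_wpDl.
have s0 : 0 < s by rewrite lt_min ltr01/= divr_gt0// oppr_gt0.
have s1 : s <= 1 by rewrite ge_min lexx.
have sA : s * (2 * (`|c| + 1)) <= - A by rewrite -ler_pdivlMr// ge_min lexx orbT.
have hp := h s; have hm := h (- s).
rewrite oppr_eq0 gt_eqF// in hp hm; have {}hp := hp isT; have {}hm := hm isT.
rewrite sqrrN mulrN in hm.
have cs : c * s ^+ 2 <= `|c| * s.
  apply: le_trans (_ : `|c| * s ^+ 2 <= _).
    by apply: ler_wpM2r; [exact: sqr_ge0|exact: ler_norm].
  by apply: ler_wpM2l => //; rewrite expr2 ler_piMl// ltW.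
lra.
Qed.

(** * The principal eigenvalue and the speed *)

Section eigenvalue_bounds.
Context {R : realType} {n : nat}.
Local Notation E := 'rV[R]_n.+1.
Variables (s : radial_domain R) (d mu nu : R) (kappa : E -> R) (f g : E -> R -> R).
Local Notation om := (dom n.+1 s).
Local Notation bd := (boundary om).
Local Notation lam := (leb n.+1).
Local Notation sig := (bdry_measure s).
Local Notation a := (inner s).
Local Notation b := (outer s).
Local Notation w1 := (@winner R n s).
Local Notation w2 := (@wouter R n s).
Local Notation m := (Num.sqrt mu).
Local Notation nn := (Num.sqrt nu).
Variables (ft gt kt : R -> R).
Hypotheses (hs : admissible s) (d0 : 0 < d) (mu0 : 0 < mu) (nu0 : 0 < nu).
Hypothesis bf : bmeas om (fun y => rderiv0 (f y)).
Hypothesis bft : bmeas `]a, b[ ft.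
Hypothesis hft : forall y, om y -> rderiv0 (f y) = ft (enorm y).
Hypothesis hgt : forall y, bd y -> rderiv0 (g y) = gt (enorm y).
Hypothesis hkt : forall y, bd y -> kappa y = kt (enorm y).
Hypothesis kt0 : forall r, 0 <= kt r.
Let mom : measurable om := measurable_dom hs.
Let mbd : measurable bd := measurable_bdry hs.
Let ab := inner_lt_outer hs.
Let a0 := inner_ge0 hs.

Local Notation energy := (energy s d mu nu kappa f g).
Local Notation Lambda := (Lambda s d mu nu kappa f g).
Local Notation rform D al l := (reduced_form s d m nn (fun y => d * al ^+ 2 + rderiv0 (f y) + l)
  kappa (fun y => D * al ^+ 2 + rderiv0 (g y) + l)).
Local Notation q D al l := (qf a b n d m nn (kt a) (kt b) w1 w2
  (D * al ^+ 2 + gt a + l) (D * al ^+ 2 + gt b + l) (fun r => d * al ^+ 2 + ft r + l)).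
Local Notation nrm U V := (\int[sig]_(y in bd) (U y ^+ 2) + \int[lam]_(y in om) (V y ^+ 2)).

Let bg : bmeas bd (fun y => rderiv0 (g y)).
Proof. by apply: eq_bmeas (bmeas_bdry_radial hs gt) => y /hgt ->. Qed.

Let bmeas_shift (A : set E) (c : R) (w : E -> R) : measurable A -> bmeas A w -> bmeas A (fun y => c + w y).
Proof. by move=> mA bw; apply: bmeasD => //; exact: bmeas_cst. Qed.

Let bCw al l : bmeas om (fun y => d * al ^+ 2 + rderiv0 (f y) + l).
Proof. by apply: bmeasD => //; [exact: bmeas_shift|exact: bmeas_cst]. Qed.

Let bPw D al l : bmeas bd (fun y => D * al ^+ 2 + rderiv0 (g y) + l).
Proof. by apply: bmeasD => //; [exact: bmeas_shift|exact: bmeas_cst]. Qed.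

Let bC al l : bmeas `]a, b[ (fun r => d * al ^+ 2 + ft r + l).
Proof. by do 2 (apply: bmeasD => //; try exact: bmeas_cst). Qed.

Let hC al l y : om y -> d * al ^+ 2 + rderiv0 (f y) + l = d * al ^+ 2 + ft (enorm y) + l.
Proof. by move=> /hft ->. Qed.

Let hp D al l y : bd y -> D * al ^+ 2 + rderiv0 (g y) + l = D * al ^+ 2 + gt (enorm y) + l.
Proof. by move=> /hgt ->. Qed.

Lemma energy_reduced D al l U GU V GV T : L2 sig bd U -> L2 lam om V ->
  energy D al U GU V GV T - l * nrm U V =
  D * \int[sig]_(y in bd) dotr (GU y) (GU y) + rform D al l U V GV T.
Proof.
move=> LU LV; rewrite /energy /Defs.energy /reduced_form.
rewrite (Rintegral_weightD _ mom (bmeas_shift (d * al ^+ 2) mom bf) LV).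
rewrite (Rintegral_weightD _ mbd (bmeas_shift (D * al ^+ 2) mbd bg) LU).
ring.
Qed.

Let dotr_int_ge0 d' (T : measurableType d') (mu' : {measure set T -> \bar R}) (A : set T) (G : T -> E) :
  0 <= \int[mu']_(y in A) dotr (G y) (G y).
Proof. by apply: Rintegral_ge0 => y _; exact: dotr_ge0. Qed.

Local Notation tests D al := [set e | exists U GU V GV T,
    [/\ H1_bdry s U GU, H1 om V GV, trace s V GV T, nrm U V = 1 &
        e = energy D al U GU V GV T]].

(** At the level [- K], with [K] above both potentials, every term of the energy plus [K] is
    nonnegative. Together with [tests_nonempty] this makes [Lambda] a genuine infimum and not a
    default value. *)
Lemma energy_has_lbound D al : 0 <= D -> has_lbound (tests D al).
Proof.
move=> D0.
have [_ [C1 hC1]] := bmeas_shift (d * al ^+ 2) mom bf.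
have [_ [C2 hC2]] := bmeas_shift (D * al ^+ 2) mbd bg.
pose K := Num.max C1 C2.
exists (- K) => _ [U [GU [V [GV [T [hU hV _ e1 ->]]]]]].
have [LU _ _] := hU; have [LV _ _] := hV.
have := energy_reduced D al (- K) GU GV T LU LV; rewrite e1 mulr1 opprK => e2.
suff : 0 <= energy D al U GU V GV T + K by lra.
have neg (mu' : {measure set E -> \bar R}) (A : set E) (w X : E -> R) : measurable A ->
    bmeas A w -> L2 mu' A X -> (forall x, A x -> w x <= 0) ->
    \int[mu']_(x in A) (w x * X x ^+ 2) <= 0.
  move=> mA bw [mX fX] w0; apply: le_trans (_ : \int[mu']_(x in A) (0 : R) <= _).
    apply: le_Rintegral => //.
    - exact: (weighted_integrable mA bw (integrable_sqr mX fX)).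
    - exact: integrable0.
    - by move=> x Ax; rewrite mulr_le0_ge0 ?sqr_ge0// w0.
  by rewrite Rintegral_cst// mul0r.
rewrite e2; apply: addr_ge0; first by rewrite mulr_ge0.
rewrite /reduced_form -addrA; apply: addr_ge0.
  rewrite subr_ge0; apply: le_trans (_ : 0 <= _); last by rewrite mulr_ge0// ltW.
  apply: (neg _ _ _ _ mom (bCw al (- K))) => //.
  move=> y /hC1; rewrite ler_norml => /andP[_ h].
  by rewrite subr_le0 (le_trans h)// le_max lexx.
rewrite subr_ge0; apply: le_trans (_ : 0 <= _).
  apply: (neg _ _ _ _ mbd (bPw D al (- K))) => //.
  move=> y /hC2; rewrite ler_norml => /andP[_ h].
  by rewrite subr_le0 (le_trans h)// le_max lexx orbT.
apply: Rintegral_ge0 => y by_; rewrite mulr_ge0 ?sqr_ge0// hkt//.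
Qed.

Lemma qfZ D al l c u1 u2 v v' : isC1 v v' ->
  q D al l (c * u1) (c * u2) (fun r => c * v r) (fun r => c * v' r) =
  c ^+ 2 * q D al l u1 u2 v v'.
Proof.
move=> hv; have [bv bv'] := bmeas_isC1 a b hv; rewrite /qf.
have bdI (x : R) : bmeas `]a, b[ (fun=> x) by exact: bmeas_cst.
have -> : wint a b n (fun r => d * (c * v' r) ^+ 2 - (d * al ^+ 2 + ft r + l) * (c * v r) ^+ 2) =
    c ^+ 2 * wint a b n (fun r => d * v' r ^+ 2 - (d * al ^+ 2 + ft r + l) * v r ^+ 2).
  rewrite -(wintZ n ab); first by apply: eq_wint => r _; ring.
  exact: (bmeasB (bmeasM (bdI d) (bmeasX 2 bv')) (bmeasM (bC al l) (bmeasX 2 bv))).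
ring.
Qed.

(** Turns a profile into a normalised competitor of the full problem. The condition [u2 != 0] keeps
    the norm positive, so that normalisation is possible. *)
Lemma radial_test D al l u1 u2 v v' : smooth v v' -> u2 != 0 ->
  exists2 e, tests D al e & exists2 c, 0 < c & e - l = c * q D al l u1 u2 v v'.
Proof.
move=> sv u20; have vC1 := smooth_isC1 sv; have [W [W' [hW ev ev']]] := sv.
pose N := omega (n := n) s * (w1 * u1 ^+ 2 + w2 * u2 ^+ 2 + wint a b n (fun r => v r ^+ 2)).
have N0 : 0 < N.
  apply: mulr_gt0; first exact: omega_gt0.
  apply: ltr_wpDr; first by apply: wint_ge0 => // r _; exact: sqr_ge0.
  apply: ltr_wpDl; first by rewrite mulr_ge0 ?sqr_ge0// winner_ge0.
  by rewrite mulr_gt0 ?wouter_gt0// lt_neqAle eq_sym sqrf_eq0 u20 sqr_ge0.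
pose c := (Num.sqrt N)^-1.
have c0 : 0 < c by rewrite invr_gt0 sqrtr_gt0.
have cN : c ^+ 2 * N = 1 by rewrite /c exprVn sqr_sqrtr ?(ltW N0)// mulVf// gt_eqF.
have b2a2 : b ^+ 2 - a ^+ 2 != 0.
  by rewrite gt_eqF// subr_gt0 ltr_pXn2r// ?nnegrE// (le_trans a0)// ltW.
(* [U] is interpolated affinely in [|x| ^+ 2] between [u1] and [u2], which gives a [C^1] function on
   the whole space with the prescribed constants on the spheres. *)
pose p1 := (u2 - u1) / (b ^+ 2 - a ^+ 2).
have hWu := isC1Z c (isC1D (isC1Z p1 isC1_id) (isC1_cst (u1 - p1 * a ^+ 2))).
have hcW := isC1Z c hW.
have ea : c * (p1 * a ^+ 2 + (u1 - p1 * a ^+ 2)) = c * u1 by ring.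
have eb : c * (p1 * b ^+ 2 + (u1 - p1 * a ^+ 2)) = c * u2 by rewrite /p1; field.
have LU := rlift_H1_bdry (n := n) hs hWu; have CV := C1_lift (n := n.+1) hcW.
have e1 := sqr_norm_radial hs hWu hcW; rewrite /= ea eb in e1.
have {}e1 : nrm (rlift (fun x => c * (p1 * x + (u1 - p1 * a ^+ 2))) : E -> R) (rlift (fun x => c * W x) : E -> R) = 1.
  rewrite e1 -cN /N [RHS]mulrCA; congr (_ * _).
  rewrite mulrDr -(wintZ n ab); last by apply: bmeasX; have [] := bmeas_isC1 a b vC1.
  by rewrite ev; congr (_ + _); [ring|apply: eq_wint => r _; ring].
exists (energy D al (rlift (fun x => c * (p1 * x + (u1 - p1 * a ^+ 2)))) (fun=> 0)
   (rlift (fun x => c * W x)) (grad (rlift (fun x => c * W x))) (rlift (fun x => c * W x))).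
  exists (rlift (fun x => c * (p1 * x + (u1 - p1 * a ^+ 2)))), (fun=> 0),
    (rlift (fun x => c * W x)), (grad (rlift (fun x => c * W x))), (rlift (fun x => c * W x)).
  by split => //; [exact: C1_H1|exact: C1_trace].
exists (omega (n := n) s * c ^+ 2).
  by rewrite mulr_gt0 ?exprn_gt0// omega_gt0.
case: LU => LU2 _ _; have [LV2 _ _] := C1_H1 hs CV.
have := energy_reduced D al l (fun=> 0) (grad (rlift (fun x => c * W x))) (rlift (fun x => c * W x)) LU2 LV2.
rewrite e1 mulr1 => ->.
rewrite (_ : \int[sig]_(y in bd) _ = 0); last first.
  by under eq_Rintegral do rewrite -(scale0r 0) dotrZl mul0r; rewrite Rintegral_cst// mul0r.
rewrite mulr0 add0r.
rewrite (form_radial hs d m nn (bCw al l) (bC al l) (@hC al l) hkt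
  (p := fun r => D * al ^+ 2 + gt r + l) (@hp D al l) hWu hcW) /= ea eb.
rewrite -[RHS]mulrA -qfZ// ev ev'; congr (_ * _).
rewrite (_ : (fun r : R => c * W' (r ^+ 2) * (2 * r)) = fun r => c * (W' (r ^+ 2) * (2 * r)))//.
by apply/funext => r; rewrite -mulrA.
Qed.

Lemma tests_nonempty D al : tests D al !=set0.
Proof.
have sc : smooth (fun=> 1 : R) (fun=> 0 : R) by exact: smooth_cst.
by have [e te _] := radial_test D al 0 0 sc (oner_neq0 R); exists e.
Qed.

Lemma Lambda_radial_ge0 D al u1 u2 v v' : 0 <= D -> smooth v v' ->
  0 <= q D al (Lambda D al) u1 u2 v v'.
Proof.
move=> D0 sv.
have pos x : x != 0 -> 0 <= q D al (Lambda D al) u1 x v v'.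
  move=> x0; have [e te [c c0 ec]] := radial_test D al (Lambda D al) u1 sv x0.
  rewrite -(pmulr_rge0 _ c0) -ec subr_ge0.
  exact: (ge_inf (energy_has_lbound al D0) te).
have [->|] := eqVneq u2 0; last exact: pos.
pose P := D * al ^+ 2 + gt b + Lambda D al.
(* The excluded value [u2 = 0] is reached as a limit: [B] and [c] are the coefficients of [x] and
   [x ^+ 2] in the form at [u2 = x]. *)
apply: (quadratic_limit_ge0 (B := - (2 * w2 * kt b * m * nn * v b)) (c := w2 * (kt b * m ^+ 2 - P))).
move=> x /pos; rewrite /qf -/P => /le_trans; apply.
rewrite le_eqVlt; apply/orP; left; apply/eqP; ring.
Qed.

Lemma Lambda_ge D al l : 0 <= D ->
  (forall u1 u2 v v', isC1 v v' -> 0 <= q D al l u1 u2 v v') -> l <= Lambda D al.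
Proof.
move=> D0 q0; apply: lb_le_inf.
  exact: tests_nonempty.
move=> _ [U [GU [V [GV [T [hU hV hT e1 ->]]]]]].
have [LU _ _] := hU; have [LV LG _] := hV.
have := energy_reduced D al l GU GV T LU LV; rewrite e1 mulr1 -subr_ge0 => ->.
apply: addr_ge0; first by rewrite mulr_ge0.
apply: (form_ge0 hs (bCw al l) (bC al l) (@hC al l) hkt
  (p := fun r => D * al ^+ 2 + gt r + l) (@hp D al l)) => //.
exact: ltW.
Qed.

Lemma Lambda_lt D1 D2 al : 0 < D1 -> D1 < D2 -> 0 < al ->
  0 < kt b \/ 0 < kt a /\ 0 < w1 -> Lambda D2 al < Lambda D1 al.
Proof.
move=> D10 D12 al0 kpos; have D20 : 0 < D2 by exact: lt_trans D12.
set l := Lambda D2 al; pose eta := (D2 - D1) * al ^+ 2.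
have eta0 : 0 < eta by rewrite mulr_gt0 ?subr_gt0// exprn_gt0.
have aw : 0 < a \/ w1 = 0.
  by move: hs; rewrite /winner; case: s => [r|r1 r2] /=; [right|move=> /andP[]; left].
have [] := @profile_gap R a b n d m nn (kt a) (kt b) w1 w2 (D2 * al ^+ 2 + gt a + l)
  (D2 * al ^+ 2 + gt b + l) (fun r => d * al ^+ 2 + ft r + l) eta a0 ab d0 _ _ (kt0 a) (kt0 b)
  (winner_ge0 hs) (wouter_gt0 hs) (bC al l) eta0 aw kpos.
- by rewrite sqrtr_gt0.
- by rewrite sqrtr_gt0.
- by move=> u1 u2 v v' sv; apply: Lambda_radial_ge0 => //; exact: ltW.
move=> dl dl0 gap; apply: (@lt_le_trans _ _ (l + dl)); first by rewrite ltrDl.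
apply: Lambda_ge; first exact: ltW.
(* As [D2 * al ^+ 2 = D1 * al ^+ 2 + eta], the gap inequality is exactly nonnegativity of the form
   for [D1] at the level [l + dl]. *)
move=> u1 u2 v v' hv; have := gap u1 u2 _ _ hv; rewrite -subr_ge0 => /le_trans; apply.
have [bv bv'] := bmeas_isC1 a b hv.
have bdI (x : R) : bmeas `]a, b[ (fun=> x) by exact: bmeas_cst.
have bq := bmeasB (bmeasM (bdI d) (bmeasX 2 bv')) (bmeasM (bC al l) (bmeasX 2 bv)).
have bdl := bmeasM (bdI dl) (bmeasX 2 bv).
rewrite le_eqVlt; apply/orP; left; apply/eqP; rewrite /qX /qf.
have -> : wint a b n (fun r => d * v' r ^+ 2 - (d * al ^+ 2 + ft r + (l + dl)) * v r ^+ 2) =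
    wint a b n (fun r => d * v' r ^+ 2 - (d * al ^+ 2 + ft r + l) * v r ^+ 2) -
    dl * wint a b n (fun r => v r ^+ 2).
  rewrite -(wintZ n ab); last exact: bmeasX.
  by rewrite -(wintB n ab)//; apply: eq_wint => r _; ring.
rewrite /eta; ring.
Qed.

Lemma energy_alpha D al al' U GU V GV T : L2 sig bd U -> L2 lam om V ->
  energy D al' U GU V GV T = energy D al U GU V GV T -
  (al' ^+ 2 - al ^+ 2) * (D * \int[sig]_(y in bd) (U y ^+ 2) + d * \int[lam]_(y in om) (V y ^+ 2)).
Proof.
move=> LU LV; rewrite /energy /Defs.energy.
have -> : \int[sig]_(y in bd) ((D * al' ^+ 2 + rderiv0 (g y)) * U y ^+ 2) =
    \int[sig]_(y in bd) ((D * al ^+ 2 + rderiv0 (g y) + D * (al' ^+ 2 - al ^+ 2)) * U y ^+ 2).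
  by apply: eq_Rintegral => y _; ring.
have -> : \int[lam]_(y in om) ((d * al' ^+ 2 + rderiv0 (f y)) * V y ^+ 2) =
    \int[lam]_(y in om) ((d * al ^+ 2 + rderiv0 (f y) + d * (al' ^+ 2 - al ^+ 2)) * V y ^+ 2).
  by apply: eq_Rintegral => y _; ring.
rewrite (Rintegral_weightD _ mom (bmeas_shift (d * al ^+ 2) mom bf) LV).
rewrite (Rintegral_weightD _ mbd (bmeas_shift (D * al ^+ 2) mbd bg) LU).
ring.
Qed.

(** For a fixed competitor [alpha] enters only through [alpha ^+ 2] times the two masses; [x] and
    [y] are the boundary and bulk shares of the unit mass. *)
Lemma Lambda_alpha_ge D al al' K : 0 <= D ->
  (forall x y, 0 <= x -> 0 <= y -> x + y = 1 -> (al' ^+ 2 - al ^+ 2) * (D * x + d * y) <= K) ->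
  Lambda D al - K <= Lambda D al'.
Proof.
move=> D0 hK; apply: lb_le_inf; first exact: tests_nonempty.
move=> _ [U [GU [V [GV [T [hU hV hT e1 ->]]]]]].
have [LU _ _] := hU; have [LV LG _] := hV.
rewrite (energy_alpha D al al' _ _ _ LU LV); apply: lerB; last first.
  by apply: hK => //; apply: Rintegral_ge0 => y _; exact: sqr_ge0.
apply: (ge_inf (energy_has_lbound al D0)).
by exists U, GU, V, GV, T.
Qed.

Lemma Lambda_lipschitz D al al' : 0 <= D ->
  `|Lambda D al - Lambda D al'| <= (D + d) * `|al ^+ 2 - al' ^+ 2|.
Proof.
move=> D0; have d0' := d0.
have h x1 x2 : Lambda D x1 - (D + d) * `|x1 ^+ 2 - x2 ^+ 2| <= Lambda D x2.
  apply: Lambda_alpha_ge => // x y x0 y0 xy; rewrite -normrN opprB.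
  have h1 : 0 <= D * x + d * y <= D + d.
    by apply/andP; split; [rewrite addr_ge0// mulr_ge0// ltW|apply: lerD; apply: ler_piMr; lra].
  move/andP: h1 => [h1 h2]; apply: le_trans (ler_norm _) _; rewrite normrM.
  by rewrite (ger0_norm h1) mulrC ler_wpM2r.
by rewrite ler_norml; have := h al al'; have := h al' al; rewrite (distrC (al' ^+ 2)); lra.
Qed.

(** Makes [- Lambda D al / al] grow at least linearly, so that minimisers in [al] cannot escape to
    infinity. *)
Lemma Lambda_decay D al : 0 <= D -> Lambda D al <= Lambda D 0 - Num.min D d * al ^+ 2.
Proof.
move=> D0; rewrite lerBrDr -[_ * _]opprK; apply: Lambda_alpha_ge => // x y x0 y0 xy.
rewrite expr0n sub0r mulNr lerN2 mulrC; apply: ler_wpM2l; first exact: sqr_ge0.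
rewrite -[Num.min D d]mulr1 -xy mulrDr; apply: lerD; apply: ler_wpM2r => //.
  by rewrite ge_min lexx.
by rewrite ge_min lexx orbT.
Qed.

End eigenvalue_bounds.

(** * Attainment of the infimum defining the speed *)

Section speed_minimiser.
Context {R : realType}.
Implicit Types (L : R -> R) (al x y : R).

(** The quotient is bounded below by [- L 0 / y], which blows up at 0, and by [q * y], which blows
    up at infinity, so it suffices to minimise it over a compact interval. *)
Lemma speed_attained L (K q : R) : 0 <= K -> 0 < q ->
  (forall x y, `|L x - L y| <= K * `|x ^+ 2 - y ^+ 2|) ->
  (forall x, L x <= L 0 - q * x ^+ 2) -> L 0 < 0 ->
  exists2 x, 0 < x & (forall y, 0 < y -> - L x / x <= - L y / y) /\ speed L = - L x / x.
Proof.
move=> K0 q0 lipL decL L0.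
suff [x x0 minx] : exists2 x, 0 < x & forall y, 0 < y -> - L x / x <= - L y / y.
  exists x => //; split => //; apply/eqP; rewrite eq_le; apply/andP; split.
    by apply: ge_inf; [exists (- L x / x) => _ [y y0 <-]; exact: minx|exists x].
  apply: lb_le_inf; first by exists (- L x / x), x.
  by move=> _ [y y0 <-]; exact: minx.
have cL : continuous L.
  move=> x; apply/cvgrPdist_le => /= e e0.
  have c2 : (fun y : R => y ^+ 2) @ x --> x ^+ 2 by exact: exprn_continuous.
  have e1 : 0 < e / (K + 1) by rewrite divr_gt0// ltr_wpDl.
  move/cvgrPdist_le: c2 => /(_ _ e1); apply: filterS => y hy.
  apply: le_trans (lipL x y) _; apply: le_trans (ler_wpM2l K0 hy) _.
  by rewrite mulrCA ler_piMr ?(ltW e0)// ler_pdivrMr ?ltr_wpDl// mul1r lerDl.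
pose F y := - L y / y.
have F1 y : 0 < y -> - L 0 / y <= F y /\ q * y <= F y.
  move=> y0; rewrite /F ler_pM2r ?invr_gt0// ler_pdivlMr// -mulrA -expr2.
  have := decL y; have : 0 <= q * y ^+ 2 by rewrite mulr_ge0 ?sqr_ge0// ltW.
  by move: L0; lra.
have [_ c0] := F1 1 ltr01; rewrite mulr1 in c0; have {}c0 := lt_le_trans q0 c0.
(* Outside [[lo, hi]] one of the two lower bounds exceeds [F 1]; the point 1 is kept inside for
   comparison. *)
pose lo := Num.min 1 (- L 0 / F 1); pose hi := Num.max 1 (F 1 / q).
have lo0 : 0 < lo by rewrite lt_min ltr01 divr_gt0// oppr_gt0.
have lo1 : lo <= 1 by rewrite ge_min lexx.
have hi1 : 1 <= hi by rewrite le_max lexx.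
have cF : {within `[lo, hi], continuous F}.
  apply: continuous_in_subspaceT => y /set_mem /=; rewrite in_itv/= => /andP[ly _].
  apply: cvgM; first by apply: cvgN; exact: cL.
  by apply: cvgV; [rewrite gt_eqF// (lt_le_trans lo0)|exact: cvg_id].
have [x xI minx] := EVT_min (le_trans lo1 hi1) cF.
move: xI; rewrite in_itv/= => /andP[lx _].
exists x => [|y y0]; first exact: lt_le_trans lx.
have F11 : F x <= F 1 by apply: minx; rewrite in_itv/= lo1.
have [h1 h2] := F1 y y0; rewrite -/(F x) -/(F y).
have [ylo|loy] := ltP y lo.
  apply: le_trans F11 (le_trans _ h1); rewrite ler_pdivlMr// mulrC -ler_pdivlMr//.
  by apply: le_trans (ltW ylo) _; rewrite ge_min lexx orbT.
have [hiy|yhi] := ltP hi y; last by apply: minx; rewrite in_itv/= loy.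
apply: le_trans F11 (le_trans _ h2); rewrite mulrC -ler_pdivrMr//.
by apply: le_trans _ (ltW hiy); rewrite le_max lexx orbT.
Qed.

End speed_minimiser.

Theorem theorem3p3 (R : realType) (N : nat) (s : radial_domain R)
  (d mu nu beta M : R) (kappa : 'rV[R]_N -> R) (f g : 'rV[R]_N -> R -> R)
  (hN : (0 < N)%N)
  (hs : admissible s)
  (hconn : connected (dom N s))
  (hd : 0 < d) (hmu : 0 < mu) (hnu : 0 < nu)
  (hbeta : 0 < beta < 1)
  (hkappaC : C1holder beta (boundary (dom N s)) kappa)
  (hkappa0 : forall y, boundary (dom N s) y -> 0 <= kappa y)
  (hkappaN0 : exists2 y, boundary (dom N s) y & kappa y != 0)
  (hfC : C1holder beta (dom N s `*` [set v : R | 0 <= v])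
           (fun p : 'rV[R]_N * R => f p.1 p.2))
  (hgC : C1holder beta (boundary (dom N s) `*` [set u : R | 0 <= u])
           (fun p : 'rV[R]_N * R => g p.1 p.2))
  (hf0 : forall y, dom N s y -> f y 0 = 0)
  (hg0 : forall y, boundary (dom N s) y -> g y 0 = 0)
  (hfdec : forall y, dom N s y ->
     forall v1 v2 : R, 0 < v1 -> v1 < v2 -> f y v2 / v2 < f y v1 / v1)
  (hgdec : forall y, boundary (dom N s) y ->
     forall u1 u2 : R, 0 < u1 -> u1 < u2 -> g y u2 / u2 <= g y u1 / u1)
  (hM : 0 < M)
  (hfM : forall y (v : R), dom N s y -> M <= v -> f y v <= 0)
  (hgM : forall y (u : R), boundary (dom N s) y -> M <= u -> g y u <= 0)
  (hLambda : sup [set Lambda s d mu nu kappa f g D 0 | D in [set D : R | 0 < D]] < 0)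
  (hLambda_f : Lambda_f s d f 0 < 0)
  (hkappa_rad : radial_on (boundary (dom N s)) kappa)
  (hf_rad : radial_on (dom N s) (fun y => rderiv0 (f y)))
  (hg_rad : radial_on (boundary (dom N s)) (fun y => rderiv0 (g y))) :
  (forall D1 D2 : R, 0 < D1 -> D1 < D2 ->
     speed (Lambda s d mu nu kappa f g D1) < speed (Lambda s d mu nu kappa f g D2)) /\
  (forall D1 D2 : R, 0 < D1 -> 0 < D2 ->
     speed (Lambda s d mu nu kappa f g D1) = speed (Lambda_f s d f) ->
     speed (Lambda s d mu nu kappa f g D2) = speed (Lambda_f s d f) -> D1 = D2).
Proof.
suff mono : forall D1 D2 : R, 0 < D1 -> D1 < D2 ->
    speed (Lambda s d mu nu kappa f g D1) < speed (Lambda s d mu nu kappa f g D2).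
  split => // D1 D2 D10 D20 e1 e2; apply/eqP; rewrite eq_le !leNgt.
  apply/andP; split; apply/negP => lt12.
    by have := mono _ _ D20 lt12; rewrite e1 e2 ltxx.
  by have := mono _ _ D10 lt12; rewrite e1 e2 ltxx.
case: N kappa f g hN hconn hkappaC hkappa0 hkappaN0 hfC hgC hf0 hg0 hfdec hgdec hfM hgM
  hLambda hLambda_f hkappa_rad hf_rad hg_rad => // n kappa f g _ _ _ hkappa0 [y0 by0 ky0]
  hfC _ _ _ _ _ _ _ hLambda _ [k hk] hf_rad [gt hgt].
have /andP[beta0 _] := hbeta.
have bf := rderiv0_bmeas hs beta0 hfC hf_rad.
have [ft [bft hft]] := rderiv0_radial hs beta0 hfC hf_rad.
(* [k] is known to be nonnegative only at the radii of the boundary; the absolute value extends this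
   to all radii without changing [kappa]. *)
pose kt r := `|k r|.
have hkt y : boundary (dom n.+1 s) y -> kappa y = kt (enorm y).
  by move=> yb; rewrite /kt -hk// ger0_norm// hkappa0.
have kt0 r : 0 <= kt r by exact: normr_ge0.
(* The point where [kappa] is nonzero lies on one of the spheres. A positive norm rules out the
   inner radius 0 of a ball, so on the inner sphere the domain is an annulus. *)
have kpos : 0 < kt (outer s) \/ 0 < kt (inner s) /\ 0 < @winner R n s.
  have ky : 0 < kt (enorm y0) by rewrite -hkt// lt_neqAle eq_sym ky0 hkappa0.
  have ny := bdry_gt0 hs by0.
  have [e|e] := bdry_enorm hs by0; rewrite e in ky ny; [right|by left].
  split => //; move: ny; rewrite /winner; case: (s) => [r|r1 r2] /=; first by rewrite ltxx.
  exact: exprn_gt0.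
have neg D : 0 < D -> Lambda s d mu nu kappa f g D 0 < 0.
  (* A set without a supremum has [sup] equal to 0, which [hLambda] excludes, so the supremum bounds
     every member. *)
  move=> D0; apply: (le_lt_trans _ hLambda); apply: ub_le_sup; last by exists D.
  have [[]//|/sup_out e] := pselect (has_sup [set Lambda s d mu nu kappa f g D 0 | D in [set D : R | 0 < D]]).
  by move: hLambda; rewrite e ltxx.
pose L := Lambda s d mu nu kappa f g.
have att D : 0 < D -> exists2 x, 0 < x &
    (forall y, 0 < y -> - L D x / x <= - L D y / y) /\ speed (L D) = - L D x / x.
  move=> D0; apply: (@speed_attained _ _ (D + d) (Num.min D d)).
  - by rewrite addr_ge0// ltW.
  - by rewrite lt_min D0.
  - by move=> x y; apply: (Lambda_lipschitz _ _ hs hd bf bft hft hgt hkt kt0); exact: ltW.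
  - by move=> x; apply: (Lambda_decay _ _ hs hd bf bft hft hgt hkt kt0); exact: ltW.
  - exact: neg.
move=> D1 D2 D10 D12; have D20 := lt_trans D10 D12.
rewrite -/(L D1) -/(L D2).
have [x1 x10 [min1 ->]] := att D1 D10; have [x2 x20 [_ ->]] := att D2 D20.
(* The quotient for [D1] is evaluated at the minimiser for [D2], where [Lambda_lt] gives the strict
   inequality. *)
apply: le_lt_trans (min1 _ x20) _; rewrite ltr_pM2r ?invr_gt0// ltrN2.
exact: (Lambda_lt hs hd hmu hnu bf bft hft hgt hkt kt0).
Qed.
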